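(* Let $p\geq 3$ be a prime, let $K$ be a field of characteristic $p$, let $l\geq 1$, and let $G=\exp(\mathfrak{sl}_2(p^l\mathbb{Z}_p))$ be the uniform pro-$p$ group corresponding to the powerful $\mathbb{Z}_p$-Lie algebra $\mathfrak{sl}_2(p^l\mathbb{Z}_p)$. Then the Frobenius pair $(KG,KG^p)$ satisfies the derivation hypothesis.
   Context: Groups and algebras. Put $\epsilon=2$ if $p=2$ and $\epsilon=1$ otherwise. A $\mathbb{Z}_p$-Lie algebra $L$ is powerful if it is free of finite rank over $\mathbb{Z}_p$ and $[L,L]\subseteq p^\epsilon L$. Such $L$ corresponds to a uniform pro-$p$ group $G=\exp(L)$, via a bijection $\exp:L\to G$ with $\exp(u)\exp(v)=\exp\Phi(u,v)$, $\Phi$ the Campbell-Hausdorff series; $\exp(p^kL)=G^{p^k}$. $\mathfrak{sl}_2(p^l\mathbb{Z}_p)$ is the Lie algebra of trace zero $2\times 2$ matrices with entries in $p^l\mathbb{Z}_p$; here $G$ is isomorphic to the congruence subgroup $\ker(\mathrm{SL}_2(\mathbb{Z}_p)\to\mathrm{SL}_2(\mathbb{Z}/p^l\mathbb{Z}))$. $KG=\varprojlim K[G/N]$ over open normal subgroups $N$ of $G$; it is the completion of $K[G]$ for the powers of the augmentation ideal $J$, filtered by $F_n KG=\overline{J^{-n}}$ for $n\leq 0$ and $F_nKG=KG$ for $n>0$. $KG^p$ is the completed group algebra of the subgroup $G^p$, identified with the closure of $K[G^p]$ in $KG$ and given the subspace filtration. Frobenius pairs. $\operatorname{gr}A=\bigoplus_n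 F_nA/F_{n-1}A$ denotes the associated graded ring of a filtered ring $A$ (filtrations $F_nA$, $n\in\mathbb{Z}$, are increasing, exhaustive, multiplicative and separated). Let $A$ be a complete filtered $K$-algebra and $A_1$ a subalgebra with the subspace filtration $F_nA_1=F_nA\cap A_1$. $(A,A_1)$ is a Frobenius pair if: (i) $A_1$ is closed in $A$; (ii) $B:=\operatorname{gr}A$ is a commutative noetherian domain; (iii) the image $B_1$ of $\operatorname{gr}A_1$ in $B$ contains $\{b^p:b\in B\}$; (iv) there are a positive integer $t$ and homogeneous $y_1,\dots,y_t\in B$ with $B=\bigoplus_{\alpha\in\{0,\dots,p-1\}^t}B_1y_1^{\alpha_1}\cdots y_t^{\alpha_t}$. The pair $(KG,KG^p)$ is a Frobenius pair. Derivation hypothesis. If $a\in A$ and $n\ge 0$ satisfy $[a,F_kA]\subseteq F_{k-n}A$ for all $k\in\mathbb{Z}$, then $\{a,-\}_n:B\to B$ is the graded derivation given by $b+F_{k-1}A\mapsto [a,b]+F_{k-n-1}A$ for $b\in F_kA$. A source of derivations for $(A,A_1)$ is $\mathbf{a}=\{a_0,a_1,a_2,\dots\}\subseteq A$ (an indexed family), together with natural numbers $\theta(a_r),\theta_1(a_r)$, such that for all $r\geq 0$ and $k\in\mathbb{Z}$: $[a_r,F_kA]\subseteq F_{k-\theta(a_r)}A$, $[a_r,F_kA_1]\subseteq F_{k-\theta_1(a_r)}A$, and $\theta_1(a_r)-\theta(a_r)\to\infty$ as $r\to\infty$. $\mathcal{S}(A,A_1)$ is the set of all sources of derivations. For a graded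 ideal $I$ of $B$, a homogeneous $Y\in B$ lies in the $\mathbf{a}$-closure of $I$ if $\{a_r,Y\}_{\theta(a_r)}\in I$ for all $r\gg 0$. Let $\mathcal{D}=\operatorname{Der}_{B_1}(B)$ be the set of $B_1$-linear derivations of $B$. $(A,A_1)$ satisfies the derivation hypothesis if for all homogeneous $X,Y\in B$: whenever $Y$ lies in the $\mathbf{a}$-closure of $XB$ for all $\mathbf{a}\in\mathcal{S}(A,A_1)$, then $\mathcal{D}(Y)\subseteq XB$. *)

(* Defs.v *)
From HB Require Import structures.
From mathcomp Require Import all_boot all_order all_algebra zify.
From mathcomp Require Import boolp classical_sets functions cardinality fsbigop.

Set Implicit Arguments.
Unset Strict Implicit.
Unset Printing Implicit Defensive.

Import Order.TTheory GRing.Theory Num.Theory.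
Local Open Scope classical_set_scope.
Local Open Scope quotient_scope.
Local Open Scope ring_scope.

Lemma fsumE (T : choiceType) (M : nmodType) (s : seq T) (F : T -> M) :
  uniq s -> (forall x, F x != 0 -> x \in s) ->
  \sum_(x \in [set: T]) F x = \sum_(x <- s) F x.
Proof.
move=> us sF; rewrite (fsbigE s)//; first by under eq_bigl do rewrite in_setT.
by move=> x _ xs; apply/eqP; apply: contraNT xs => /sF.
Qed.

Lemma big_seq_wid (T : eqType) (M : nmodType) (s r : seq T) (F : T -> M) :
  uniq s -> uniq r -> (forall x, F x != 0 -> x \in s) ->
  (forall x, F x != 0 -> x \in r) ->
  \sum_(x <- s) F x = \sum_(x <- r) F x.
Proof.
move=> us ur sF rF; rewrite (bigID (fun x => F x == 0)) /= big1 ?add0r; last by move=> x /eqP.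
rewrite [RHS](bigID (fun x => F x == 0)) /= [X in _ = X + _]big1 ?add0r; last by move=> x /eqP.
rewrite -big_filter -[RHS]big_filter; apply: perm_big.
rewrite uniq_perm ?filter_uniq// => x; rewrite !mem_filter.
by case: (boolP (F x != 0)) => //= Fx; rewrite sF ?rF.
Qed.

Section GroupAlgebra.
Variables (R : pzRingType) (G : groupType).

Definition fin_supp : {pred (G -> R)} :=
  fun f => `[< finite_set [set x | f x != 0] >].

(** The group ring R[G]: finitely supported functions with the convolution
    product (f * g)(z) = sum_x f(x) g(x^-1 z). *)
Record gralg : Type := GrAlg { gcoef :> G -> R ; _ : gcoef \in fin_supp }.

HB.instance Definition _ := [isSub of gralg for gcoef].
HB.instance Definition _ := gen_eqMixin gralg.
HB.instance Definition _ := gen_choiceMixin gralg.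

Lemma fin_suppP (f : G -> R) :
  f \in fin_supp <-> exists2 s : seq G, uniq s & forall x, f x != 0 -> x \in s.
Proof.
split=> [/asboolP/finite_seqP[s fs]|[s us fs]].
  exists (undup s); first exact: undup_uniq.
  by move=> x fx; rewrite mem_undup; have : [set x | f x != 0] x by []; rewrite fs.
apply/asboolP; apply: (sub_finite_set (B := [set` s])) => [x /fs//|].
by apply/finite_seqP; exists s.
Qed.

Lemma gsuppP (f : gralg) :
  exists2 s : seq G, uniq s & forall x, f x != 0 -> x \in s.
Proof. by apply/fin_suppP; case: f. Qed.

Lemma gralgP (f g : gralg) : f =1 g -> f = g.
Proof. by move=> fg; apply/val_inj/funext. Qed.

Fact fin_supp_zmod_closed : zmod_closed fin_supp.
Proof.
split=> [|f g /fin_suppP[s us fs] /fin_suppP[t ut gt]].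
  by apply/fin_suppP; exists [::] => // x; rewrite eqxx.
apply/fin_suppP; exists (undup (s ++ t)); first exact: undup_uniq.
move=> x; rewrite mem_undup mem_cat; apply: contraR; rewrite negb_or => /andP[xs xt].
have /eqP fx0 : f x == 0 by apply: contraR xs => /fs.
have /eqP gx0 : g x == 0 by apply: contraR xt => /gt.
by apply/eqP; rewrite -[LHS]/(f x - g x) fx0 gx0 subrr.
Qed.
HB.instance Definition _ :=
  GRing.isZmodClosed.Build (G -> R) fin_supp fin_supp_zmod_closed.
HB.instance Definition _ := [SubChoice_isSubZmodule of gralg by <:].

Lemma gcoefD (f g : gralg) x : (f + g) x = f x + g x. Proof. by []. Qed.
Lemma gcoefN (f : gralg) x : (- f) x = - f x. Proof. by []. Qed.
Lemma gcoef0 x : (0 : gralg) x = 0. Proof. by []. Qed.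

Fact gdelta_subproof (a : R) (g : G) : (fun x => if x == g then a else 0) \in fin_supp.
Proof.
apply/fin_suppP; exists [:: g] => // x; rewrite mem_seq1.
by case: ifP => //; rewrite eqxx.
Qed.
Definition gdelta (a : R) (g : G) : gralg := GrAlg (gdelta_subproof a g).

Fact gmul_subproof (f g : gralg) :
  (fun z => \sum_(x \in [set: G]) f x * g (x^-1 * z)%g) \in fin_supp.
Proof.
have [s us fs] := gsuppP f; have [t ut gt] := gsuppP g.
apply/fin_suppP; exists (undup [seq (x * y)%g | x <- s, y <- t]); first exact: undup_uniq.
move=> z; rewrite mem_undup; apply: contraR => zst.
apply/eqP/fsbig1 => x _; case: (eqVneq (f x) 0) => [->|/fs xs]; first by rewrite mul0r.
case: (eqVneq (g (x^-1 * z)%g) 0) => [->|/gt yt]; first by rewrite mulr0.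
case/negP: zst; apply/allpairsP; exists (x, (x^-1 * z)%g); split=> //=.
by rewrite mulVKg.
Qed.
Definition gmul (f g : gralg) : gralg := GrAlg (gmul_subproof f g).

Lemma gmulE (f g : gralg) s z : uniq s -> (forall x, f x != 0 -> x \in s) ->
  gmul f g z = \sum_(x <- s) f x * g (x^-1 * z)%g.
Proof.
move=> us fs; rewrite /= (fsumE us)// => x; apply: contraNT => xs.
suff -> : f x = 0 by rewrite mul0r.
by apply/eqP; apply: contraR xs => /fs.
Qed.

Fact gmulA : associative gmul.
Proof.
move=> f g h; apply/gralgP => z.
have [s us fs] := gsuppP f; have [t ut gt] := gsuppP g.
rewrite (gmulE _ _ us)//.
have [r ur fgr] := gsuppP (gmul f g).
pose r' := undup (r ++ [seq (x * y)%g | x <- s, y <- t]).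
have ur' : uniq r' by exact: undup_uniq.
rewrite (gmulE _ _ ur'); last by move=> x /fgr xr; rewrite mem_undup mem_cat xr.
under [RHS]eq_bigr => w _ do rewrite (gmulE _ _ us)// mulr_suml.
rewrite exchange_big /=; apply: eq_big_seq => x xs.
under [RHS]eq_bigr => w _ do rewrite -mulrA.
rewrite -mulr_sumr; congr (_ * _); rewrite -(@fsumE _ _ r')//; last first.
  move=> w; apply: contraNT; rewrite mem_undup mem_cat negb_or => /andP[_ wst].
  suff -> : g (x^-1 * w)%g = 0 by rewrite mul0r.
  apply/eqP; apply: contraR wst => /gt yt; apply/allpairsP.
  by exists (x, (x^-1 * w)%g); split=> //=; rewrite mulVKg.
rewrite [RHS](reindex_fsbigT (fun y => x * y)%g)/=; last first.
  by exists (fun y => x^-1 * y)%g => y; rewrite ?mulKg ?mulVKg.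
by apply: eq_fsbigr => y _; rewrite mulKg invgM mulgA.
Qed.

Lemma gmul_deltal a x (g : gralg) z : gmul (gdelta a x) g z = a * g (x^-1 * z)%g.
Proof.
rewrite (@gmulE _ _ [:: x])//; last first.
  by move=> y /=; rewrite mem_seq1; case: ifP => //; rewrite eqxx.
by rewrite big_seq1 /= eqxx.
Qed.

Fact gmul1g : left_id (gdelta 1 1%g) gmul.
Proof. by move=> f; apply/gralgP => z; rewrite gmul_deltal mul1r invg1 mul1g. Qed.

Fact gmulg1 : right_id (gdelta 1 1%g) gmul.
Proof.
move=> f; apply/gralgP => z; have [s us fs] := gsuppP f.
pose s' := undup (z :: s).
have us' : uniq s' by exact: undup_uniq.
rewrite (gmulE _ _ us'); last by move=> x /fs; rewrite mem_undup inE => ->; rewrite orbT.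
rewrite (bigD1_seq z) ?mem_undup ?mem_head//= mulVg eqxx mulr1 big1 ?addr0// => x xz.
by rewrite mulg_eq1 eqg_inv (negPf xz) mulr0.
Qed.

Fact gmulDl : left_distributive gmul +%R.
Proof.
move=> f g h; apply/gralgP => z.
have [s us fs] := gsuppP f; have [t ut gt] := gsuppP g.
have [r ur fgr] := gsuppP (f + g).
pose s' := undup (s ++ t ++ r); have us' : uniq s' := undup_uniq _.
rewrite gcoefD !(gmulE _ _ us') -?big_split/=; first by apply: eq_bigr => x _; rewrite mulrDl.
- by move=> x /gt xt; rewrite mem_undup !mem_cat xt orbT.
- by move=> x /fs xt; rewrite mem_undup !mem_cat xt.
- by move=> x /fgr xt; rewrite mem_undup !mem_cat xt !orbT.
Qed.

Fact gmulDr : right_distributive gmul +%R.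
Proof.
move=> f g h; apply/gralgP => z; have [s us fs] := gsuppP f.
rewrite gcoefD !(gmulE _ _ us) -?big_split//=.
by apply: eq_bigr => x _; rewrite mulrDr.
Qed.

HB.instance Definition _ := GRing.Zmodule_isPzRing.Build gralg
  gmulA gmul1g gmulg1 gmulDl gmulDr.

End GroupAlgebra.

Section PushForward.
Variables (R : pzRingType) (G H : groupType) (h : G -> H).

Lemma gmap_sumE (f : gralg R G) s c : uniq s -> (forall x, f x != 0 -> x \in s) ->
  \sum_(x \in [set x | h x = c]) f x = \sum_(x <- s | h x == c) f x.
Proof.
move=> us fs; rewrite fsbig_mkcond (fsumE us) /patch; last first.
  by move=> x; case: ifP => [_ /fs//|]; rewrite eqxx.
rewrite [RHS]big_mkcond; apply: eq_bigr => x _.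
by congr (if _ then _ else _); apply/idP/eqP; rewrite inE.
Qed.

Fact gmap_subproof (f : gralg R G) :
  (fun c => \sum_(x \in [set x | h x = c]) f x) \in @fin_supp R H.
Proof.
have [s us fs] := gsuppP f.
apply/fin_suppP; exists (undup (map h s)); first exact: undup_uniq.
move=> c; rewrite mem_undup; apply: contraR => cs; apply/eqP.
rewrite (gmap_sumE _ us)// big_seq_cond big1// => x /andP[xs /eqP hx].
by case/negP: cs; rewrite -hx map_f.
Qed.
Definition gmap (f : gralg R G) : gralg R H := GrAlg (gmap_subproof f).

Lemma gmapE (f : gralg R G) s c : uniq s -> (forall x, f x != 0 -> x \in s) ->
  gmap f c = \sum_(x <- s | h x == c) f x.
Proof. exact: gmap_sumE. Qed.

Lemma gmapB (f g : gralg R G) : gmap (f - g) = gmap f - gmap g.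
Proof.
apply/gralgP => c; have [s us fs] := gsuppP f; have [t ut gt] := gsuppP g.
have [r ur fgr] := gsuppP (f - g).
pose s' := undup (s ++ t ++ r); have us' : uniq s' := undup_uniq _.
have -> : (gmap f - gmap g) c = gmap f c - gmap g c by [].
rewrite !(gmapE _ us') -?sumrB//.
- by move=> x /gt xt; rewrite mem_undup !mem_cat xt orbT.
- by move=> x /fs xt; rewrite mem_undup !mem_cat xt.
- by move=> x /fgr xt; rewrite mem_undup !mem_cat xt !orbT.
Qed.

Lemma gmap0 : gmap 0 = 0. Proof. by rewrite -(subrr 0) gmapB subrr. Qed.
Lemma gmapN f : gmap (- f) = - gmap f. Proof. by rewrite -sub0r gmapB gmap0 sub0r. Qed.
Lemma gmapD f g : gmap (f + g) = gmap f + gmap g.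
Proof. by rewrite -{1}[g]opprK gmapB gmapN opprK. Qed.

Lemma gmap_delta a x : gmap (gdelta a x) = gdelta a (h x).
Proof.
apply/gralgP => c; rewrite (@gmapE _ [:: x])//; last first.
  by move=> y /=; rewrite mem_seq1; case: ifP => //; rewrite eqxx.
by rewrite big_cons big_nil /= eqxx addr0 eq_sym; case: ifP.
Qed.

Hypothesis hM : {morph h : x y / (x * y)%g}.

Lemma gmapM f g : gmap (f * g) = gmap f * gmap g.
Proof.
apply/gralgP => c; have [s us fs] := gsuppP f; have [t ut gt] := gsuppP g.
have [r ur fgr] := gsuppP (f * g).
pose r' := undup (r ++ [seq (x * y)%g | x <- s, y <- t]).
have ur' : uniq r' by exact: undup_uniq.
rewrite (gmapE _ ur'); last by move=> x /fgr xr; rewrite mem_undup mem_cat xr.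
under eq_bigr => w _ do rewrite [(f * g) w](gmulE _ _ us)//.
rewrite exchange_big /=.
pose q := undup (map h s); have uq : uniq q := undup_uniq _.
rewrite [RHS](_ : _ = gmul (gmap f) (gmap g) c)// [RHS](@gmulE _ _ _ _ q)//; last first.
  move=> d; rewrite (gmapE _ us)// mem_undup; apply: contraR => ds; apply/eqP.
  rewrite big_seq_cond big1// => x /andP[xs /eqP hx].
  by case/negP: ds; rewrite -hx map_f.
transitivity (\sum_(d <- q) \sum_(x <- s) (if h x == d then f x * gmap g (d^-1 * c)%g else 0)).
  rewrite [RHS]exchange_big; apply: eq_big_seq => x xs.
  rewrite [RHS](bigD1_seq (h x)) ?mem_undup ?map_f// eqxx.
  rewrite [X in _ = _ + X]big1 ?addr0; last by move=> d dx; rewrite ifN// eq_sym.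
  rewrite -mulr_sumr; congr (_ * _); rewrite (gmapE _ ut)//.
  rewrite [RHS]big_mkcond /= -(@fsumE _ _ t)//; last first.
    by move=> y; case: ifP; rewrite ?eqxx// => _ /gt.
  rewrite [LHS]big_mkcond /= -(@fsumE _ _ r')//; last first.
    move=> w; case: ifP; rewrite ?eqxx// => _ /gt yt.
    rewrite mem_undup mem_cat; apply/orP; right; apply/allpairsP.
    by exists (x, (x^-1 * w)%g); split=> //=; rewrite mulVKg.
  rewrite [LHS](reindex_fsbigT (fun y => x * y)%g)/=; last first.
    by exists (fun y => x^-1 * y)%g => y; rewrite ?mulKg ?mulVKg.
  apply: eq_fsbigr => y _; rewrite mulKg hM; congr (if _ then _ else _).
  by rewrite -(inj_eq (@mulgI _ (h x)^-1%g)) mulKg.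
apply: eq_bigr => d _; rewrite (@gmapE f s d us fs) mulr_suml [RHS]big_mkcond.
by apply: eq_bigr => x _; case: ifP.
Qed.

Lemma gmap1 : gmap 1 = 1.
Proof.
have h1 : h 1%g = 1%g by apply: (@mulgI _ (h 1%g)); rewrite -hM !mulg1.
by rewrite [LHS]gmap_delta h1.
Qed.

End PushForward.

Lemma gmap_comp (R : pzRingType) (G H L : groupType) (h : G -> H) (k : H -> L)
    (f : gralg R G) : gmap k (gmap h f) = gmap (k \o h) f.
Proof.
apply/gralgP => c; have [s us fs] := gsuppP f.
rewrite (gmapE _ _ us)//.
pose t := undup (map h s); have ut : uniq t := undup_uniq _.
rewrite (@gmapE _ _ _ _ _ t)//; last first.
  move=> d; rewrite (gmapE _ _ us)// mem_undup; apply: contraR => ds; apply/eqP.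
  rewrite big_seq_cond big1// => x /andP[xs /eqP hx].
  by case/negP: ds; rewrite -hx map_f.
under eq_bigr => d _ do rewrite (gmapE _ _ us)// big_mkcond.
rewrite exchange_big /= [RHS]big_mkcond; apply: eq_big_seq => x xs /=.
rewrite big_mkcond (bigD1_seq (h x)) ?mem_undup ?map_f//= eqxx big1 ?addr0// => d dx.
by rewrite [h x == d]eq_sym (negPf dx) if_same.
Qed.

Lemma eq_gmap (R : pzRingType) (G H : groupType) (h k : G -> H) (f : gralg R G) :
  h =1 k -> gmap h f = gmap k f.
Proof. by move=> /funext ->. Qed.

Definition is_subgroup (G : groupType) (H : set G) : Prop :=
  H 1%g /\ forall x y, H x -> H y -> H (x * y^-1)%g.

Section Quotient.
Variable G : groupType.

Record nsubgroup : Type := NSubgroup {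
  nsg :> G -> Prop ;
  nsgP : is_subgroup nsg ;
  nsgJ : forall x y, nsg x -> nsg (x ^ y)%g }.

Section QuotientBy.
Variable N : nsubgroup.

Lemma nsg1 : N 1%g. Proof. by case: (nsgP N). Qed.
Lemma nsgV x : N x -> N x^-1%g.
Proof. by move=> Nx; rewrite -[x^-1%g]mul1g; apply: (nsgP N).2 => //; apply: nsg1. Qed.
Lemma nsgM x y : N x -> N y -> N (x * y)%g.
Proof. by move=> Nx Ny; rewrite -[y]invgK; apply: (nsgP N).2 => //; apply: nsgV. Qed.

Definition coset_rel : rel G := fun x y => `[< N (x^-1 * y)%g >].

Fact coset_rel_equiv : equiv_class_of coset_rel.
Proof.
have sym x y : coset_rel x y -> coset_rel y x.
  by move=> /asboolP/nsgV; rewrite invgM invgK => ?; apply/asboolP.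
split=> [x|x y|y x z].
- by apply/asboolP; rewrite mulVg; apply: nsg1.
- by apply/idP/idP; apply: sym.
- move=> /asboolP xy /asboolP yz; apply/asboolP.
  by have := nsgM xy yz; rewrite -mulgA mulVKg.
Qed.
Canonical coset_rel_equivRel := EquivRelPack coset_rel_equiv.
Canonical coset_rel_encModRel := defaultEncModRel coset_rel.

Definition quotg : Type := {eq_quot coset_rel}.
HB.instance Definition _ : EqQuotient G coset_rel quotg := EqQuotient.on quotg.
HB.instance Definition _ := Choice.on quotg.

Definition coset (x : G) : quotg := \pi x.

Lemma cosetP x y : coset x = coset y <-> N (x^-1 * y)%g.
Proof.
split=> [/eqP|Nxy]; first by rewrite piE => /asboolP.
by apply/eqP; rewrite piE; apply/asboolP.
Qed.

Lemma coset_repr c : coset (repr c) = c. Proof. exact: reprK. Qed.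

Definition quotg_mul (c d : quotg) : quotg := coset (repr c * repr d)%g.
Definition quotg_inv (c : quotg) : quotg := coset (repr c)^-1%g.

Lemma cosetMr x y : quotg_mul (coset x) (coset y) = coset (x * y)%g.
Proof.
apply/cosetP; set x' := repr _; set y' := repr _.
have /cosetP Nx : coset x' = coset x by exact: coset_repr.
have /cosetP Ny : coset y' = coset y by exact: coset_repr.
suff -> : ((x' * y')^-1 * (x * y) = (y'^-1 * y) * ((x'^-1 * x) ^ y))%g.
  by apply: nsgM => //; apply: nsgJ.
by rewrite conjgE !invgM !mulgA mulgK.
Qed.

Lemma cosetVr x : quotg_inv (coset x) = coset x^-1%g.
Proof.
apply/cosetP; set x' := repr _.
have /cosetP Nx : coset x' = coset x by exact: coset_repr.
rewrite invgK; have := nsgJ x^-1%g (nsgV Nx).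
by rewrite conjgE invgM !invgK mulgA mulVKg.
Qed.

Fact quotg_mulA : associative quotg_mul.
Proof.
move=> a b c; rewrite -(coset_repr a) -(coset_repr b) -(coset_repr c).
by rewrite !cosetMr mulgA.
Qed.
Fact quotg_mul1 : left_id (coset 1%g) quotg_mul.
Proof. by move=> a; rewrite -(coset_repr a) cosetMr mul1g. Qed.
Fact quotg_mulr1 : right_id (coset 1%g) quotg_mul.
Proof. by move=> a; rewrite -(coset_repr a) cosetMr mulg1. Qed.
Fact quotg_mulV : left_inverse (coset 1%g) quotg_inv quotg_mul.
Proof. by move=> a; rewrite -(coset_repr a) cosetVr cosetMr mulVg. Qed.
Fact quotg_mulrV : right_inverse (coset 1%g) quotg_inv quotg_mul.
Proof. by move=> a; rewrite -(coset_repr a) cosetVr cosetMr mulgV. Qed.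

HB.instance Definition _ := isGroup.Build quotg
  quotg_mulA quotg_mul1 quotg_mulr1 quotg_mulV quotg_mulrV.

Lemma cosetM : {morph coset : x y / (x * y)%g}.
Proof. by move=> x y; rewrite -cosetMr. Qed.
End QuotientBy.

(** the projection G/N -> G/M, meaningful when N is contained in M *)
Definition quotg_map (N M : nsubgroup) (c : quotg N) : quotg M := coset M (repr c).

Lemma quotg_map_coset (N M : nsubgroup) x : nsg N `<=` nsg M ->
  quotg_map M (coset N x) = coset M x.
Proof. by move=> NM; apply/cosetP/NM/cosetP; rewrite coset_repr. Qed.

Lemma quotg_mapM (N M : nsubgroup) : nsg N `<=` nsg M ->
  {morph @quotg_map N M : x y / (x * y)%g}.
Proof.
move=> NM x y; rewrite -(coset_repr x) -(coset_repr y) -cosetM.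
by rewrite !quotg_map_coset// cosetM.
Qed.

End Quotient.

Section CompletedGroupAlgebra.
Variables (K : pzRingType) (G : groupType) (tau : set (set G)).

(** KG is the inverse limit of the K[G/N] over the normal subgroups N which
    are open, i.e. belong to the topology [tau] of G *)
Definition open_nsubgroup : Type := {N : nsubgroup G | tau (nsg N)}.

Record cga : Type := CGA {
  cga_proj : forall N : open_nsubgroup, gralg K (quotg (sval N)) ;
  _ : forall N M : open_nsubgroup, nsg (sval N) `<=` nsg (sval M) ->
      gmap (@quotg_map G (sval N) (sval M)) (cga_proj N) = cga_proj M }.

HB.instance Definition _ := gen_eqMixin cga.
HB.instance Definition _ := gen_choiceMixin cga.

Lemma cga_compat (x : cga) (N M : open_nsubgroup) : nsg (sval N) `<=` nsg (sval M) ->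
  gmap (@quotg_map G (sval N) (sval M)) (cga_proj x N) = cga_proj x M.
Proof. by case: x => x; apply. Qed.

Lemma cgaP (x y : cga) : (forall N, cga_proj x N = cga_proj y N) -> x = y.
Proof.
case: x y => [x Hx] [y Hy] /= xy; have {}xy : x = y by exact: functional_extensionality_dep.
by case: _ / xy Hy => Hy; congr CGA; exact: Prop_irrelevance.
Qed.

Program Definition cga0 : cga := @CGA (fun=> 0) _.
Next Obligation. by rewrite gmap0. Qed.
Program Definition cga1 : cga := @CGA (fun=> 1) _.
Next Obligation. by rewrite gmap1//; apply: quotg_mapM. Qed.
Program Definition cgaN (x : cga) : cga := @CGA (fun N => - cga_proj x N) _.
Next Obligation. by rewrite gmapN cga_compat. Qed.
Program Definition cgaD (x y : cga) : cga :=
  @CGA (fun N => cga_proj x N + cga_proj y N) _.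
Next Obligation. by rewrite gmapD !cga_compat. Qed.
Program Definition cgaM (x y : cga) : cga :=
  @CGA (fun N => cga_proj x N * cga_proj y N) _.
Next Obligation. by rewrite gmapM ?cga_compat//; apply: quotg_mapM. Qed.

Fact cgaDA : associative cgaD. Proof. by move=> *; apply/cgaP => N /=; rewrite addrA. Qed.
Fact cgaDC : commutative cgaD. Proof. by move=> *; apply/cgaP => N /=; rewrite addrC. Qed.
Fact cga0D : left_id cga0 cgaD. Proof. by move=> *; apply/cgaP => N /=; rewrite add0r. Qed.
Fact cgaND : left_inverse cga0 cgaN cgaD.
Proof. by move=> *; apply/cgaP => N /=; rewrite addNr. Qed.
HB.instance Definition _ := GRing.isZmodule.Build cga cgaDA cgaDC cga0D cgaND.

Fact cgaMA : associative cgaM. Proof. by move=> *; apply/cgaP => N /=; rewrite mulrA. Qed.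
Fact cga1M : left_id cga1 cgaM. Proof. by move=> *; apply/cgaP => N /=; rewrite mul1r. Qed.
Fact cgaM1 : right_id cga1 cgaM. Proof. by move=> *; apply/cgaP => N /=; rewrite mulr1. Qed.
Fact cgaMDl : left_distributive cgaM +%R.
Proof. by move=> *; apply/cgaP => N /=; rewrite mulrDl. Qed.
Fact cgaMDr : right_distributive cgaM +%R.
Proof. by move=> *; apply/cgaP => N /=; rewrite mulrDr. Qed.
HB.instance Definition _ :=
  GRing.Zmodule_isPzRing.Build cga cgaMA cga1M cgaM1 cgaMDl cgaMDr.

Program Definition cga_of (f : gralg K G) : cga :=
  @CGA (fun N => gmap (coset (sval N)) f) _.
Next Obligation.
by rewrite gmap_comp; apply: eq_gmap => x /=; rewrite quotg_map_coset.
Qed.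

Lemma cga_ofB : {morph cga_of : f g / f - g}.
Proof. by move=> f g; apply/cgaP => N /=; rewrite gmapB. Qed.
Lemma cga_ofM : {morph cga_of : f g / f * g}.
Proof. by move=> f g; apply/cgaP => N /=; rewrite gmapM//; apply: cosetM. Qed.
Lemma cga_of1 : cga_of 1 = 1.
Proof. by apply/cgaP => N /=; rewrite gmap1//; apply: cosetM. Qed.

(** Closure for the inverse limit topology, each K[G/N] being discrete.  One N
    at a time suffices since the open normal subgroups are closed under finite
    intersections. *)
Definition cga_closure (S : set cga) : set cga :=
  [set x | forall N, exists2 s, S s & cga_proj s N = cga_proj x N].

End CompletedGroupAlgebra.

Arguments cga_of {K G} tau f.

(** Increasing, exhaustive, multiplicative Z-filtrations.  Separatedness plays
    no role in the definition of gr A, hence is not recorded. *)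
Record filtration (A : pzRingType) : Type := Filtration {
  fil :> int -> A -> Prop ;
  fil_le : forall k m x, k <= m -> fil k x -> fil m x ;
  fil0 : forall k, fil k 0 ;
  filB : forall k x y, fil k x -> fil k y -> fil k (x - y) ;
  fil1 : fil 0 1 ;
  filM : forall k m x y, fil k x -> fil m y -> fil (k + m) (x * y) ;
  fil_exhaustive : forall x, exists k, fil k x }.

Section AssociatedGraded.
Variables (A : pzRingType) (F : filtration A).

Lemma filN k x : F k x -> F k (- x).
Proof. by move=> Fx; rewrite -sub0r; apply: filB => //; apply: fil0. Qed.
Lemma filD k x y : F k x -> F k y -> F k (x + y).
Proof. by move=> Fx Fy; rewrite -[y]opprK; apply: filB => //; apply: filN. Qed.
Lemma fil_sum k (I : eqType) (s : seq I) (f : I -> A) :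
  (forall i, i \in s -> F k (f i)) -> F k (\sum_(i <- s) f i).
Proof.
move=> sF; rewrite big_seq; elim/big_ind: _ => //; [exact: fil0|exact: filD].
Qed.

(** Laurent polynomials over A: the group ring A[Z], [f k] being the
    coefficient of t^k *)
Local Notation laurent := (gralg A (Algebra.to_multiplicative int)).

(** The Rees ring of F: those Laurent polynomials sum_k a_k t^k with a_k in
    F_k A.  Its quotient by the two-sided ideal of those with a_k in F_(k-1) A
    is the direct sum of the F_k A / F_(k-1) A with the induced product, i.e.
    gr A. *)
Definition rees_pred : {pred laurent} := fun f => `[< forall k : int, F k (f k) >].

Lemma rees_predP f : f \in rees_pred <-> forall k : int, F k (f k).
Proof. by split=> /asboolP. Qed.

Lemma laurentM (f g : laurent) (s : seq int) (k : int) :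
  uniq s -> (forall i : int, f i != 0 -> i \in s) ->
  (f * g) k = \sum_(i <- s) f i * g (k - i).
Proof.
move=> us fs; rewrite [LHS](@gmulE A (Algebra.to_multiplicative int) f g s k us fs).
by apply: eq_bigr => i _; congr (_ * g _); rewrite addrC.
Qed.

Fact rees_subring_closed : subring_closed rees_pred.
Proof.
split.
- apply/rees_predP => k; rewrite [(1 : laurent) k]/=.
  by case: eqP => [->|_]; [exact: fil1|exact: fil0].
- by move=> f g /rees_predP Ff /rees_predP Fg; apply/rees_predP => k; apply: filB.
- move=> f g /rees_predP Ff /rees_predP Fg; apply/rees_predP => k.
  have [s us fs] := gsuppP f; rewrite (laurentM _ _ us)//.
  apply: fil_sum => i _; have -> : k = i + (k - i) by rewrite addrC subrK.
  by rewrite [i + (k - i) - i]addrC addKr; apply: filM.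
Qed.
HB.instance Definition _ := GRing.isSubringClosed.Build laurent rees_pred
  rees_subring_closed.

Record rees : Type := Rees { rees_val :> laurent ; _ : rees_val \in rees_pred }.
HB.instance Definition _ := [isSub of rees for rees_val].
HB.instance Definition _ := gen_eqMixin rees.
HB.instance Definition _ := gen_choiceMixin rees.
HB.instance Definition _ := [SubChoice_isSubZmodule of rees by <:].
HB.instance Definition _ :=
  GRing.SubZmodule_isSubPzRing.Build laurent rees_pred rees rees_subring_closed.

Lemma reesP (f : rees) (k : int) : F k (f k).
Proof. by case: f => f /= /rees_predP. Qed.

Definition rees_lower : {pred rees} := fun f => `[< forall k : int, F (k - 1) (f k) >].

Lemma rees_lowerP f : f \in rees_lower <-> forall k : int, F (k - 1) (f k).
Proof. by split=> /asboolP. Qed.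

Fact rees_lower_zmod_closed : zmod_closed rees_lower.
Proof.
split; first by apply/rees_lowerP => k; apply: fil0.
by move=> f g /rees_lowerP Ff /rees_lowerP Fg; apply/rees_lowerP => k; apply: filB.
Qed.
HB.instance Definition _ := GRing.isZmodClosed.Build rees rees_lower
  rees_lower_zmod_closed.

Lemma rees_lowerMl f g : g \in rees_lower -> f * g \in rees_lower.
Proof.
move=> /rees_lowerP Fg; apply/rees_lowerP => k.
have [s us fs] := gsuppP (rees_val f); rewrite (laurentM _ _ us)//.
apply: fil_sum => i _; have -> : k - 1 = i + (k - i - 1) by rewrite addrA addrCA subrr addr0.
by apply: filM => //; apply: reesP.
Qed.

Lemma rees_lowerMr f g : f \in rees_lower -> f * g \in rees_lower.
Proof.
move=> /rees_lowerP Ff; apply/rees_lowerP => k.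
have [s us fs] := gsuppP (rees_val f); rewrite (laurentM _ _ us)//.
apply: fil_sum => i _; have -> : k - 1 = (i - 1) + (k - i).
  by rewrite [RHS]addrC addrA subrK.
by apply: filM => //; apply: reesP.
Qed.

Definition gr : Type := Quotient.quot rees_lower.
HB.instance Definition _ := GRing.Zmodule.on gr.

Definition gr_pi (f : rees) : gr := \pi_gr f.
Definition gr_repr (y : gr) : rees := repr y.

Lemma gr_reprK y : gr_pi (gr_repr y) = y. Proof. exact: reprK. Qed.
Lemma gr_piP f g : gr_pi f = gr_pi g <-> f - g \in rees_lower.
Proof.
split=> [/eqP|fg]; last apply/eqP.
  by rewrite /gr_pi -[_ == _]Quotient.idealrBE.
by rewrite /gr_pi -[_ == _]Quotient.idealrBE.
Qed.
Lemma gr_piD : {morph gr_pi : f g / f + g}.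
Proof. by move=> f g; apply: (@pi_addr _ _ _ _ _ (Quotient.quot rees_lower)). Qed.
Lemma gr_piB : {morph gr_pi : f g / f - g}.
Proof.
move=> f g; rewrite gr_piD; congr (_ + _).
exact: (@pi_oppr _ _ _ _ _ (Quotient.quot rees_lower)).
Qed.

Definition gr_mul (x y : gr) : gr := gr_pi (gr_repr x * gr_repr y).

Lemma gr_mulE f g : gr_mul (gr_pi f) (gr_pi g) = gr_pi (f * g).
Proof.
apply/gr_piP; set f' := gr_repr _; set g' := gr_repr _.
have /gr_piP Ff : gr_pi f' = gr_pi f by exact: gr_reprK.
have /gr_piP Fg : gr_pi g' = gr_pi g by exact: gr_reprK.
have -> : f' * g' - f * g = (f' - f) * g' + f * (g' - g).
  by rewrite mulrBl mulrBr addrA subrK.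
by apply: rpredD; [apply: rees_lowerMr|apply: rees_lowerMl].
Qed.

Fact gr_mulA : associative gr_mul.
Proof.
by move=> x y z; rewrite -(gr_reprK x) -(gr_reprK y) -(gr_reprK z) !gr_mulE mulrA.
Qed.
Fact gr_mul1 : left_id (gr_pi 1) gr_mul.
Proof. by move=> x; rewrite -(gr_reprK x) gr_mulE mul1r. Qed.
Fact gr_mulr1 : right_id (gr_pi 1) gr_mul.
Proof. by move=> x; rewrite -(gr_reprK x) gr_mulE mulr1. Qed.
Fact gr_mulDl : left_distributive gr_mul +%R.
Proof.
move=> x y z; rewrite -(gr_reprK x) -(gr_reprK y) -(gr_reprK z).
by rewrite -gr_piD !gr_mulE mulrDl gr_piD.
Qed.
Fact gr_mulDr : right_distributive gr_mul +%R.
Proof.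
move=> x y z; rewrite -(gr_reprK x) -(gr_reprK y) -(gr_reprK z).
by rewrite -gr_piD !gr_mulE mulrDr gr_piD.
Qed.
HB.instance Definition _ := GRing.Zmodule_isPzRing.Build gr
  gr_mulA gr_mul1 gr_mulr1 gr_mulDl gr_mulDr.

Fact gr_cls_subproof (k : int) (a : A) : F k a ->
  @gdelta A (Algebra.to_multiplicative int) a k \in rees_pred.
Proof.
move=> Fa; apply/rees_predP => m; rewrite /=.
by case: eqP => [->//|_]; apply: fil0.
Qed.

(** [gr_cls k a] is a + F_(k-1) A in degree k if a lies in F_k A (junk value 0
    otherwise) *)
Definition gr_cls (k : int) (a : A) : gr :=
  if pselect (F k a) is left Fa then gr_pi (Rees (gr_cls_subproof Fa)) else 0.

Definition homogeneous (y : gr) : Prop := exists k a, F k a /\ y = gr_cls k a.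

Definition principal_ideal (x : gr) : set gr := [set y | exists b, y = x * b].

(** The image of gr A1 in gr A, A1 having the subspace filtration
    F_k A1 = F_k A /\ A1: classes whose components have representatives in A1. *)
Definition gr_sub (A1 : set A) : set gr :=
  [set y | exists f : rees, (forall k : int, A1 (f k)) /\ y = gr_pi f].

Definition commutator (a b : A) : A := a * b - b * a.

(** The map b + F_(k-1) A |-> [a, b] + F_(k-n-1) A on gr A.  It does not depend
    on the representatives as soon as [a, F_k A] is in F_(k-n) A for all k. *)
Definition gr_der (a : A) (n : nat) (y : gr) : gr :=
  \sum_(k \in [set: int]) gr_cls (k - n%:Z) (commutator a (gr_repr y k)).

Definition derivation (B1 : set gr) (D : gr -> gr) : Prop :=
  [/\ forall x y, D (x + y) = D x + D y,
      forall x y, D (x * y) = D x * y + x * D y &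
      forall b x, B1 b -> D (b * x) = b * D x].

Variable A1 : set A.

(** theta and theta1 are attached to the index r of the family *)
Record derivation_source : Type := DerivationSource {
  src :> nat -> A ;
  theta : nat -> nat ;
  theta1 : nat -> nat ;
  src_theta : forall r (k : int) b, F k b -> F (k - (theta r)%:Z) (commutator (src r) b) ;
  src_theta1 : forall r (k : int) b, F k b -> A1 b ->
    F (k - (theta1 r)%:Z) (commutator (src r) b) ;
  theta_infty : forall M : nat, exists r0 : nat, forall r : nat, (r0 <= r)%N ->
    (theta r + M <= theta1 r)%N }.

Definition in_source_closure (a : derivation_source) (I : set gr) (y : gr) : Prop :=
  exists r0 : nat, forall r : nat, (r0 <= r)%N -> I (gr_der (a r) (theta a r) y).

(** X and Y range over the homogeneous elements of B = gr A, B1 is the image of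
    gr A1, and the conclusion is D(Y) in XB for every D in Der_(B1)(B). *)
Definition derivation_hypothesis : Prop :=
  forall X Y : gr, homogeneous X -> homogeneous Y ->
    (forall a : derivation_source, in_source_closure a (principal_ideal X) Y) ->
    forall D : gr -> gr, derivation (gr_sub A1) D -> principal_ideal X (D Y).

End AssociatedGraded.

Section AugmentationFiltration.
Variables (K : pzRingType) (G : groupType).

Definition aug_ideal : set (gralg K G) :=
  [set f | \sum_(x \in [set: G]) f x = 0].

Fixpoint aug_power (m : nat) : set (gralg K G) :=
  if m is m'.+1 then
    [set f | exists s : seq (gralg K G * gralg K G),
      (forall u, u \in s -> aug_power m' u.1 /\ aug_ideal u.2) /\
      f = \sum_(u <- s) u.1 * u.2]
  else setT.

Lemma aug_power0 m : aug_power m 0.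
Proof. by case: m => [//|m]; exists [::]; rewrite big_nil. Qed.

Lemma aug_powerD m f g : aug_power m f -> aug_power m g -> aug_power m (f + g).
Proof.
case: m => [//|m] [s [sP ->]] [t [tP ->]]; exists (s ++ t); split; last by rewrite big_cat.
by move=> u; rewrite mem_cat => /orP[/sP|/tP].
Qed.

Lemma aug_powerN m f : aug_power m f -> aug_power m (- f).
Proof.
elim: m f => [//|m IH] f [s [sP ->]]; exists [seq (- u.1, u.2) | u <- s]; split.
  by move=> _ /mapP[u /sP[u1 u2] ->]; split=> //=; apply: IH.
by rewrite big_map -sumrN; apply: eq_bigr => u _; rewrite mulNr.
Qed.

Lemma aug_powerB m f g : aug_power m f -> aug_power m g -> aug_power m (f - g).
Proof. by move=> ? ?; apply: aug_powerD => //; apply: aug_powerN. Qed.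

Lemma aug_power_sum m (s : seq (gralg K G * gralg K G)) (F : _ -> gralg K G) :
  (forall u, u \in s -> aug_power m (F u)) -> aug_power m (\sum_(u <- s) F u).
Proof.
move=> sF; rewrite big_seq; elim/big_ind: _ => //; [exact: aug_power0|exact: aug_powerD].
Qed.

Lemma aug_gmap (f : gralg K G) :
  \sum_(x \in [set: G]) f x = gmap (fun=> 1%g : G) f 1%g :> K.
Proof.
have [s us fs] := gsuppP f; rewrite (fsumE us)// (gmapE _ _ us)//.
by apply: eq_bigl => x; rewrite eqxx.
Qed.

Lemma aug_idealP (f : gralg K G) : aug_ideal f <-> gmap (fun=> 1%g : G) f = 0.
Proof.
split=> [f0|f0]; last by rewrite /aug_ideal /= aug_gmap f0.
have [s us fs] := gsuppP f.
apply/gralgP => c; case: (eqVneq c 1%g) => [->|c1]; first by rewrite -aug_gmap.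
by rewrite (gmapE _ _ us)// big_pred0// => x; rewrite eq_sym (negPf c1).
Qed.

Lemma aug_idealMl f g : aug_ideal g -> aug_ideal (f * g).
Proof.
move=> /aug_idealP g0; apply/aug_idealP; rewrite gmapM ?g0 ?mulr0//.
by move=> x y; rewrite mulg1.
Qed.

Lemma aug_powerMl m f g : aug_power m g -> aug_power m (f * g).
Proof.
elim: m f g => [//|m IH] f g [s [sP ->]].
exists [seq (f * u.1, u.2) | u <- s]; split.
  by move=> _ /mapP[u /sP[u1 u2] ->]; split=> //=; apply: IH.
by rewrite big_map mulr_sumr; apply: eq_bigr => u _; rewrite mulrA.
Qed.

Lemma aug_powerMr m f g : aug_power m f -> aug_power m (f * g).
Proof.
case: m f => [//|m] f [s [sP ->]].
suff H u : aug_ideal u -> aug_ideal (u * g).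
  exists [seq (u.1, u.2 * g) | u <- s]; split.
    by move=> _ /mapP[u /sP[u1 u2] ->]; split=> //=; apply: H.
  by rewrite big_map mulr_suml; apply: eq_bigr => u _; rewrite mulrA.
move=> /aug_idealP u0; apply/aug_idealP; rewrite gmapM ?u0 ?mul0r//.
by move=> x y; rewrite mulg1.
Qed.

Lemma aug_powerS m f : aug_power m.+1 f -> aug_power m f.
Proof.
by move=> [s [sP ->]]; apply: aug_power_sum => u /sP[u1 _]; apply: aug_powerMr.
Qed.

Lemma aug_power_le m n f : (m <= n)%N -> aug_power n f -> aug_power m f.
Proof.
by move=> /subnK <-; elim: (n - m)%N => [//|k IH]; rewrite addSn => /aug_powerS/IH.
Qed.

Lemma aug_powerM m n f g : aug_power m f -> aug_power n g -> aug_power (m + n) (f * g).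
Proof.
elim: n m f g => [|n IH] m f g fm; first by rewrite addn0 => _; apply: aug_powerMr.
move=> [s [sP ->]]; rewrite addnS; exists [seq (f * u.1, u.2) | u <- s]; split.
  by move=> _ /mapP[u /sP[u1 u2] ->]; split=> //=; apply: IH.
by rewrite big_map mulr_sumr; apply: eq_bigr => u _; rewrite mulrA.
Qed.

Variable tau : set (set G).
Local Notation KG := (cga K tau).

(** F_k KG is the closure of J^(-k) for k <= 0, and KG for k > 0 *)
Definition cga_fil (k : int) : KG -> Prop :=
  if (0 < k) then setT else cga_closure (cga_of tau @` aug_power `|k|%N).

Lemma cga_filP k x : k <= 0 -> cga_fil k x <->
  forall N, exists2 f, aug_power `|k|%N f & cga_proj (cga_of tau f) N = cga_proj x N.
Proof.
move=> k0; rewrite /cga_fil ltNge k0 /=; split=> xN N; have [f] := xN N.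
  by move=> [g gk <-] gx; exists g.
by move=> fk fx; exists (cga_of tau f) => //; exists f.
Qed.

Lemma cga_fil_ge0 k x : 0 <= k -> cga_fil k x.
Proof.
rewrite le0r => /orP[/eqP ->|k0]; last by rewrite /cga_fil k0.
apply/cga_filP => // N; have [s us xs] := gsuppP (cga_proj x N).
exists (\sum_(c <- s) gdelta (cga_proj x N c) (repr c)) => //=.
have -> t : gmap (coset (sval N)) (\sum_(c <- t) gdelta (cga_proj x N c) (repr c)) =
    \sum_(c <- t) gdelta (cga_proj x N c) c.
  elim: t => [|c t IH]; first by rewrite !big_nil gmap0.
  by rewrite !big_cons gmapD IH gmap_delta coset_repr.
have sumE t c : (\sum_(d <- t) gdelta (cga_proj x N d) d) c =
    \sum_(d <- t) gdelta (cga_proj x N d) d c.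
  by elim: t => [|d t IH]; rewrite ?big_nil// !big_cons -IH.
apply/gralgP => c; rewrite sumE.
case: (boolP (c \in s)) => cs.
  rewrite (bigD1_seq c)//= eqxx big1 ?addr0// => d dc.
  by rewrite ifN// eq_sym.
rewrite big_seq big1; last first.
  by move=> d ds /=; rewrite ifN//; apply: contraNneq cs => ->.
by apply/esym/eqP; apply: contraR cs => /xs.
Qed.

Fact cga_fil_le (k m : int) x : k <= m -> cga_fil k x -> cga_fil m x.
Proof.
move=> km; case: (leP m 0) => m0; last by move=> _; apply/cga_fil_ge0/ltW.
have k0 := le_trans km m0; move=> /(cga_filP _ k0) xk; apply/(cga_filP _ m0) => N.
have [f fk fx] := xk N; exists f => //; apply: aug_power_le fk; lia.
Qed.

Fact cga_fil0 k : cga_fil k 0.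
Proof.
case: (leP k 0) => k0; last exact/cga_fil_ge0/ltW.
apply/(cga_filP _ k0) => N; exists 0; first exact: aug_power0.
by rewrite /= gmap0.
Qed.

Fact cga_filB k x y : cga_fil k x -> cga_fil k y -> cga_fil k (x - y).
Proof.
case: (leP k 0) => k0; last by move=> *; apply/cga_fil_ge0/ltW.
move=> /(cga_filP _ k0) xk /(cga_filP _ k0) yk; apply/(cga_filP _ k0) => N.
have [f fk fx] := xk N; have [g gk gy] := yk N.
by exists (f - g); [exact: aug_powerB|rewrite cga_ofB -[RHS]/(cga_proj x N - cga_proj y N) -fx -gy].
Qed.

Fact cga_fil1 : cga_fil 0 1. Proof. exact: cga_fil_ge0. Qed.

Fact cga_filM k m x y : cga_fil k x -> cga_fil m y -> cga_fil (k + m) (x * y).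
Proof.
have neg k' m' x' y' : k' <= 0 -> m' <= 0 -> cga_fil k' x' -> cga_fil m' y' ->
    cga_fil (k' + m') (x' * y').
  move=> k0 m0 /(cga_filP _ k0) xk /(cga_filP _ m0) ym.
  apply/cga_filP => [|N]; first by lia.
  have [f fk fx] := xk N; have [g gk gy] := ym N.
  exists (f * g); last first.
    by rewrite cga_ofM -[RHS]/(cga_proj x' N * cga_proj y' N) -fx -gy.
  have -> : `|(k' + m')%R|%N = (`|k'| + `|m'|)%N by lia.
  exact: aug_powerM.
case: (leP k 0) => k0; case: (leP m 0) => m0 xk ym.
- exact: neg.
- apply: (@cga_fil_le (k + 0)); first lia.
  by apply: neg => //; apply: cga_fil_ge0.
- apply: (@cga_fil_le (0 + m)); first lia.
  by apply: neg => //; apply: cga_fil_ge0.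
- by apply/cga_fil_ge0/addr_ge0; apply/ltW.
Qed.

Fact cga_fil_exhaustive x : exists k, cga_fil k x.
Proof. by exists 0; apply: cga_fil_ge0. Qed.

Definition cga_filtration : filtration KG :=
  Filtration cga_fil_le cga_fil0 cga_filB cga_fil1 cga_filM cga_fil_exhaustive.

Definition power_subgroup (p : nat) : set G :=
  [set g | forall H : set G, is_subgroup H -> (forall x, H (x ^+ p)%g) -> H g].

(** KG^p, identified with the closure of K[G^p] in KG *)
Definition cga_power (p : nat) : set KG :=
  cga_closure (cga_of tau @` [set f : gralg K G | forall g, f g != 0 -> power_subgroup p g]).

End AugmentationFiltration.

Section PadicIntegers.
Variables (p : nat) (p_prime : prime p).

Local Notation Zmod n := 'Z_(p ^ n.+1).

Definition Zmod_red (n : nat) (a : Zmod n.+1) : Zmod n := (a : nat)%:R.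

Lemma pexp_gt1 n : (1 < p ^ n.+1)%N.
Proof. by rewrite (leq_trans (prime_gt1 p_prime))// -[X in (X <= _)%N]expn1 leq_exp2l// prime_gt1. Qed.

Lemma Zmod_natE n (a b : nat) : (a%:R == b%:R :> Zmod n) = (a == b %[mod p ^ n.+1])%N.
Proof. by rewrite -val_eqE /= !val_Zp_nat// pexp_gt1. Qed.

Lemma Zmod_red_nat n k : @Zmod_red n k%:R = k%:R.
Proof.
apply/eqP; rewrite /Zmod_red Zmod_natE val_Zp_nat ?pexp_gt1//.
by rewrite modn_dvdm// dvdn_exp2l.
Qed.

Lemma Zmod_nat n (a : Zmod n) : a = (a : nat)%:R.
Proof. by rewrite natr_Zp. Qed.

Lemma Zmod_redD n : {morph @Zmod_red n : a b / a + b}.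
Proof.
by move=> a b; rewrite (Zmod_nat a) (Zmod_nat b) -natrD !Zmod_red_nat natrD.
Qed.
Lemma Zmod_redM n : {morph @Zmod_red n : a b / a * b}.
Proof.
by move=> a b; rewrite (Zmod_nat a) (Zmod_nat b) -natrM !Zmod_red_nat natrM.
Qed.
Lemma Zmod_red0 n : @Zmod_red n 0 = 0. Proof. exact: (Zmod_red_nat n 0). Qed.
Lemma Zmod_red1 n : @Zmod_red n 1 = 1. Proof. exact: (Zmod_red_nat n 1). Qed.
Lemma Zmod_redN n : {morph @Zmod_red n : a / - a}.
Proof.
by move=> a; apply: (addrI (Zmod_red a)); rewrite -Zmod_redD !subrr Zmod_red0.
Qed.

(** Indices are shifted by one because 'Z_1 is not the zero ring. *)
Record padic_seq : Type := PadicSeq {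
  padic_proj : forall n, Zmod n ;
  _ : forall n, Zmod_red (padic_proj n.+1) = padic_proj n }.

(** The primality of p is recorded in the type, since the integral domain
    structure depends on it. *)
Definition padic_int of prime p : Type := padic_seq.
Local Notation Zp := (padic_int p_prime).

HB.instance Definition _ := gen_eqMixin Zp.
HB.instance Definition _ := gen_choiceMixin Zp.

Lemma padic_compat (x : Zp) n : Zmod_red (padic_proj x n.+1) = padic_proj x n.
Proof. by case: x. Qed.

Lemma padicP (x y : Zp) : (forall n, padic_proj x n = padic_proj y n) -> x = y.
Proof.
case: x y => [x Hx] [y Hy] /= xy; have {}xy : x = y by exact: functional_extensionality_dep.
by case: _ / xy Hy => Hy; congr PadicSeq; exact: Prop_irrelevance.
Qed.

Program Definition padic0 : Zp := @PadicSeq (fun=> 0) _.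
Program Definition padic1 : Zp := @PadicSeq (fun=> 1) _.
Program Definition padicN (x : Zp) : Zp := @PadicSeq (fun n => - padic_proj x n) _.
Next Obligation. by rewrite Zmod_redN padic_compat. Qed.
Program Definition padicD (x y : Zp) : Zp :=
  @PadicSeq (fun n => padic_proj x n + padic_proj y n) _.
Next Obligation. by rewrite Zmod_redD !padic_compat. Qed.
Program Definition padicM (x y : Zp) : Zp :=
  @PadicSeq (fun n => padic_proj x n * padic_proj y n) _.
Next Obligation. by rewrite Zmod_redM !padic_compat. Qed.

Fact padicDA : associative padicD. Proof. by move=> *; apply/padicP => n /=; rewrite addrA. Qed.
Fact padicDC : commutative padicD. Proof. by move=> *; apply/padicP => n /=; rewrite addrC. Qed.
Fact padic0D : left_id padic0 padicD. Proof. by move=> *; apply/padicP => n /=; rewrite add0r. Qed.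
Fact padicND : left_inverse padic0 padicN padicD.
Proof. by move=> *; apply/padicP => n /=; rewrite addNr. Qed.
HB.instance Definition _ := GRing.isZmodule.Build Zp padicDA padicDC padic0D padicND.

Fact padicMA : associative padicM. Proof. by move=> *; apply/padicP => n /=; rewrite mulrA. Qed.
Fact padicMC : commutative padicM. Proof. by move=> *; apply/padicP => n /=; rewrite mulrC. Qed.
Fact padic1M : left_id padic1 padicM. Proof. by move=> *; apply/padicP => n /=; rewrite mul1r. Qed.
Fact padicMDl : left_distributive padicM +%R.
Proof. by move=> *; apply/padicP => n /=; rewrite mulrDl. Qed.
Fact padic10 : padic1 != 0.
Proof. by apply/eqP => /(congr1 (fun x => padic_proj x 0)) /= /eqP; rewrite oner_eq0. Qed.
HB.instance Definition _ :=
  GRing.Zmodule_isComNzRing.Build Zp padicMA padicMC padic1M padicMDl padic10.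

Definition padic_unit : pred Zp := fun x => `[< exists y, y * x = 1 >].
Definition padic_inv (x : Zp) : Zp :=
  if pselect (exists y, y * x = 1) is left e then projT1 (cid e) else x.

Fact padic_mulVr : {in padic_unit, left_inverse 1 padic_inv *%R}.
Proof.
move=> x /asboolP ex; rewrite /padic_inv; case: pselect => // e.
by case: (cid e).
Qed.
Fact padic_unitP (x y : Zp) : y * x = 1 -> padic_unit x.
Proof. by move=> yx; apply/asboolP; exists y. Qed.
Fact padic_inv_out : {in [predC padic_unit], padic_inv =1 id}.
Proof.
move=> x /negP nx; rewrite /padic_inv; case: pselect => // e.
by case: nx; apply/asboolP.
Qed.
HB.instance Definition _ :=
  GRing.ComNzRing_hasMulInverse.Build Zp padic_mulVr padic_unitP padic_inv_out.

Lemma padic_proj_mod (x : Zp) n k :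
  (padic_proj x (n + k) = padic_proj x n %[mod p ^ n.+1])%N.
Proof.
elim: k => [|k IH]; first by rewrite addn0.
rewrite -IH addnS -(padic_compat x (n + k)) /Zmod_red val_Zp_nat ?pexp_gt1//.
by rewrite modn_dvdm// dvdn_exp2l// ltnS leq_addr.
Qed.

Lemma padic_neq0 (x : Zp) : x != 0 ->
  exists n, forall k, ~~ (p ^ n.+1 %| padic_proj x (n + k)%N)%N.
Proof.
move=> /eqP x0; have [n xn] : exists n, padic_proj x n != 0.
  by apply: contra_notP x0 => /forallNP H; apply/padicP => n; apply/eqP/negPn/negP/H.
exists n => k; apply: contra xn; rewrite /dvdn padic_proj_mod => /eqP xn.
by apply/eqP/val_inj => /=; rewrite -xn modn_small// -[X in (_ < X)%N](Zp_cast (pexp_gt1 n)).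
Qed.

Fact padic_idomain : GRing.integral_domain_axiom Zp.
Proof.
move=> x y xy0; apply: contraT; rewrite negb_or => /andP[/padic_neq0[n xn] /padic_neq0[m ym]].
have := congr1 (fun z => padic_proj z (n + m)%N) xy0 => /= /eqP.
move: (xn m) (ym n); rewrite [(m + n)%N]addnC.
set a := padic_proj x _; set b := padic_proj y _ => an bm.
rewrite (Zmod_nat a) (Zmod_nat b) -natrM -[0]/(0%:R) Zmod_natE mod0n.
have gt0 (q k : nat) : ~~ (p ^ q.+1 %| k)%N -> (0 < k)%N.
  by case: k => //; rewrite dvdn0.
have a0 := gt0 _ _ an; have b0 := gt0 _ _ bm.
move: an bm; rewrite -[_ == 0%N]/(p ^ (n + m).+1 %| a * b)%N.
rewrite !pfactor_dvdn ?muln_gt0 ?a0// lognM// -!leqNgt => la lb.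
by rewrite ltnNge leq_add.
Qed.
HB.instance Definition _ := GRing.ComUnitRing_isIntegral.Build Zp padic_idomain.

End PadicIntegers.

(** The homogeneous component of degree n of the Campbell-Hausdorff series
    Phi(U, V) = log(e^U e^V) = sum_(k >= 1) (-1)^(k+1)/k (e^U e^V - 1)^k,
    evaluated at two matrices.  An auxiliary polynomial variable keeps track of
    the degree; only the terms with k <= n contribute in degree n. *)
Section CampbellHausdorff.
Variables (F : fieldType) (d : nat).
Implicit Types U V : 'M[F]_d.+1.

Definition exp_mul_trunc (n : nat) U V : {poly 'M[F]_d.+1} :=
  \poly_(m < n.+1)
    \sum_(i < m.+1) ((i`! * (m - i)`!)%:R^-1 : F) *: (U ^+ i * V ^+ (m - i)).

Definition CH_term (n : nat) U V : 'M[F]_d.+1 :=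
  \sum_(1 <= k < n.+1)
    ((-1) ^+ k.+1 / k%:R : F) *: ((exp_mul_trunc n U V - 1) ^+ k)`_n.

End CampbellHausdorff.

Section ExpSl2.
Variables (p : nat) (p_prime : prime p) (l : nat).

Local Notation Zp := (padic_int p_prime).
Local Notation Qp := {fraction Zp}.

Definition sl2_lattice : set 'M[Zp]_2 :=
  [set u | \tr u = 0 /\ forall i j, exists z : Zp, u i j = (p ^ l)%:R * z].

(** the matrices with entries in Z_p, and in p^m Z_p, inside M_2(Q_p) *)
Definition to_Qp (u : 'M[Zp]_2) : 'M[Qp]_2 := map_mx (@tofrac Zp) u.
Definition pball (m : nat) : set 'M[Qp]_2 :=
  [set U | exists E : 'M[Zp]_2, U = to_Qp ((p ^ m)%:R *: E)].

(** w = Phi(u, v), the series being p-adically convergent with sum w *)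
Definition is_CH (u v w : 'M[Zp]_2) : Prop :=
  forall m : nat, exists N0 : nat, forall N : nat, (N0 <= N)%N ->
    pball m (to_Qp w - \sum_(1 <= n < N.+1) CH_term n (to_Qp u) (to_Qp v)).

Variable G : groupType.

(** [e], restricted to L = sl_2(p^l Z_p), is a bijection L -> G with
    e(u) e(v) = e(Phi(u, v)), i.e. G is exp(L) *)
Definition is_exp (e : 'M[Zp]_2 -> G) : Prop :=
  set_bij sl2_lattice [set: G] e /\
  forall u v, sl2_lattice u -> sl2_lattice v ->
    exists w, [/\ sl2_lattice w, is_CH u v w & (e u * e v)%g = e w].

(** the topology of G, transported from the p-adic topology of L along [e] *)
Definition exp_open (e : 'M[Zp]_2 -> G) : set (set G) :=
  [set U | forall u, sl2_lattice u -> U (e u) ->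
    exists m : nat, forall w, sl2_lattice w ->
      pball m (to_Qp w - to_Qp u) -> U (e w)].

End ExpSl2.

Arguments cga_power K {G} tau p.
Arguments cga_filtration K {G} tau.

(* Main.v *)
Require Import Defs.
From HB Require Import structures.
From mathcomp Require Import all_boot all_order all_algebra zify ring.
From mathcomp Require Import boolp classical_sets functions fsbigop.

Set Implicit Arguments.
Unset Strict Implicit.
Unset Printing Implicit Defensive.

Import Order.TTheory GRing.Theory Num.Theory.
Local Open Scope classical_set_scope.
Local Open Scope ring_scope.

(** By the Campbell-Hausdorff formula the matrix exponential embeds G in
    GL_2(Z_p), and the elements congruent to 1 modulo p^(l+j) form a filtration
    N_j of G whose layers are copies of sl_2(F_p), on which the commutator
    pairing is the Lie bracket, shifted by l.  Let x, y, z in G be the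
    exponentials of p^l times the standard basis e, f, h.  In K[G/N_n] the
    monomials (x-1)^i (y-1)^j (z-1)^k with i, j, k < p^n are a basis adapted to
    the augmentation filtration; hence gr KG is the polynomial ring K[e,f,h], and
    the part of KG^p of filtration at least m is spanned, at each finite level,
    by p-th powers of such monomials.  The powers a_r = g^(p^r), with g one of x,
    y, z, then form sources of derivations; with q = p^(r+l) they induce
    h^q d_f - 2 e^q d_h, 2 f^q d_h - h^q d_e and 2 e^q d_e - 2 f^q d_f on K[e,f,h].
    If X divides the images of Y under these for all large r, elimination between
    two values of q gives coprime multipliers of each partial derivative of Y
    landing in (X), so X divides all partial derivatives of Y. *)

(** * Divisibility in Z_p *)

(** The group is known only through the Campbell-Hausdorff law on a lattice, so the first obstacle
    is that exp must turn this p-adic limit into a product. Formal identities become numerical by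
    grading: a polynomial variable records the degree, and, constant terms aside, coefficients of
    degree m have valuation at least (m+1)/2, because 2 v(n!) < n for p at least 3. An identity
    modulo X^N, evaluated at 1, is then an approximation of order about N/2. The group ring half
    sees G only through [uniform_chain], the brackets of the generators and the cofinality of the
    N_j. At level n the augmentation ideal J is nilpotent, so successive leading forms terminate and
    give spanning; independence is triangularity against ordered words. Degrees of the sources: with
    q = p^(r+l), bracketing with g^(p^r) sends y-1 of degree 1 to degree q, but (y-1)^p of degree p
    to degree pq, since y^p lies one layer deeper. The gap (pq - p) - (q - 1) = (p - 1)(q - 1) is
    unbounded, which is the condition on sources. A B_1-linear derivation kills K, so D(Y) is a
    combination of the three partial derivatives of Y. *)

Section Legendre.
Variables (p : nat) (p_prime : prime p) (p_ge3 : (3 <= p)%N).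

(** Legendre's formula with its first term split off; this recursive form suits strong induction. *)
Lemma logn_factS n : logn p n`! = (n %/ p + logn p (n %/ p)`!)%N.
Proof.
have p0 : (0 < p)%N by lia.
have e (m : nat) : (\sum_(1 <= k < n.+1) m %/ p ^ k)%N = (\sum_(1 <= k < m.+1) m %/ p ^ k)%N
    -> logn p m`! = (\sum_(1 <= k < n.+1) m %/ p ^ k)%N by move=> ->; rewrite logn_fact.
have ext (m n' : nat) : (m <= n')%N ->
    (\sum_(1 <= k < n'.+1) m %/ p ^ k)%N = (\sum_(1 <= k < m.+1) m %/ p ^ k)%N.
  move=> mn; rewrite (big_cat_nat (n := m.+1))//= [X in (_ + X)%N]big_nat_cond.
  rewrite [X in (_ + X)%N]big1 ?addn0// => k /andP[/andP[mk _] _].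
  by apply: divn_small; apply: (ltn_trans mk); apply: ltn_expl; lia.
rewrite (logn_fact n p_prime) (e (n %/ p)%N); last by apply: ext; exact: leq_div.
rewrite -(ext n n.+1)// big_ltn// expn1; congr (_ + _)%N.
rewrite big_add1 /=; apply: eq_big_nat => k _.
by rewrite expnS divnMA.
Qed.

(** With q = n/p rounded down and q > 0, induction gives 2 v(n!) = 2q + 2 v(q!) < 3q, and 3q <= pq
    <= n. This is where p >= 3 makes the exponential converge on all of p M_2(Z_p); strictness
    supplies the extra 1/2 in later valuations. *)
Lemma logn_fact_le n : (0 < n)%N -> ((logn p n`!).*2 < n)%N.
Proof.
elim/ltn_ind: n => n IH n0; rewrite logn_factS.
have [->|q0] := posnP (n %/ p); first by rewrite fact0 logn1.
have := IH (n %/ p)%N; rewrite ltn_Pdiv//; last by lia.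
move=> /(_ isT q0).
have := leq_trunc_div n p; nia.
Qed.

Lemma logn_fact2_le i j : (0 < i + j)%N -> ((logn p (i`! * j`!)).*2 < i + j)%N.
Proof.
move=> ij0; apply: leq_ltn_trans (logn_fact_le ij0); rewrite leq_double.
apply: dvdn_leq_log; rewrite ?fact_gt0//.
by rewrite -(bin_fact (leq_addr j i)) addKn dvdn_mull.
Qed.

Lemma logn_le k : (0 < k)%N -> ((logn p k).*2 < k)%N.
Proof.
move=> k0; apply: leq_ltn_trans (logn_fact_le k0); rewrite leq_double.
by apply: dvdn_leq_log; rewrite ?fact_gt0// dvdn_fact// k0 leqnn.
Qed.

End Legendre.

Section PadicArith.
Variables (p : nat) (p_prime : prime p).
Local Notation Zp := (padic_int p_prime).
Local Notation Qp := {fraction Zp}.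

Lemma padic_proj_nat (k n : nat) : padic_proj (k%:R : Zp) n = k%:R.
Proof. by elim: k => [//|k IH]; rewrite -[k.+1]addn1 !natrD -IH. Qed.

Lemma padic_nat_neq0 (k : nat) : (0 < k)%N -> (k%:R : Zp) != 0.
Proof.
move=> k0; apply/eqP => /(congr1 (fun x => padic_proj x k)).
rewrite padic_proj_nat => /eqP; rewrite -[padic_proj (0 : Zp) k]/(0%:R) Zmod_natE// mod0n.
have kp : (k < p ^ k.+1)%N by apply: ltn_trans (ltnSn k) _; rewrite ltn_expl// prime_gt1.
by rewrite modn_small// eqn0Ngt k0.
Qed.

Lemma Qp_nat_neq0 (k : nat) : (0 < k)%N -> (k%:R : Qp) != 0.
Proof.
move=> k0; rewrite -(rmorph_nat (@tofrac Zp)) tofrac_eq0; exact: padic_nat_neq0.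
Qed.

Lemma padic_nat_unit (k : nat) : coprime k p -> exists z : Zp, k%:R * z = 1.
Proof.
move=> kp; have ku n : (k%:R : 'Z_(p ^ n.+1)) \is a GRing.unit.
  by rewrite unitZpE ?pexp_gt1// coprime_sym coprimeXr.
have compat n : @Zmod_red p n (k%:R)^-1 = (k%:R)^-1.
  apply: (mulrI (ku n)); rewrite (mulrV (ku n)).
  have {1}<- := @Zmod_red_nat p p_prime n k; rewrite -Zmod_redM//.
  by rewrite (mulrV (ku n.+1)) Zmod_red1.
exists (PadicSeq compat); apply/padicP => n.
by rewrite -[LHS]/(padic_proj (k%:R : Zp) n * (k%:R)^-1) padic_proj_nat (mulrV (ku n)).
Qed.

(** The prime-to-p part of k is a unit of Z_p, and p^a absorbs the rest of the denominator. *)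
Lemma inv_nat_integral (k a : nat) : (0 < k)%N -> (logn p k <= a)%N ->
  exists z : Zp, (k%:R : Qp)^-1 * (p ^ a)%:R = tofrac z.
Proof.
move=> k0 ka; have [c kc ck] := pfactor_coprime p_prime k0.
have [z cz] := @padic_nat_unit c ltac:(by rewrite coprime_sym).
exists (z * (p ^ (a - logn p k))%:R); apply: (mulfI (Qp_nat_neq0 k0)).
rewrite mulVKf ?Qp_nat_neq0// -(rmorph_nat (@tofrac Zp) k) -(rmorph_nat (@tofrac Zp)).
rewrite -rmorphM; congr tofrac.
rewrite {1}ck natrM mulrACA cz mul1r -natrM -expnD subnKC//.
Qed.

Lemma padic_divP (z : Zp) n : padic_proj z n = 0 <-> exists w, z = (p ^ n.+1)%:R * w.
Proof.
split; last first.
  case=> w ->; rewrite -[LHS]/(padic_proj ((p ^ n.+1)%:R : Zp) n * _) padic_proj_nat.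
  suff -> : ((p ^ n.+1)%:R : 'Z_(p ^ n.+1)) = 0 by rewrite mul0r.
  by apply/eqP; rewrite -[0]/(0%:R) Zmod_natE// mod0n modnn.
(* Index n + 1 + k holds a residue modulo p^(n+k+2); dividing it by p^(n+1) leaves one modulo
   p^(k+1), which is index k of the quotient. *)
move=> zn; pose q k := (padic_proj z (n.+1 + k)%N %/ p ^ n.+1)%N.
have zq k : (padic_proj z (n.+1 + k)%N : nat) = (p ^ n.+1 * q k)%N.
  rewrite mulnC divnK// /dvdn addSnnS.
  by rewrite (padic_proj_mod z n k.+1) zn mod0n.
have compat k : @Zmod_red p k (q k.+1)%:R = (q k)%:R.
  rewrite Zmod_red_nat//; apply/eqP; rewrite Zmod_natE//.
  have zq1 : (padic_proj z (n.+1 + k).+1 : nat) = (p ^ n.+1 * q k.+1)%N by rewrite -zq addnS.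
  have := padic_proj_mod z (n.+1 + k) 1; rewrite addn1 zq1 zq => /eqP.
  have -> : (p ^ (n.+1 + k).+1 = p ^ n.+1 * p ^ k.+1)%N by rewrite -addnS expnD.
  rewrite -!muln_modr; first by rewrite eqn_pmul2l ?expn_gt0 ?prime_gt0.
exists (PadicSeq compat); apply/padicP => m.
rewrite -[RHS]/(padic_proj ((p ^ n.+1)%:R : Zp) m * (q m)%:R) padic_proj_nat -natrM -zq.
transitivity ((padic_proj z m : nat)%:R : 'Z_(p ^ m.+1)); first exact: Zmod_nat.
apply/eqP; rewrite Zmod_natE//; apply/eqP.
by rewrite addnC padic_proj_mod.
Qed.

End PadicArith.

(** * Truncated exponential and logarithm *)

Section ExpLog.
Variable F : fieldType.
Hypothesis F0 : forall k : nat, (0 < k)%N -> k%:R != 0 :> F.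

Definition log_trunc (N : nat) : {poly F} :=
  \sum_(1 <= k < N.+1) ((-1) ^+ k.+1 / k%:R) *: 'X^k.

Definition exp_trunc (A : lalgType F) (N : nat) (x : A) : A :=
  \sum_(k < N.+1) (k`!%:R)^-1 *: x ^+ k.

Lemma log_trunc_dvd N : exists l1 : {poly F}, log_trunc N = l1 * 'X.
Proof.
exists (\sum_(1 <= k < N.+1) ((-1) ^+ k.+1 / k%:R) *: 'X^(k.-1)).
rewrite mulr_suml; apply: eq_big_nat => -[//|k] _.
by rewrite -scalerAl -exprSr.
Qed.

Lemma deriv_log_trunc N : (1 + 'X) * (log_trunc N)^`() = 1 - (- 'X) ^+ N.
Proof.
elim: N => [|N IH]; first by rewrite /log_trunc big_geq// deriv0 mulr0 expr0 subrr.
rewrite /log_trunc big_nat_recr//= -/(log_trunc N) derivD mulrDr IH derivZ derivXn /=.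
have -> : ((-1) ^+ N.+2 / N.+1%:R) *: ('X^N *+ N.+1) = (- 'X) ^+ N :> {poly F}.
  by rewrite -scaler_nat scalerA divfK ?F0// -scaleN1r exprZn !exprS !mulN1r opprK.
by rewrite exprS; ring.
Qed.

Lemma deriv_exp_trunc N (l : {poly F}) :
  (exp_trunc N l)^`() = l^`() * (exp_trunc N l - (N`!%:R)^-1 *: l ^+ N).
Proof.
rewrite {2}/exp_trunc big_ord_recr /= addrK /exp_trunc big_ord_recl /= derivD derivZ.
rewrite expr0 derivC scaler0 add0r raddf_sum mulr_sumr; apply: eq_bigr => i _.
rewrite /= derivZ deriv_exp /= add0n /bump leq0n add1n -scaler_nat scalerA -scalerAr.
by rewrite factS natrM invfM mulrAC mulVf ?F0// mul1r.
Qed.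

(** [y = exp (log (1 + X))] solves [(1 + X) y' = y] modulo [X^N], which determines its coefficients. *)
Lemma exp_log_trunc N : exists Q : {poly F},
  exp_trunc N (log_trunc N) = 1 + 'X + Q * 'X^(N.+1).
Proof.
set y : {poly F} := exp_trunc N _; have [l1 l1E] := log_trunc_dvd N.
have coefMXN (Q : {poly F}) i : (i < N)%N -> (Q * 'X^N)`_i = 0 by rewrite coefMXn => ->.
have ode i : (i < N)%N -> ((1 + 'X) * y^`())`_i = y`_i.
  move=> iN; rewrite deriv_exp_trunc mulrA deriv_log_trunc -/y {1}l1E exprMn.
  have -> : (1 - (- 'X) ^+ N) * (y - (N`!%:R)^-1 *: (l1 ^+ N * 'X^N)) =
      y - ((1 - (- 'X) ^+ N) * ((N`!%:R)^-1 *: l1 ^+ N) + (-1) ^+ N * y) * 'X^N.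
    by rewrite (exprNn 'X) -!mul_polyC; ring.
  by rewrite coefB coefMXN// subr0.
have y0 : y`_0 = 1.
  rewrite /y /exp_trunc big_ord_recl coefD coef_sum big1 ?addr0 => [|i _].
    by rewrite coefZ expr0 coef1 fact0 invr1 mulr1.
  by rewrite lift0 l1E exprMn coefZ coefMXn ?mulr0.
have yS i : (i < N)%N -> y`_i.+1 * i.+1%:R = (1 - i%:R) * y`_i.
  move=> /ode; rewrite mulrDl mul1r coefD coefXM !coef_deriv.
  case: i => [|i] /=; first by rewrite addr0 subr0 mul1r mulr_natr.
  by move=> e; rewrite mulr_natr mulrBl mul1r -{1}e mulr_natl addrK.
have yE i : (i <= N)%N -> y`_i = (1 + 'X)`_i.
  elim: i => [_|i IH iN]; first by rewrite y0 coefD coefX coef1 addr0.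
  apply: (mulIf (F0 (ltn0Sn i))); rewrite yS// IH; last exact: ltnW.
  rewrite !coefD !coefX !coef1; case: i {IH iN} => [|[|i]] /=.
  - by rewrite subr0 addr0 add0r.
  - by rewrite subrr addr0 !mul0r.
  - by rewrite addr0 mulr0 mul0r.
exists (drop_poly N.+1 (y - (1 + 'X))).
apply/eqP; rewrite -subr_eq0 opprD addrA subr_eq0 -{1}(poly_take_drop N.+1 (y - (1 + 'X))).
suff -> : take_poly N.+1 (y - (1 + 'X)) = 0 by rewrite add0r.
apply/polyP => i; rewrite coef_take_poly coef0; case: ifP => // iN.
by rewrite coefB yE ?subrr.
Qed.

End ExpLog.

(** * The Campbell-Hausdorff series in M_2(Q_p) *)

Lemma mulr_sub1 (R : pzRingType) (a b : R) :
  a * b - 1 = (a - 1) * (b - 1) + ((a - 1) + (b - 1)).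
Proof.
rewrite -{1}[a](subrK 1) -{1}[b](subrK 1); move: (a - 1) (b - 1) => c d.
by rewrite mulrDl mulrDr mul1r mulr1 !addrA addrK.
Qed.

Section Ball.
Variables (p : nat) (p_prime : prime p).
Local Notation Zp := (padic_int p_prime).
Local Notation Qp := {fraction Zp}.
Local Notation ball := (@pball p p_prime).
Implicit Types U V : 'M[Qp]_2.

Lemma to_QpB : {morph @to_Qp p p_prime : u v / u - v}.
Proof. by move=> u v; rewrite /to_Qp raddfB. Qed.
Lemma to_QpM : {morph @to_Qp p p_prime : u v / u * v}.
Proof. by move=> u v; rewrite /to_Qp -[u * v]/(u *m v) map_mxM. Qed.
Lemma to_Qp1 : to_Qp (1 : 'M[Zp]_2) = 1. Proof. by rewrite /to_Qp map_scalar_mx rmorph1. Qed.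
Lemma to_QpZ c (u : 'M[Zp]_2) : to_Qp (c *: u) = tofrac c *: to_Qp u.
Proof. by rewrite /to_Qp map_mxZ. Qed.
Lemma to_Qp_nat (k : nat) (u : 'M[Zp]_2) : to_Qp (k%:R *: u) = k%:R *: to_Qp u.
Proof. by rewrite to_QpZ rmorph_nat. Qed.

Lemma to_Qp_inj : injective (@to_Qp p p_prime).
Proof.
by move=> u v /matrixP uv; apply/matrixP => i j; have /eqP := uv i j; rewrite !mxE tofrac_eq => /eqP.
Qed.

Lemma ball0 m : ball m 0.
Proof. by exists 0; rewrite scaler0 /to_Qp raddf0. Qed.

Lemma ballB m U V : ball m U -> ball m V -> ball m (U - V).
Proof. by move=> [E ->] [E' ->]; exists (E - E'); rewrite scalerBr to_QpB. Qed.

Lemma ballN m U : ball m U -> ball m (- U).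
Proof. by move=> mU; rewrite -sub0r; apply: ballB => //; apply: ball0. Qed.

Lemma ballD m U V : ball m U -> ball m V -> ball m (U + V).
Proof. by move=> mU mV; rewrite -[V]opprK; apply: ballB => //; apply: ballN. Qed.

Lemma ballC m U V : ball m (U - V) -> ball m (V - U).
Proof. by move=> /ballN; rewrite opprB. Qed.

Lemma ball_trans m U V W : ball m (U - V) -> ball m (V - W) -> ball m (U - W).
Proof. by move=> UV VW; have := ballD UV VW; rewrite addrA subrK. Qed.

Lemma ballM m n U V : ball m U -> ball n V -> ball (m + n) (U * V).
Proof.
move=> [E ->] [E' ->]; exists (E * E').
by rewrite -to_QpM -scalerAl -scalerAr scalerA -natrM -expnD.
Qed.

Lemma ball_le m n U : (m <= n)%N -> ball n U -> ball m U.
Proof.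
move=> /subnKC <- [E ->]; exists ((p ^ (n - m))%:R *: E).
by rewrite scalerA -natrM -expnD.
Qed.

Lemma ball_int (u : 'M[Zp]_2) : ball 0 (to_Qp u).
Proof. by exists u; rewrite expn0 scale1r. Qed.

Lemma ball1 : ball 0 1. Proof. by rewrite -to_Qp1; apply: ball_int. Qed.

Lemma ball_sum m (I : Type) (r : seq I) (P : pred I) (f : I -> 'M[Qp]_2) :
  (forall i, P i -> ball m (f i)) -> ball m (\sum_(i <- r | P i) f i).
Proof. by move=> fm; elim/big_ind: _ => //; [exact: ball0|exact: ballD]. Qed.

Lemma ball_sum_nat m a b (f : nat -> 'M[Qp]_2) :
  (forall i, (a <= i < b)%N -> ball m (f i)) -> ball m (\sum_(a <= i < b) f i).
Proof. by move=> fm; rewrite big_nat_cond; apply: ball_sum => i /andP[/fm]. Qed.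

Lemma ball_divn m a (k : nat) U : (0 < k)%N -> (logn p k <= a)%N ->
  ball (m + a) U -> ball m ((k%:R)^-1 *: U).
Proof.
move=> k0 ka [E ->]; have [z zE] := inv_nat_integral p_prime k0 ka.
exists (z *: E); rewrite !to_Qp_nat to_QpZ !scalerA expnD natrM; congr (_ *: _).
by rewrite -zE mulrCA.
Qed.

Lemma ballX m k U : ball m U -> ball (m * k) (U ^+ k).
Proof.
move=> mU; elim: k => [|k IH]; first by rewrite muln0 expr0; apply: ball1.
by rewrite mulnS exprS; apply: ballM.
Qed.

Lemma ball_sign m k U : ball m U -> ball m ((-1) ^+ k *: U).
Proof.
move=> mU; elim: k => [|k IH]; first by rewrite expr0 scale1r.
by rewrite exprS -scalerA scaleN1r; apply: ballN.
Qed.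

Lemma ball_all0 (u : 'M[Zp]_2) : (forall m, ball m (to_Qp u)) -> u = 0.
Proof.
move=> um; apply/matrixP => i j; apply/padicP => n; rewrite mxE.
have [E /to_Qp_inj ->] := um n.+1.
by apply/padic_divP; exists (E i j); rewrite mxE.
Qed.

(** The valuation of a degree m term of the series is at least m/2; balls of
    half-integral radius make this bound multiplicative. *)
Definition hball (h : nat) : set 'M[Qp]_2 := ball (uphalf h).

Lemma hballM h k U V : hball h U -> hball k V -> hball (h + k) (U * V).
Proof.
move=> hU kV; apply: ball_le (ballM hU kV); rewrite !uphalf_half; lia.
Qed.

Lemma hball_le h k U : (h <= k)%N -> hball k U -> hball h U.
Proof. by move=> hk; apply: ball_le; apply: uphalf_leq. Qed.

Lemma hball_divn h a k U : (0 < k)%N -> (logn p k <= a)%N ->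
  hball (h + a.*2) U -> hball h ((k%:R)^-1 *: U).
Proof.
move=> k0 ka hU; apply: ball_divn k0 ka _; apply: ball_le hU.
by rewrite !uphalf_half; lia.
Qed.

(** Valuation at least (m + c)/2 in degree m. The offset c pays for denominators: dividing by k
    costs 2 v(k) of it. *)
Definition wt (c : nat) (Q : {poly 'M[Qp]_2}) : Prop := forall m, hball (m + c) Q`_m.
Definition cst (c : Qp) : {poly 'M[Qp]_2} := (c%:M)%:P.

Lemma coef_cstM c Q i : (cst c * Q)`_i = c *: Q`_i.
Proof. by rewrite coefCM -[_ * _]/(_ *m _) mul_scalar_mx. Qed.

Lemma wtD c Q R : wt c Q -> wt c R -> wt c (Q + R).
Proof. by move=> cQ cR m; rewrite coefD; exact: ballD (cQ m) (cR m). Qed.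

Lemma wtB c Q R : wt c Q -> wt c R -> wt c (Q - R).
Proof. by move=> cQ cR m; rewrite coefB; exact: ballB (cQ m) (cR m). Qed.

Lemma wt0 c : wt c 0.
Proof. by move=> m; rewrite coef0; apply: ball0. Qed.

Lemma wt_sum c (I : Type) (r : seq I) (P : pred I) f :
  (forall i, P i -> wt c (f i)) -> wt c (\sum_(i <- r | P i) f i).
Proof. by move=> fc; elim/big_ind: _ => //; [exact: wt0|exact: wtD]. Qed.

Lemma wt_le c d Q : (c <= d)%N -> wt d Q -> wt c Q.
Proof. by move=> cd dQ m; apply: hball_le (dQ m); rewrite leq_add2l. Qed.

Lemma wtM c d Q R : wt c Q -> wt d R -> wt (c + d) (Q * R).
Proof.
move=> cQ dR m; rewrite coefM; apply: ball_sum => i _.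
have -> : (m + (c + d) = (i + c) + (m - i + d))%N by have := ltn_ord i; lia.
exact: hballM.
Qed.

Lemma wtX Q k : wt 1 Q -> wt k (Q ^+ k).
Proof.
move=> Q1; elim: k => [|k IH]; last by rewrite exprS -[k.+1]add1n; apply: wtM.
by case=> [|m]; rewrite expr0 coef1 /=; [apply: ball1|apply: ball0].
Qed.

Lemma wt_cst_div c a k Q : (0 < k)%N -> (logn p k <= a)%N -> wt (c + a.*2) Q ->
  wt c (cst (k%:R)^-1 * Q).
Proof.
by move=> k0 ka cQ m; rewrite coef_cstM; apply: hball_divn k0 ka _; rewrite -addnA.
Qed.

Lemma eval1M (Q R : {poly 'M[Qp]_2}) : (Q * R).[1] = Q.[1] * R.[1].
Proof. by rewrite hornerM_comm// /comm_poly mulr1 mul1r. Qed.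

Lemma eval1X (Q : {poly 'M[Qp]_2}) k : (Q ^+ k).[1] = Q.[1] ^+ k.
Proof. by elim: k => [|k IH]; rewrite ?expr0 ?hornerC// !exprS eval1M IH. Qed.

Lemma eval1E (Q : {poly 'M[Qp]_2}) : Q.[1] = \sum_(i < size Q) Q`_i.
Proof. by rewrite horner_coef; apply: eq_bigr => i _; rewrite expr1n mulr1. Qed.

Lemma eval1_cstM c Q : (cst c * Q).[1] = c *: Q.[1].
Proof. by rewrite eval1M hornerC -[_ * _]/(_ *m _) mul_scalar_mx. Qed.

(** The bridge from formal to p-adic: an identity modulo X^N becomes, at X = 1, an approximation of
    order (N + c)/2. *)
Lemma eval1_wt c N Q : wt c Q -> (forall i, (i < N)%N -> Q`_i = 0) -> hball (N + c) Q.[1].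
Proof.
move=> cQ Q0; rewrite eval1E; apply: ball_sum => i _.
case: (ltnP i N) => iN; first by rewrite Q0//; apply: ball0.
by apply: hball_le (cQ i); rewrite leq_add2r.
Qed.

Definition eqX (n : nat) (Q R : {poly 'M[Qp]_2}) : Prop := forall i, (i < n)%N -> Q`_i = R`_i.

Lemma eqXM n Q Q' R R' : eqX n Q Q' -> eqX n R R' -> eqX n (Q * R) (Q' * R').
Proof.
move=> QQ RR i iN; rewrite !coefM; apply: eq_bigr => j _.
by rewrite QQ ?RR//; have := ltn_ord j; lia.
Qed.

Lemma eqX_exp n Q R k : eqX n Q R -> eqX n (Q ^+ k) (R ^+ k).
Proof. by move=> QR; elim: k => [//|k IH]; rewrite !exprS; apply: eqXM. Qed.

Lemma coef_exp_low (Q : {poly 'M[Qp]_2}) k i : Q`_0 = 0 -> (i < k)%N -> (Q ^+ k)`_i = 0.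
Proof.
move=> Q0; elim: k i => [//|k IH] i ik; rewrite exprS coefM big1// => j _.
case: j => -[|j] /= ji; first by rewrite Q0 mul0r.
by rewrite IH ?mulr0//; lia.
Qed.

Section CampbellHausdorffExp.
Hypothesis p_ge3 : (3 <= p)%N.
Variables (U V : 'M[Qp]_2) (N : nat).
Hypotheses (U1 : ball 1 U) (V1 : ball 1 V).

Let P := exp_mul_trunc N U V.

Lemma coef_exp_mul n i : (i <= n)%N -> (exp_mul_trunc n U V)`_i =
  \sum_(j < i.+1) ((j`! * (i - j)`!)%:R^-1 : Qp) *: (U ^+ j * V ^+ (i - j)).
Proof. by move=> iN; rewrite coef_poly ltnS iN. Qed.

Lemma coef0_exp_mul n : (exp_mul_trunc n U V)`_0 = 1.
Proof. by rewrite coef_exp_mul// big_ord1 subnn fact0 muln1 invr1 scale1r !expr0 mulr1. Qed.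

Lemma coef0_P1 n : (exp_mul_trunc n U V - 1)`_0 = 0.
Proof. by rewrite coefB coef0_exp_mul coef1 subrr. Qed.

(** A term U^j V^(m-j) / (j! (m-j)!) has valuation at least m - (m-1)/2 = (m+1)/2, by the strict
    bound on v(j! (m-j)!). *)
Lemma wt_P1 : wt 1 (P - 1).
Proof.
case=> [|m]; first by rewrite coef0_P1; apply: ball0.
rewrite coefB coef1 subr0; case: (leqP m.+1 N) => mN; last first.
  by rewrite coef_poly ltnS leqNgt mN /=; apply: ball0.
rewrite coef_exp_mul//; apply: ball_sum => j _.
have := logn_fact2_le p_prime p_ge3 (i := j) (j := m.+1 - j).
rewrite subnKC; last by have := ltn_ord j; lia.
move=> /(_ isT) lj.
apply: (@ball_divn _ (logn p (j`! * (m.+1 - j)`!))); rewrite ?muln_gt0 ?fact_gt0//.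
apply: ball_le (ballM (ballX j U1) (ballX (m.+1 - j) V1)).
by rewrite !mul1n subnKC ?uphalf_half; [|have := ltn_ord j]; lia.
Qed.

(** The truncated logarithm of [P], kept with its coefficients beyond degree N so that it is the
    image of [log_trunc] under a ring morphism. Up to degree N its coefficients are the
    Campbell-Hausdorff terms; [CH_poly_eval] bounds the rest. *)
Definition CH_poly : {poly 'M[Qp]_2} :=
  \sum_(1 <= k < N.+1) cst ((-1) ^+ k.+1 / k%:R) * (P - 1) ^+ k.

Lemma wt_CH_poly : wt 1 CH_poly.
Proof.
rewrite /CH_poly big_nat_cond; apply: wt_sum => k /andP[/andP[k0 _] _] m.
rewrite coef_cstM -scalerA; apply: ball_sign; rewrite -coef_cstM.
have lk := logn_le p_prime p_ge3 k0.
apply: (wt_cst_div k0 (leqnn _)); apply: (@wt_le _ k); first lia.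
exact/wtX/wt_P1.
Qed.

Lemma coef_CH_poly m : (m <= N)%N -> CH_poly`_m = CH_term m U V.
Proof.
move=> mN; rewrite /CH_poly coef_sum /CH_term (big_cat_nat (n := m.+1))//=.
rewrite [X in _ + X = _]big_nat_cond [X in _ + X]big1 ?addr0; last first.
  move=> k /andP[/andP[mk _] _]; rewrite coef_cstM coef_exp_low ?scaler0//.
  (* [P - 1] has no constant term, so its k-th power starts in degree k and the summands with k > m
     do not reach degree m. *)
  exact: coef0_P1.
apply: eq_bigr => k _; rewrite coef_cstM; congr (_ *: _).
apply: (@eqX_exp m.+1) => // i im.
by rewrite !coefB !coef_exp_mul//; lia.
Qed.

Lemma CH_poly_eval : hball N.+2 (CH_poly.[1] - \sum_(1 <= n < N.+1) CH_term n U V).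
Proof.
pose T := \poly_(i < N.+1) CH_poly`_i.
have -> : \sum_(1 <= n < N.+1) CH_term n U V = T.[1].
  rewrite -[T.[1]](_ : \sum_(0 <= i < N.+1) CH_poly`_i = _); last first.
    by rewrite horner_poly big_mkord; apply: eq_bigr => i _; rewrite expr1n mulr1.
  rewrite [RHS]big_ltn// coef_CH_poly// /CH_term [X in X + _]big_geq// add0r.
  by apply: eq_big_nat => i iN; rewrite coef_CH_poly//; lia.
rewrite -hornerN -hornerD -addn1; apply: eval1_wt => [m|i iN]; last first.
  by rewrite coefB coef_poly iN subrr.
rewrite coefB coef_poly; case: ifP => _; first by rewrite subrr; apply: ball0.
by rewrite subr0; apply: wt_CH_poly.
Qed.

Definition exp_poly (W : 'M[Qp]_2) : {poly 'M[Qp]_2} := \poly_(i < N.+1) ((i`!%:R)^-1 *: W ^+ i).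

Lemma exp_poly_eval W : (exp_poly W).[1] = exp_trunc N W.
Proof. by rewrite horner_poly; apply: eq_bigr => i _; rewrite expr1n mulr1. Qed.

Lemma wt_exp_poly W : ball 1 W -> wt 1 (exp_poly W - 1).
Proof.
move=> W1 [|m]; rewrite coefB coef1 coef_poly ?subr0/=.
  by rewrite fact0 invr1 scale1r expr0 subrr; apply: ball0.
case: ifP => _; last exact: ball0.
have lm := logn_fact_le p_prime p_ge3 (ltn0Sn m).
apply: (@ball_divn _ (logn p m.+1`!)); rewrite ?fact_gt0//.
by apply: ball_le (ballX m.+1 W1); rewrite !uphalf_half; lia.
Qed.

Lemma wt_exp_polyM : wt 1 (exp_poly U * exp_poly V - 1).
Proof.
rewrite mulr_sub1; have wU := wt_exp_poly U1; have wV := wt_exp_poly V1.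
by apply: wtD (wtD wU wV); apply: (wt_le (leqnSn 1)); apply: wtM wU wV.
Qed.

(** U and V need not commute: everything happens in the commutative algebra generated by the single
    element [P - 1]. Substituting it in exp(log(1 + X)) = 1 + X + Q X^(N+1) gives [P] up to degree
    N, which agrees there with the product of the two truncated exponentials. Both sides minus 1
    have weight 1, so [eval1_wt] applies at N + 1. *)
Lemma exp_trunc_CH :
  hball N.+2 (exp_trunc N CH_poly.[1] - exp_trunc N U * exp_trunc N V).
Proof.
have F0 := Qp_nat_neq0 p_prime.
pose f : {rmorphism Qp -> {poly 'M[Qp]_2}} := polyC \o (@scalar_mx Qp 2).
(* Substitution into a noncommutative ring is a ring morphism because scalar matrices commute with
   [P - 1]. *)
have cfu : commr_rmorph f (P - 1).
  move=> c; apply/polyP => i; rewrite /= coefMC coefCM.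
  exact: scalar_mxC.
pose phi : {rmorphism {poly Qp} -> {poly 'M[Qp]_2}} := horner_morph cfu.
have phiX : phi 'X = P - 1 by rewrite /phi /= horner_morphX.
have phiZ c Q : phi (c *: Q) = cst c * phi Q.
  by rewrite -mul_polyC rmorphM /= horner_morphC.
have phil : phi (log_trunc _ N) = CH_poly.
  by rewrite /log_trunc rmorph_sum; apply: eq_bigr => k _; rewrite phiZ rmorphXn /= phiX.
pose EL := \sum_(k < N.+1) cst (k`!%:R)^-1 * CH_poly ^+ k.
have phie : phi (exp_trunc N (log_trunc _ N)) = EL.
  by rewrite /exp_trunc rmorph_sum; apply: eq_bigr => k _; rewrite phiZ rmorphXn /= phil.
have EL1 : EL.[1] = exp_trunc N CH_poly.[1].
  by rewrite /EL horner_sum; apply: eq_bigr => k _; rewrite eval1_cstM eval1X.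
have wtEL : wt 1 (EL - 1).
  rewrite /EL big_ord_recl expr0 mulr1 fact0 invr1.
  rewrite -[cst 1]/(f 1) rmorph1 addrAC subrr add0r; apply: wt_sum => k _.
  have lk := logn_fact_le p_prime p_ge3 (ltn0Sn k).
  apply: (@wt_cst_div _ (logn p k.+1`!)); rewrite ?fact_gt0//.
  by apply: (@wt_le _ k.+1); [lia|exact/wtX/wt_CH_poly].
rewrite -EL1 -!exp_poly_eval -eval1M -hornerN -hornerD -addn1.
apply: eval1_wt => [|i iN].
  have -> : EL - exp_poly U * exp_poly V = (EL - 1) - (exp_poly U * exp_poly V - 1).
    by rewrite opprB addrA subrK.
  exact: wtB wtEL wt_exp_polyM.
rewrite -phie; have [Q ->] := exp_log_trunc F0 N.
rewrite rmorphD /= rmorphM rmorphXn rmorphD rmorph1 /= phiX (addrC 1) subrK.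
have PE : P`_i = (exp_poly U * exp_poly V)`_i.
  rewrite coefM coef_exp_mul//; apply: eq_bigr => j _; have := ltn_ord j => ji.
  rewrite !coef_poly; do 2 (case: ifP; last by lia); move=> _ _.
  by rewrite natrM invfM -scalerAl -scalerAr scalerA.
rewrite coefB coefD PE addrAC subrr add0r coefM big1// => j _.
rewrite [X in _ * X]coef_exp_low ?mulr0 ?coef0_P1//.
by have := ltn_ord j; lia.
Qed.
End CampbellHausdorffExp.
End Ball.

(** * The matrix exponential *)

Section ExpLimit.
Variables (p : nat) (p_prime : prime p) (p_ge3 : (3 <= p)%N).
Local Notation Zp := (padic_int p_prime).
Local Notation Qp := {fraction Zp}.
Local Notation ball := (@pball p p_prime).
Implicit Types U V : 'M[Qp]_2.

Lemma ball_exp_term k U : (0 < k)%N -> ball 1 U -> hball k.+1 ((k`!%:R)^-1 *: U ^+ k).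
Proof.
move=> k0 U1; have lk := logn_fact_le p_prime p_ge3 k0.
apply: (@ball_divn _ _ _ (logn p k`!)); rewrite ?fact_gt0//.
by apply: ball_le (ballX k U1); rewrite !uphalf_half; lia.
Qed.

Lemma exp_trunc_cauchy N N' U : (N <= N')%N -> ball 1 U ->
  hball N.+2 (exp_trunc N' U - exp_trunc N U).
Proof.
move=> NN U1; rewrite /exp_trunc -!(big_mkord xpredT (fun k => (k`!%:R)^-1 *: U ^+ k)).
rewrite (big_cat_nat (n := N.+1))//= addrAC subrr add0r.
apply: ball_sum_nat => k /andP[Nk _]; apply: hball_le (ball_exp_term _ U1); lia.
Qed.

Lemma exp_trunc_int N U : ball 1 U -> ball 0 (exp_trunc N U).
Proof.
move=> U1; rewrite -[exp_trunc N U](subrK (exp_trunc 0 U)); apply: ballD.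
  by apply: ball_le (exp_trunc_cauchy (leq0n N) U1).
by rewrite /exp_trunc big_ord1 fact0 invr1 scale1r; apply: ball1.
Qed.

Lemma ball_subX k m U V : ball 1 U -> ball 1 V -> ball m (U - V) ->
  ball (m + k) (U ^+ k.+1 - V ^+ k.+1).
Proof.
move=> U1 V1 UV; elim: k => [|k IH]; first by rewrite addn0 !expr1.
have -> : U ^+ k.+2 - V ^+ k.+2 = U ^+ k.+1 * (U - V) + (U ^+ k.+1 - V ^+ k.+1) * V.
  by rewrite mulrBr mulrBl -!exprSr addrA subrK.
apply: ballD; last by rewrite addnS -addn1; apply: ballM.
by rewrite addnC; apply: ballM UV; have := ballX k.+1 U1; rewrite mul1n.
Qed.

(** exp is 1-Lipschitz: U^(k+1) - V^(k+1) gains k factors of p over U - V, enough to pay for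
    (k+1)!. *)
Lemma exp_trunc_cont N m U V : ball 1 U -> ball 1 V -> ball m (U - V) ->
  ball m (exp_trunc N U - exp_trunc N V).
Proof.
move=> U1 V1 UV; rewrite /exp_trunc -sumrB; apply: ball_sum => -[[|k] kN] _ /=.
  by rewrite !expr0 subrr; apply: ball0.
rewrite -scalerBr; have lk := logn_fact_le p_prime p_ge3 (ltn0Sn k).
apply: (@ball_divn _ _ _ (logn p k.+1`!)); rewrite ?fact_gt0//.
by apply: ball_le (ball_subX k U1 V1 UV); lia.
Qed.

Lemma ball_complete (t : nat -> 'M[Qp]_2) : (forall m, ball 0 (t m)) ->
  (forall m n, (m <= n)%N -> ball m (t n - t m)) ->
  exists E : 'M[Zp]_2, forall m, ball m (to_Qp E - t m).
Proof.
move=> t0 tc.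
have /choice[E tE] m : exists E : 'M[Zp]_2, t m = to_Qp E.
  by have [E ->] := t0 m; exists E; rewrite expn0 scale1r.
(* Index n is a residue modulo p^(n+1), hence it is stable from [t n.+1] on. *)
have Ec n i j : padic_proj (E n.+2 i j) n = padic_proj (E n.+1 i j) n.
  have [D] := tc n.+1 n.+2 (leqnSn _); rewrite !tE -to_QpB => /to_Qp_inj/matrixP/(_ i j).
  rewrite !mxE => EE; apply/eqP; rewrite -subr_eq0; apply/eqP.
  by rewrite -[LHS]/(padic_proj (E n.+2 i j - E n.+1 i j : Zp) n) EE; apply/padic_divP; exists (D i j).
have compat i j n : @Zmod_red p n (padic_proj (E n.+2 i j) n.+1) = padic_proj (E n.+1 i j) n.
  by rewrite padic_compat Ec.
exists (\matrix_(i, j) (PadicSeq (compat i j) : Zp)) => -[|m].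
  by rewrite tE -to_QpB; apply: ball_int.
have /choice[D DE] (ij : 'I_2 * 'I_2) : exists w : Zp,
    (PadicSeq (compat ij.1 ij.2) : Zp) - E m.+1 ij.1 ij.2 = (p ^ m.+1)%:R * w.
  apply/padic_divP.
  by rewrite -[LHS]/(padic_proj (E m.+1 ij.1 ij.2) m - padic_proj (E m.+1 ij.1 ij.2) m) subrr.
exists (\matrix_(i, j) D (i, j)); rewrite tE -to_QpB; congr to_Qp.
by apply/matrixP => i j; rewrite !mxE -(DE (i, j)).
Qed.

Lemma exp_limit (u : 'M[Zp]_2) : ball 1 (to_Qp u) ->
  exists E : 'M[Zp]_2, forall N, hball N.+2 (to_Qp E - exp_trunc N (to_Qp u)).
Proof.
(* Truncation at order 2m because each further order gains only half a power of p. *)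
move=> u1; have [m|m n mn|E Em] := @ball_complete (fun m => exp_trunc m.*2 (to_Qp u)).
- exact: exp_trunc_int.
- have := @exp_trunc_cauchy m.*2 n.*2 _ _ u1; rewrite leq_double => /(_ mn).
  by apply: ball_le; rewrite !uphalf_half; lia.
exists E => N; apply: ball_trans (exp_trunc_cauchy _ u1).
  by apply: ball_le (Em N.+2); rewrite !uphalf_half; lia.
lia.
Qed.

(** From the quadratic term on, U^i / i! has valuation at least k + 1. The order [N.+1] guarantees
    that the linear term is present. *)
Lemma exp_trunc_first N k U : (0 < k)%N -> ball k U -> ball k.+1 (exp_trunc N.+1 U - 1 - U).
Proof.
move=> k0 Uk; rewrite /exp_trunc !big_ord_recl /= fact0 invr1 !scale1r expr1 expr0.
rewrite [1 + _]addrC addrK addrAC subrr add0r.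
apply: ball_sum => i _; rewrite /bump /= !add1n.
have li := logn_fact_le p_prime p_ge3 (ltn0Sn i.+1).
apply: (@ball_divn _ _ _ (logn p i.+2`!)); rewrite ?fact_gt0//.
apply: ball_le (ballX i.+2 Uk); nia.
Qed.

End ExpLimit.

(** * A matrix representation of G *)

Section ExpRepresentation.
Variables (p : nat) (p_prime : prime p) (p_ge3 : (3 <= p)%N).
Local Notation Zp := (padic_int p_prime).
Local Notation ball := (@pball p p_prime).
Variables (l : nat) (l_ge1 : (1 <= l)%N) (G : groupType) (e : 'M[Zp]_2 -> G).
Hypothesis eG : is_exp l e.

Lemma sl2_lattice_ball u : sl2_lattice l u -> ball l (to_Qp u).
Proof.
move=> [_ ul]; have /choice[D DE] (ij : 'I_2 * 'I_2) := ul ij.1 ij.2.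
exists (\matrix_(i, j) D (i, j)); congr to_Qp; apply/matrixP => i j.
by rewrite !mxE -(DE (i, j)).
Qed.

(** The matrix exponential turns the abstract group [G] into a group of
    matrices, in which commutators and powers are explicit. *)
Lemma exp_representation : exists rho : G -> 'M[Zp]_2,
  (forall x y, rho (x * y)%g = rho x * rho y) /\
  forall u k, sl2_lattice l u -> (0 < k)%N -> ball k (to_Qp u) ->
    ball k.+1 (to_Qp (rho (e u) - 1 - u)).
Proof.
have [eb em] := eG.
have u1 u : sl2_lattice l u -> ball 1 (to_Qp u).
  by move=> /sl2_lattice_ball; apply: ball_le.
have /choice[Ex ExE] u : exists E : 'M[Zp]_2, sl2_lattice l u ->
    forall N, hball N.+2 (to_Qp E - exp_trunc N (to_Qp u)).
  have [ul|ul] := pselect (sl2_lattice l u); last by exists 0.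
  by have [E EE] := exp_limit p_ge3 (u1 _ ul); exists E.
have [_ einj esurj] := eb.
have /choice[ei eiE] x : exists u, sl2_lattice l u /\ e u = x.
  by have [u ul <-] := esurj x I; exists u.
have eiK u : sl2_lattice l u -> ei (e u) = u.
  by move=> ul; have [eul eu] := eiE (e u); apply: einj; rewrite ?inE.
(* The representation is the matrix exponential after the inverse of the bijection [e]. *)
exists (Ex \o ei); split=> [x y|u k ul k0 uk] /=; last first.
  rewrite eiK// !to_QpB to_Qp1.
  set A := to_Qp (Ex u); set U := to_Qp u; set B := exp_trunc k.*2.+1 U.
  have -> : A - 1 - U = (A - B) + (B - 1 - U) by rewrite !addrA subrK.
  apply: ballD; last exact: exp_trunc_first.
  by apply: ball_le (ExE u ul k.*2.+1); rewrite !uphalf_half; lia.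
have [ul eu] := eiE x; have [vl ev] := eiE y.
set u := ei x in ul eu *; set v := ei y in vl ev *.
have [w [wl CHw ew]] := em u v ul vl.
have -> : ei (x * y)%g = w by rewrite -eu -ev ew eiK.
apply/eqP; rewrite -subr_eq0; apply/eqP/ball_all0 => m.
(* Precision m + 1, not m, so that the partial sum [S] stays in [ball 1] even for m = 0; the summand
   2m makes the truncation errors at N fall in [ball m]. *)
have [N0 CHm] := CHw m.+1; pose N := (N0 + m.*2)%N.
have small W : hball N.+2 W -> ball m W by apply: ball_le; rewrite uphalf_half; lia.
pose S := (CH_poly (to_Qp u) (to_Qp v) N).[1].
have Sw : ball m.+1 (to_Qp w - S).
  apply: ball_trans (CHm N (leq_addr _ _)) _.
  apply/ballC; apply: ball_le (CH_poly_eval p_ge3 N (u1 _ ul) (u1 _ vl)).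
  by rewrite uphalf_half; lia.
have S1 : ball 1 S.
  by rewrite -[S](subKr (to_Qp w)); apply: ballB (u1 _ wl) _; apply: ball_le Sw.
rewrite to_QpB to_QpM.
(* Modulo p^m: exp(w), its truncation, the truncation at [S], the product of the truncations at u
   and v, and finally exp(u) exp(v). *)
apply: (ball_trans (small _ (ExE w wl N))).
apply: (@ball_trans _ _ _ _ (exp_trunc N S)).
  by apply: exp_trunc_cont => //; [exact: u1|apply: ball_le Sw].
apply: ball_trans (small _ (exp_trunc_CH p_ge3 N (u1 _ ul) (u1 _ vl))) _.
have := small _ (ExE u ul N); have := small _ (ExE v vl N).
have := exp_trunc_int p_ge3 N (u1 _ ul); have := ball_int (Ex v).
set A := exp_trunc N (to_Qp u); set B := exp_trunc N (to_Qp v) => v0 A0 vB uA.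
have -> : A * B - to_Qp (Ex u) * to_Qp (Ex v) =
    A * (B - to_Qp (Ex v)) + (A - to_Qp (Ex u)) * to_Qp (Ex v).
  by rewrite mulrBr mulrBl addrA subrK.
apply: ballD.
  by apply: (ballM A0 (ballC vB)).
by rewrite -[m]addn0; apply: ballM v0; apply: ballC.
Qed.

End ExpRepresentation.

(** * Congruence filtration of G *)

Lemma mulr_sub_mul (R : pzRingType) (a b c d : R) :
  a * b - c * d = (a - c) * b + c * (b - d).
Proof. by rewrite mulrBl mulrBr addrA subrK. Qed.

Lemma commr_sub1 (R : pzRingType) (x y : R) :
  (x - 1) * (y - 1) - (y - 1) * (x - 1) = x * y - y * x.
Proof.
have E (a b : R) : (a - 1) * (b - 1) = a * b - 1 - ((a - 1) + (b - 1)).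
  by rewrite mulr_sub1 addrK.
rewrite !E [y - 1 + _]addrC; move: (x - 1 + (y - 1)) (x * y) (y * x) => s a b.
by rewrite opprB addrA subrK opprB addrA subrK.
Qed.

Section CongruenceFiltration.
Variables (p : nat) (p_prime : prime p).
Local Notation Zp := (padic_int p_prime).
Local Notation M2 := 'M[Zp]_2.

Definition pdvd (k : nat) (A : M2) : Prop := exists E, A = (p ^ k)%:R *: E.

Lemma pdvd_ball k A : pball k (to_Qp A) <-> pdvd k A.
Proof. by split=> [[E /to_Qp_inj ->]|[E ->]]; exists E. Qed.

Lemma pdvd0 k : pdvd k 0. Proof. by exists 0; rewrite scaler0. Qed.
Lemma pdvdD k A B : pdvd k A -> pdvd k B -> pdvd k (A + B).
Proof. by move=> [E ->] [E' ->]; exists (E + E'); rewrite scalerDr. Qed.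
Lemma pdvdN k A : pdvd k A -> pdvd k (- A).
Proof. by move=> [E ->]; exists (- E); rewrite scalerN. Qed.
Lemma pdvdB k A B : pdvd k A -> pdvd k B -> pdvd k (A - B).
Proof. by move=> kA /pdvdN; apply: pdvdD. Qed.
Lemma pdvdM k m A B : pdvd k A -> pdvd m B -> pdvd (k + m) (A * B).
Proof.
by move=> [E ->] [E' ->]; exists (E * E'); rewrite -scalerAl -scalerAr scalerA -natrM -expnD.
Qed.
Lemma pdvdMl k A B : pdvd k B -> pdvd k (A * B).
Proof. by move=> kB; rewrite -[k]add0n; apply: pdvdM => //; exists A; rewrite expn0 scale1r. Qed.
Lemma pdvdMr k A B : pdvd k A -> pdvd k (A * B).
Proof. by move=> kB; rewrite -[k]addn0; apply: pdvdM => //; exists B; rewrite expn0 scale1r. Qed.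
Lemma pdvd_le k m A : (k <= m)%N -> pdvd m A -> pdvd k A.
Proof.
by move=> /subnKC <- [E ->]; exists ((p ^ (m - k))%:R *: E); rewrite scalerA -natrM -expnD.
Qed.
Lemma pdvdZ k m A : pdvd m A -> pdvd (k + m) ((p ^ k)%:R *: A).
Proof. by move=> [E ->]; exists E; rewrite scalerA -natrM -expnD. Qed.

Lemma pexp_neq0 k : ((p ^ k)%:R : Zp) != 0.
Proof. by apply: padic_nat_neq0; rewrite expn_gt0 prime_gt0. Qed.

Lemma pdvdZI k m A : pdvd (k + m) ((p ^ k)%:R *: A) -> pdvd m A.
Proof.
move=> [E AE]; exists E; apply/matrixP => i j; apply: (mulfI (pexp_neq0 k)).
by have /matrixP/(_ i j) := AE; rewrite !mxE => ->; rewrite mulrA -natrM -expnD.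
Qed.

Variables (l : nat) (l_ge1 : (1 <= l)%N) (G : groupType) (rho : G -> M2).
Hypothesis rhoM : forall x y, rho (x * y)%g = rho x * rho y.
Hypothesis rho1 : rho 1%g = 1.

(** The shift by l makes level 0 the whole group. *)
Definition cgr (j : nat) (x : G) : Prop := pdvd (l + j) (rho x - 1).

(** [X] modulo p is the class of x in the layer of level j; it is additive in x ([leadM]). *)
Definition lead (j : nat) (x : G) (X : M2) : Prop :=
  pdvd (l + j).+1 (rho x - 1 - (p ^ (l + j))%:R *: X).

Lemma lead_cgr j x X : lead j x X -> cgr j x.
Proof.
move=> /(pdvd_le (leqnSn _)) jx; rewrite /cgr -[_ - 1](subrK ((p ^ (l + j))%:R *: X)).
by apply: pdvdD => //; exists X.
Qed.

Lemma lead_cong j x X Y : pdvd 1 (X - Y) -> lead j x X -> lead j x Y.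
Proof.
move=> XY jx; rewrite /lead.
have -> : rho x - 1 - (p ^ (l + j))%:R *: Y =
   (rho x - 1 - (p ^ (l + j))%:R *: X) + (p ^ (l + j))%:R *: (X - Y).
  by rewrite scalerBr addrA subrK.
by apply: pdvdD => //; rewrite -addn1; apply: pdvdZ.
Qed.

Lemma lead_cgrS j x X : lead j x X -> (cgr j.+1 x <-> pdvd 1 X).
Proof.
rewrite /lead /cgr addnS => jx; split=> [jx'|X1].
  apply: (@pdvdZI (l + j)); rewrite addn1.
  by rewrite -[_ *: X](subKr (rho x - 1)); apply: pdvdB.
rewrite -[_ - 1](subrK ((p ^ (l + j))%:R *: X)); apply: pdvdD => //.
by rewrite -addn1; apply: pdvdZ.
Qed.

Lemma leadM j x y X Y : lead j x X -> lead j y Y -> lead j (x * y)%g (X + Y).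
Proof.
move=> jx jy; rewrite /lead rhoM mulr_sub1.
have xy := pdvdM (lead_cgr jx) (lead_cgr jy).
rewrite scalerDr; set a := _ *: X; set b := _ *: Y.
rewrite -addrA opprD [_ - 1 + _ + _]addrACA; apply: pdvdD; last exact: pdvdD.
by apply: pdvd_le xy; lia.
Qed.

Lemma lead1 j : lead j 1%g 0.
Proof. by rewrite /lead rho1 scaler0 subr0 subrr; apply: pdvd0. Qed.

Lemma cgr_lead j x : cgr j x -> exists X, lead j x X.
Proof. by move=> [X xX]; exists X; rewrite /lead xX subrr; apply: pdvd0. Qed.

Lemma rhoV x : rho x * rho (x^-1)%g = 1.
Proof. by rewrite -rhoM mulgV rho1. Qed.

Lemma cgrV j x : cgr j x -> cgr j (x^-1)%g.
Proof.
move=> jx; rewrite /cgr -opprB; apply: pdvdN.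
by rewrite -{1}(rhoV x) -[X in _ - X]mul1r -mulrBl; apply: pdvdMr.
Qed.

Lemma leadV j x X : lead j x X -> lead j (x^-1)%g (- X).
Proof.
move=> jx; have [Y jY] := cgr_lead (cgrV (lead_cgr jx)).
have := leadM jx jY; rewrite mulgV /lead rho1 subrr sub0r => /pdvdN; rewrite opprK => XY.
apply: lead_cong jY; rewrite opprK addrC.
by apply: (@pdvdZI (l + j)); rewrite addn1.
Qed.

Lemma leadX j x X n : lead j x X -> lead j (x ^+ n)%g (n%:R *: X).
Proof.
move=> jx; elim: n => [|n IH]; first by rewrite scale0r; apply: lead1.
by rewrite expgS -(add1n n) natrD scalerDl scale1r; apply: leadM.
Qed.

Lemma rhoX x n : rho (x ^+ n)%g = rho x ^+ n.
Proof. by elim: n => [|n IH]; rewrite ?expg0 ?expr0// expgS exprS rhoM IH. Qed.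

Lemma cgr_conj j x y : cgr j x -> cgr j (x ^ y)%g.
Proof.
move=> jx; rewrite /cgr conjgE !rhoM -{1}(rhoV (y^-1)%g) invgK -mulrBr.
by rewrite -[X in _ * (_ - X)]mul1r -mulrBl; apply/pdvdMl/pdvdMr.
Qed.

(** The commutator minus 1 is (xy - yx) x^-1 y^-1, and xy - yx is the bracket of x - 1 and y - 1, of
    leading term p^(2l+i+j) [X, Y]. Only one l is absorbed by the index shift, so the level is i + j
    + l. *)
Lemma lead_comm i j x y X Y : lead i x X -> lead j y Y ->
  lead (i + j + l) (x * y * x^-1 * y^-1)%g (X * Y - Y * X).
Proof.
move=> ix jy; set s := (l + i)%N; set t := (l + j)%N.
have st : (l + (i + j + l) = s + t)%N by rewrite /s /t; lia.
have half i' j' x' y' X' Y' : (l + i' + (l + j') = s + t)%N -> lead i' x' X' -> lead j' y' Y' ->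
    pdvd (s + t).+1 ((rho x' - 1) * (rho y' - 1) - (p ^ (s + t))%:R *: (X' * Y')).
  move=> <- ix' jy'; rewrite expnD natrM.
  set a := rho x' - 1; set b := rho y' - 1; set u := (p ^ _)%:R; set v := (p ^ _)%:R.
  have -> : (u * v) *: (X' * Y') = u *: X' * (v *: Y') by rewrite -scalerAl -scalerAr scalerA.
  rewrite mulr_sub_mul.
  apply: pdvdD; first by rewrite -addSn; apply: pdvdM => //; apply: lead_cgr jy'.
  by rewrite -addnS; apply: pdvdM => //; exists X'.
have {half} := pdvdB (half _ _ _ _ _ _ erefl ix jy) (half _ _ _ _ _ _ (addnC _ _) jy ix).
set c := (p ^ (s + t))%:R; set A := _ * (rho y - 1); set B := _ * (rho x - 1) => AB.
have {AB} : pdvd (s + t).+1 ((A - B) - c *: (X * Y - Y * X)).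
  rewrite scalerBr opprB [c *: _ - _]addrC -addrACA [- B + _]addrC.
  by move: AB; rewrite opprB.
rewrite commr_sub1.
rewrite /lead st; set Z := rho x * rho y - _ => ZXY.
have -> : rho (x * y * x^-1 * y^-1)%g - 1 = Z * (rho x^-1%g * rho y^-1%g).
  by rewrite /Z mulrBl !rhoM !mulrA -(mulrA (rho y)) rhoV mulr1 rhoV.
set W := rho x^-1%g * _; have W1 : pdvd 1 (W - 1).
  have gx : pdvd (l + i) (rho x^-1%g - 1) := cgrV (lead_cgr ix).
  have gy : pdvd (l + j) (rho y^-1%g - 1) := cgrV (lead_cgr jy).
  rewrite /W mulr_sub1; apply: pdvdD; last apply: pdvdD.
  - by apply: pdvdMr; apply: pdvd_le gx; lia.
  - by apply: pdvd_le gx; lia.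
  - by apply: pdvd_le gy; lia.
rewrite -/c; have -> : Z * W - c *: (X * Y - Y * X) = (Z - c *: (X * Y - Y * X)) + Z * (W - 1).
  by rewrite mulrBr mulr1 [RHS]addrC addrA subrK.
apply: pdvdD => //; rewrite -addn1; apply: pdvdM => //.
rewrite -[Z](subrK (c *: (X * Y - Y * X))); apply: pdvdD; first exact: pdvd_le ZXY.
by exists (X * Y - Y * X).
Qed.

Hypothesis p_ge3 : (3 <= p)%N.

(** x^p - 1 is x - 1 times the sum of the x^i for i < p. That sum is p modulo p^2, because its
    linear correction carries the coefficient C(p, 2), divisible by p as p is odd. *)
Lemma lead_exp_p j x X : lead j x X -> lead j.+1 (x ^+ p)%g X.
Proof.
move=> jx; rewrite /lead addnS rhoX.
pose Y := rho x - 1; have Yj : pdvd (l + j) Y := lead_cgr jx.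
have xE : rho x = Y + 1 by rewrite subrK.
have XE n : pdvd (l + j) (rho x ^+ n - 1).
  elim: n => [|n IH]; first by rewrite expr0 subrr; apply: pdvd0.
  by rewrite exprS mulr_sub1; do !apply: pdvdD => //; apply: pdvdMr.
have X2 n : pdvd 2 (rho x ^+ n - 1 - n%:R * Y).
  elim: n => [|n IH]; first by rewrite expr0 subrr mul0r subr0; apply: pdvd0.
  have -> : rho x ^+ n.+1 - 1 - n.+1%:R * Y = (rho x ^+ n - 1 - n%:R * Y) + (rho x ^+ n - 1) * Y.
    rewrite exprSr {2}xE mulrDr mulr1 mulrBl mul1r -(addn1 n) natrD mulrDl mul1r opprD.
    by rewrite -(addrA (_ * Y)) [_ * Y + _]addrC [RHS]addrACA.
  by apply: pdvdD => //; apply: pdvd_le (pdvdM (XE n) Yj); lia.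
have S2 : pdvd 2 (\sum_(i < p) rho x ^+ i - p%:R).
  have -> : \sum_(i < p) rho x ^+ i - p%:R =
      \sum_(i < p) (rho x ^+ i - 1 - i%:R * Y) + 'C(p, 2)%:R * Y.
    rewrite !sumrB sumr_const card_ord -mulr_suml -natr_sum -bin2_sum big_mkord.
    by rewrite subrK.
  apply: pdvdD; first by elim/big_ind: _ => //; [exact: pdvd0|exact: pdvdD].
  have /dvdnP[c ->] : (p %| 'C(p, 2))%N by apply: prime_dvd_bin.
  rewrite mulnC natrM -mulrA; apply: pdvd_le (_ : pdvd (1 + (l + j)) _); first by lia.
  by apply: pdvdM; [exists 1; rewrite expn1 scaler_nat|apply: pdvdMl].
rewrite subrX1 -/Y.
have -> : Y * \sum_(i < p) rho x ^+ i - (p ^ (l + j).+1)%:R *: X =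
    Y * (\sum_(i < p) rho x ^+ i - p%:R) + p%:R *: (Y - (p ^ (l + j))%:R *: X).
  rewrite mulrBr scalerBr scalerA -natrM -expnS addrA; congr (_ - _).
  by rewrite scaler_nat mulr_natr subrK.
apply: pdvdD; first by apply: pdvd_le (pdvdM Yj S2); lia.
by rewrite -[X in X%:R]expn1 -[_.+2]add1n; apply: pdvdZ.
Qed.

End CongruenceFiltration.

(** * Abstract uniform chains, and the chain of exp(sl_2) *)

Section UniformChain.
Variables (p l : nat) (G : groupType).

Definition word (g : G * G * G) (n a b c : nat) : G :=
  (g.1.1 ^+ (n * a) * g.1.2 ^+ (n * b) * g.2 ^+ (n * c))%g.

(** The interface between group and group ring: the layers N_j / N_(j+1) have F_p-coordinates given
    by the p^j-th powers of three fixed generators. *)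
Record uniform_chain (N : nat -> nsubgroup G) (g : G * G * G) : Prop := UniformChain {
  chain0 : forall x, N 0%N x ;
  chainS : forall j x, N j.+1 x -> N j x ;
  chain_dec : forall j x, N j x ->
    exists a b c, N j.+1 ((word g (p ^ j) a b c)^-1 * x)%g ;
  chain_uniq : forall j a b c, N j.+1 (word g (p ^ j) a b c) ->
    [/\ (p %| a)%N, (p %| b)%N & (p %| c)%N] ;
  chain_pow : forall j x, N j x -> N j.+1 (x ^+ p)%g ;
  chain_comm : forall i j x y, N i x -> N j y -> N (i + j + l)%N (x * y * x^-1 * y^-1)%g }.

(** The bracket of x and y has coordinates a, b, c modulo p, uniformly in r. Coordinates are natural
    numbers, so -1 and -2 appear as p - 1 and p - 2. *)
Definition chain_bracket (N : nat -> nsubgroup G) (g : G * G * G) (x y : G) (a b c : nat) :=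
  forall r, N (r + l).+1 ((word g (p ^ (r + l)) a b c)^-1 *
    (x ^+ (p ^ r) * y * (x ^+ (p ^ r))^-1 * y^-1))%g.

End UniformChain.

Section Sl2Chain.
Variables (p : nat) (p_prime : prime p) (p_ge3 : (3 <= p)%N).
Local Notation Zp := (padic_int p_prime).
Local Notation M2 := 'M[Zp]_2.
Variables (l : nat) (l_ge1 : (1 <= l)%N) (G : groupType) (e : M2 -> G).
Hypothesis eG : is_exp l e.

(** The matrix a e + b f + c h in the standard basis of sl_2. *)
Definition sl2_comb (a b c : Zp) : M2 := \matrix_(i, j)
  if i == 0 then (if j == 0 then c else a) else (if j == 0 then b else - c).

Lemma sl2_combE a b c i j : sl2_comb a b c i j =
  if i == 0 then (if j == 0 then c else a) else (if j == 0 then b else - c).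
Proof. by rewrite mxE. Qed.

Lemma ord2_cases (i : 'I_2) : i = 0 \/ i = 1.
Proof. by case: i => -[|[|//]] i2; [left|right]; apply: val_inj. Qed.

Lemma mx2P (A B : M2) : A 0 0 = B 0 0 -> A 0 1 = B 0 1 -> A 1 0 = B 1 0 -> A 1 1 = B 1 1 -> A = B.
Proof.
move=> *; apply/matrixP => i j.
by have [->|->] := ord2_cases i; have [->|->] := ord2_cases j.
Qed.

Lemma sl2_combZ k a b c : k *: sl2_comb a b c = sl2_comb (k * a) (k * b) (k * c).
Proof. by apply: mx2P; rewrite !mxE /= ?mulrN. Qed.

Lemma sl2_combD a b c a' b' c' :
  sl2_comb a b c + sl2_comb a' b' c' = sl2_comb (a + a') (b + b') (c + c').
Proof. by apply: mx2P; rewrite !mxE /= ?opprD. Qed.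

Lemma sl2_combB a b c a' b' c' :
  sl2_comb a b c - sl2_comb a' b' c' = sl2_comb (a - a') (b - b') (c - c').
Proof. by apply: mx2P; rewrite !mxE /= ?opprD. Qed.

Lemma sl2_comb_bracket a b c a' b' c' :
  sl2_comb a b c * sl2_comb a' b' c' - sl2_comb a' b' c' * sl2_comb a b c =
  sl2_comb (2%:R * (c * a' - a * c')) (2%:R * (b * c' - c * b')) (a * b' - b * a').
Proof.
rewrite -![_ * _]/(_ *m _).
by apply: mx2P; rewrite !mxE !big_ord_recl !big_ord0 !mxE /=; ring.
Qed.

Lemma sl2_lattice_comb a b c : sl2_lattice l ((p ^ l)%:R *: sl2_comb a b c).
Proof.
split=> [|i j]; last by exists (sl2_comb a b c i j); rewrite mxE.
by rewrite sl2_combZ /mxtrace big_ord_recl big_ord1 !mxE /= subrr.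
Qed.

Lemma sl2_latticeP u : sl2_lattice l u -> exists a b c, u = sl2_comb a b c.
Proof.
move=> [tu _]; exists (u 0 1), (u 1 0), (u 0 0); apply: mx2P; rewrite sl2_combE //=.
move: tu; rewrite /mxtrace big_ord_recl big_ord1 => /eqP; rewrite addrC addr_eq0 => /eqP <-.
by congr (u _ _); apply: val_inj.
Qed.

Lemma padic_mod_nat (z : Zp) : exists (a : nat) w, z = a%:R + p%:R * w.
Proof.
exists (padic_proj z 0); have [|w] := (padic_divP (z - (padic_proj z 0 : nat)%:R) 0).1.
  rewrite -[LHS]/(padic_proj z 0 - padic_proj ((padic_proj z 0 : nat)%:R : Zp) 0).
  by rewrite padic_proj_nat -Zmod_nat subrr.
have e1 : (p ^ 1)%:R = p%:R :> Zp by rewrite expn1.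
by rewrite e1 => wE; exists w; rewrite -wE addrC subrK.
Qed.

Lemma padic_dvd_nat (a : nat) (w : Zp) : a%:R = p%:R * w -> (p %| a)%N.
Proof.
move=> aw; have : padic_proj (a%:R : Zp) 0 = 0 by apply/padic_divP; exists w; rewrite expn1.
rewrite padic_proj_nat => /eqP; rewrite -[0]/(0%:R) Zmod_natE// expn1 mod0n => /eqP a0.
by rewrite /dvdn a0.
Qed.

Theorem exp_chain : exists (N : nat -> nsubgroup G) (g : G * G * G),
  [/\ uniform_chain p l N g,
      forall j, exp_open l e (N j),
      forall U : set G, exp_open l e U -> U 1%g -> exists j, forall x, N j x -> U x &
      let: (x, y, z) := g in
      [/\ chain_bracket p l N g x y 0 0 1, chain_bracket p l N g x z (p - 2) 0 0
        & chain_bracket p l N g y z 0 2 0] /\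
      [/\ chain_bracket p l N g y x 0 0 (p - 1), chain_bracket p l N g z x 2 0 0
        & chain_bracket p l N g z y 0 (p - 2) 0]].
Proof.
have [rho [rhoM rhoE]] := exp_representation p_ge3 l_ge1 eG.
have {}rhoE u k : sl2_lattice l u -> (0 < k)%N -> pdvd k u -> pdvd k.+1 (rho (e u) - 1 - u).
  by move=> ul k0 /pdvd_ball uk; apply/pdvd_ball/rhoE.
have [[_ einj esurj] _] := eG.
have all0 (u : M2) : (forall k, pdvd k u) -> u = 0.
  by move=> uk; apply: ball_all0 => k; apply/pdvd_ball.
have lat_dvd (u : M2) : sl2_lattice l u -> pdvd l u by move=> /sl2_lattice_ball/pdvd_ball.
(* u and rho(e u) - 1 have the same valuation. Both are divisible by p^l; beyond that, each known
   power of p dividing u makes their difference divisible by one more. *)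
have rhoP u k : sl2_lattice l u -> pdvd k (rho (e u) - 1) <-> pdvd k u.
  move=> ul; have [kl|/ltnW lk] := leqP k l.
    split=> _; first by apply: (pdvd_le kl); apply: lat_dvd.
    rewrite -[_ - 1](subrK u); apply: pdvdD; last by apply: (pdvd_le kl); apply: lat_dvd.
    by apply: pdvd_le (rhoE u l ul l_ge1 (lat_dvd u ul)); lia.
  split=> [|uk].
    rewrite -(subnKC lk); elim: (k - l)%N => [_|i IH ik]; first by rewrite addn0; apply: lat_dvd.
    have ui : pdvd (l + i) u by apply: IH; apply: pdvd_le ik; lia.
    rewrite addnS -(subKr (rho (e u) - 1) u); apply: pdvdB; first by rewrite -addnS.
    by apply: rhoE => //; lia.
  rewrite -[_ - 1](subrK u); apply: pdvdD => //.
  have k0 : (0 < k)%N by lia.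
  exact: pdvd_le (leqnSn k) (rhoE u k ul k0 uk).
have lat0 : sl2_lattice l (0 : M2).
  by split=> [|i j]; [rewrite mxtrace0|exists 0; rewrite mxE mulr0].
(* [rho] is only known to be multiplicative; rho 1 = 1 follows from the value at [e 0], and [rhoP]
   then identifies [e 0] with the unit. *)
have rho_e0 : rho (e 0) = 1.
  by apply/eqP; rewrite -subr_eq0; apply/eqP/all0 => k; apply/rhoP => //; apply: pdvd0.
have rho1 : rho 1%g = 1.
  by rewrite -[LHS]mulr1 -rho_e0 -rhoM mul1g.
have e0 : e 0 = 1%g.
  have [u ul eu] := esurj 1%g I.
  suff u0 : u = 0 by rewrite -u0.
  by apply: all0 => k; apply/rhoP => //; rewrite eu rho1 subrr; apply: pdvd0.
have lM := leadM l_ge1 rhoM; have lX := leadX l_ge1 rhoM rho1; have lV := leadV l_ge1 rhoM rho1.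
have subN j : is_subgroup (cgr l rho j).
  split=> [|x y jx jy]; first exact: lead_cgr (lead1 _ rho1 j).
  have [X jX] := cgr_lead jx; have [Y jY] := cgr_lead jy.
  exact: lead_cgr (lM _ _ _ _ _ jX (lV _ _ _ jY)).
pose N j : nsubgroup G := NSubgroup (subN j) (@cgr_conj _ _ _ _ _ rhoM rho1 j).
have latP x j : N j x -> exists a b c, lead l rho j x (sl2_comb a b c).
  have [u ul <-] := esurj x I => /(rhoP _ _ ul) [u0 uE].
  have uj : pdvd (l + j) u by exists u0.
  have [a [b [c cE]]] := sl2_latticeP ul.
  exists (u0 0 1), (u0 1 0), (u0 0 0).
  (* u0 inherits trace zero from u = p^(l+j) u0, since Z_p is a domain. *)
  have -> : sl2_comb (u0 0 1) (u0 1 0) (u0 0 0) = u0.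
    apply: mx2P; rewrite sl2_combE //=; apply: (mulfI (pexp_neq0 p_prime (l + j))).
    have uEij i k : (p ^ (l + j))%:R * u0 i k = u i k by rewrite uE mxE.
    by rewrite mulrN !uEij cE !sl2_combE.
  by rewrite /lead -uE; apply: rhoE => //; lia.
have lat0E (a b c : nat) : lead l rho 0 (e ((p ^ l)%:R *: sl2_comb a%:R b%:R c%:R))
    (sl2_comb a%:R b%:R c%:R).
  rewrite /lead addn0; apply: rhoE => //; first exact: sl2_lattice_comb.
  by exists (sl2_comb a%:R b%:R c%:R).
pose gen (a b c : nat) := e ((p ^ l)%:R *: sl2_comb a%:R b%:R c%:R).
pose g := (gen 1%N 0%N 0%N, gen 0%N 1%N 0%N, gen 0%N 0%N 1%N).
have lexp j x X : lead l rho 0 x X -> lead l rho j (x ^+ (p ^ j))%g X.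
  move=> x0; elim: j => [|j IH]; first by rewrite expn0 expg1.
  by rewrite expnSr expgnA; apply: (lead_exp_p l_ge1 rhoM rho1 p_ge3).
have lword j (a b c : nat) : lead l rho j (word g (p ^ j) a b c) (sl2_comb a%:R b%:R c%:R).
  have -> : sl2_comb a%:R b%:R c%:R = a%:R *: sl2_comb 1%:R 0%:R 0%:R +
      b%:R *: sl2_comb 0%:R 1%:R 0%:R + c%:R *: sl2_comb 0%:R 0%:R 1%:R.
    by rewrite !sl2_combZ !sl2_combD !mulr0 !mulr1 !add0r !addr0.
  by rewrite /word !expgnA; apply: (lM); [apply: (lM)|]; apply: (lX); apply: lexp; apply: lat0E.
have pdvd_comb (a b c : Zp) : pdvd 1 (sl2_comb a b c) <->
    [/\ exists w, a = p%:R * w, exists w, b = p%:R * w & exists w, c = p%:R * w].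
  split=> [[E /matrixP cE]|[[u ->] [v ->] [w ->]]].
    by split; [exists (E 0 1)|exists (E 1 0)|exists (E 0 0)];
      [have := cE 0 1|have := cE 1 0|have := cE 0 0]; rewrite !mxE expn1.
  by exists (sl2_comb u v w); rewrite sl2_combZ expn1.
have NS j x X : lead l rho j x X -> pdvd 1 X -> N j.+1 x.
  by move=> jx X1; apply/(lead_cgrS jx).
have bracket x y X Y (a b c : nat) : lead l rho 0 x X -> lead l rho 0 y Y ->
    pdvd 1 (- sl2_comb a%:R b%:R c%:R + (X * Y - Y * X)) -> chain_bracket p l N g x y a b c.
  move=> x0 y0 XY r; have xr := lexp r _ _ x0.
  have := lead_comm l_ge1 rhoM rho1 xr y0; rewrite addn0 => cr.
  exact: NS (lM _ _ _ _ _ (lV _ _ _ (lword _ a b c)) cr) XY.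
exists N, g; split.
- split.
  + move=> x; have [u ul <-] := esurj x I; apply/rhoP => //; rewrite addn0; exact: lat_dvd.
  + by move=> j x; apply: pdvd_le; lia.
  + move=> j x /latP[a [b [c jx]]].
    have [a' [u au]] := padic_mod_nat a; have [b' [v bv]] := padic_mod_nat b.
    have [c' [w cw]] := padic_mod_nat c; exists a', b', c'.
    apply: NS (lM _ _ _ _ _ (lV _ _ _ (lword _ a' b' c')) jx) _.
    rewrite addrC sl2_combB; apply/pdvd_comb.
    have P1 (m : nat) (w' : Zp) : exists w'', m%:R + p%:R * w' - m%:R = p%:R * w''.
      by exists w'; rewrite addrAC subrr add0r.
    by rewrite au bv cw; split; apply: P1.
  + move=> j a b c /(lead_cgrS (lword j a b c))/pdvd_comb[[u au] [v bv] [w cw]].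
    by split; apply: padic_dvd_nat; eassumption.
  + by move=> j x /cgr_lead[X jx]; apply: lead_cgr (lead_exp_p l_ge1 rhoM rho1 p_ge3 jx).
  + move=> i j x y /cgr_lead[X ix] /cgr_lead[Y jy].
    exact: lead_cgr (lead_comm l_ge1 rhoM rho1 ix jy).
- move=> j u ul; rewrite /= => /(rhoP _ _ ul) uj; exists (l + j)%N => w wl.
  rewrite -to_QpB => /pdvd_ball wu; apply/(rhoP _ _ wl).
  by rewrite -[w](subrK u); apply: pdvdD.
- move=> U oU U1; have [|m mU] := oU 0 lat0; first by rewrite e0.
  exists m => x; have [w wl <-] := esurj x I => /(rhoP _ _ wl) wm; apply: mU => //.
  by rewrite -to_QpB subr0; apply/pdvd_ball; apply: pdvd_le wm; lia.
rewrite /g; split; split; apply: bracket; try exact: lat0E;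
  rewrite sl2_comb_bracket addrC sl2_combB; apply/pdvd_comb; split.
all: try (exists 0; ring).
(* What remains are the coordinates -1 - (p - 1) and -2 - (p - 2), both equal to -p. *)
all: by exists (-1); rewrite natrB ?prime_gt0 ?prime_gt1//; ring.
Qed.

End Sl2Chain.

(** * Group rings and augmentation powers *)

Section GroupRingBasics.
Variables (K : fieldType) (G : groupType).
Implicit Types (f g : gralg K G) (x y : G) (c d : K).

Fact gralg_nz : (1 : gralg K G) != 0.
Proof.
by apply/eqP => /(congr1 (fun f : gralg K G => f 1%g)) /= /eqP; rewrite eqxx oner_eq0.
Qed.
HB.instance Definition _ := GRing.PzSemiRing_isNonZero.Build (gralg K G) gralg_nz.

Definition dl x : gralg K G := gdelta 1 x.
Definition sc c : gralg K G := gdelta c 1%g.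

Lemma dlM x y : dl (x * y)%g = dl x * dl y.
Proof.
apply/gralgP => z; rewrite [RHS](gmul_deltal 1 x (dl y) z) mul1r /=.
have -> // : ((x^-1 * z)%g == y) = (z == (x * y)%g) by rewrite -[LHS](inj_eq (mulgI x)) mulVKg.
Qed.

Lemma dl1 : dl 1%g = 1. Proof. by []. Qed.

Lemma gdeltaE c x : gdelta c x = sc c * dl x.
Proof.
apply/gralgP => z; rewrite [RHS](gmul_deltal c 1%g (dl x) z) /= invg1 mul1g.
by case: ifP => _; rewrite ?mulr1 ?mulr0.
Qed.

Lemma sc_coef c f z : (sc c * f) z = c * f z.
Proof. by rewrite [LHS](gmul_deltal c 1%g f z) invg1 mul1g. Qed.

Lemma scD c d : sc (c + d) = sc c + sc d.
Proof. by apply/gralgP => z; rewrite gcoefD /=; case: ifP; rewrite ?addr0. Qed.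
Lemma sc0 : sc 0 = 0.
Proof. by apply: (addrI (sc 0)); rewrite -scD !addr0. Qed.
Lemma scN c : sc (- c) = - sc c.
Proof. by apply: (addrI (sc c)); rewrite -scD !subrr sc0. Qed.
Lemma sc1 : sc 1 = 1. Proof. by []. Qed.
Lemma scM c d : sc (c * d) = sc c * sc d.
Proof. by apply/gralgP => z; rewrite sc_coef /=; case: ifP; rewrite ?mulr0. Qed.
Lemma sc_nat n : sc n%:R = n%:R.
Proof. by elim: n => [|n IH]; [exact: sc0|rewrite -addn1 !natrD scD IH]. Qed.

Lemma gralg_pchar p : p \in [pchar K] -> p \in [pchar (gralg K G)].
Proof. by move=> /andP[pp /eqP p0]; apply/andP; split=> //; rewrite -sc_nat p0 sc0. Qed.

Lemma gsum_coef (I : Type) (r : seq I) (F : I -> gralg K G) z :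
  (\sum_(i <- r) F i) z = \sum_(i <- r) F i z.
Proof. by elim/big_rec2: _ => [//|i a b _ <-]; rewrite gcoefD. Qed.

Lemma gralg_sum f s : uniq s -> (forall x, f x != 0 -> x \in s) ->
  f = \sum_(x <- s) sc (f x) * dl x.
Proof.
move=> us fs; apply/gralgP => z; rewrite gsum_coef.
under eq_bigr => x _ do rewrite sc_coef /=.
have [zs|zs] := boolP (z \in s).
  rewrite (bigD1_seq z)//= eqxx mulr1 big1 ?addr0// => x xz.
  by rewrite eq_sym (negPf xz) mulr0.
have /eqP -> : f z == 0 by apply: contraR zs => /fs.
by rewrite big_seq big1// => x xs; case: eqP => [zx|]; rewrite ?mulr0//; rewrite zx xs in zs.
Qed.

Lemma gralg_ind (P : gralg K G -> Prop) : P 0 -> (forall f g, P f -> P g -> P (f + g)) ->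
  (forall c x, P (sc c * dl x)) -> forall f, P f.
Proof.
move=> P0 PD Px f; have [s us fs] := gsuppP f; rewrite (gralg_sum us fs).
by elim/big_ind: _.
Qed.

Lemma sc_comm c f : sc c * f = f * sc c.
Proof.
elim/gralg_ind: f => [|f g IHf IHg|d x]; first by rewrite mulr0 mul0r.
  by rewrite mulrDr mulrDl IHf IHg.
have scx b : sc b * dl x = dl x * sc b.
  apply/gralgP => z; rewrite sc_coef [RHS](gmul_deltal 1 x (sc b) z) mul1r /=.
  have -> : ((x^-1 * z)%g == 1%g) = (z == x) by rewrite -[LHS](inj_eq (mulgI x)) mulVKg mulg1.
  by case: ifP => _; rewrite ?mulr1 ?mulr0.
by rewrite mulrA -scM mulrC scM -!mulrA scx.
Qed.

Lemma sumr_aug f : aug_ideal f -> exists2 s, uniq s & f = \sum_(x <- s) sc (f x) * (dl x - 1).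
Proof.
have [s us fs] := gsuppP f => f0; exists s => //.
under eq_bigr => x _ do rewrite mulrBr mulr1.
rewrite sumrB -(gralg_sum us fs).
have -> : \sum_(x <- s) sc (f x) = sc (\sum_(x <- s) f x).
  by elim/big_rec2: _ => [|i a b _ ->]; rewrite ?sc0 ?scD.
move: f0; rewrite /aug_ideal /= (fsumE us)// => ->.
by rewrite sc0 subr0.
Qed.

Lemma aug_dl x : aug_ideal (dl x - 1).
Proof.
by apply/aug_idealP; rewrite gmapB gmap_delta gmap1 ?subrr// => a b; rewrite mulg1.
Qed.

Lemma aug_power1 f : aug_ideal f -> aug_power 1 f.
Proof.
move=> f0; exists [:: (1, f)]; rewrite big_seq1 mul1r; split=> // u.
by rewrite mem_seq1 => /eqP ->.
Qed.

Lemma aug_power1_dl x : aug_power 1 (dl x - 1).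
Proof. exact/aug_power1/aug_dl. Qed.

Lemma aug_powerZ m c f : aug_power m f -> aug_power m (sc c * f).
Proof. exact: aug_powerMl. Qed.

Lemma aug_powerMn m n f : aug_power m f -> aug_power m (f *+ n).
Proof.
move=> mf; elim: n => [|n IH]; first by rewrite mulr0n; apply: aug_power0.
by rewrite mulrS; apply: aug_powerD.
Qed.

Lemma aug_powerX m n f : aug_power m f -> aug_power (m * n) (f ^+ n).
Proof.
move=> mf; elim: n => [|n IH]; first by rewrite muln0.
by rewrite exprS mulnS; apply: aug_powerM.
Qed.

(** J is spanned over K by the x - 1, and scalars can be moved into the left factor, so products u
    (x - 1) with u in J^m already generate J^(m+1) additively. *)
Lemma aug_powerS_ind m (P : gralg K G -> Prop) : P 0 -> (forall f g, P f -> P g -> P (f + g)) ->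
  (forall u x, aug_power m u -> P (u * (dl x - 1))) -> forall f, aug_power m.+1 f -> P f.
Proof.
move=> P0 PD Px f [s [sP ->]]; rewrite big_seq; elim/big_ind: _ => // -[u v] /sP[/= um v0].
have [t ut ->] := sumr_aug v0; rewrite mulr_sumr; elim/big_ind: _ => // x _.
by rewrite mulrA; apply: Px; apply: aug_powerMr.
Qed.

Lemma aug_power_add_ind m n (P : gralg K G -> Prop) : P 0 -> (forall f g, P f -> P g -> P (f + g)) ->
  (forall u v, aug_power m u -> aug_power n v -> P (u * v)) ->
  forall f, aug_power (m + n) f -> P f.
Proof.
elim: n P => [|n IH] P P0 PD Puv f.
  by rewrite addn0 -[f]mulr1 => fm; apply: Puv => //; rewrite -[f]mulr1.
rewrite addnS; apply: aug_powerS_ind => // u x; move: u; apply: IH => [|f' g|u v um vn].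
- by rewrite mul0r.
- by rewrite mulrDl; apply: PD.
rewrite -mulrA; apply: Puv => //; rewrite -addn1; apply: aug_powerM => //.
exact: aug_power1_dl.
Qed.

Lemma aug_ideal_sc f : exists c, aug_ideal (f - sc c).
Proof.
have [s us fs] := gsuppP f; exists (\sum_(x <- s) f x); apply/aug_idealP/gralgP => z.
rewrite gmapB gcoefD gcoefN (gmapE _ _ us)// gmap_delta /= eq_sym.
by case: eqP => _; rewrite ?subrr// big_pred0_eq subr0.
Qed.

End GroupRingBasics.

Section GmapAug.
Variables (K : fieldType) (G H : groupType) (h : G -> H).
Hypothesis hM : {morph h : x y / (x * y)%g}.

Lemma morph_g1 : h 1%g = 1%g.
Proof. by apply: (@mulgI _ (h 1%g)); rewrite -hM !mulg1. Qed.

Lemma gmap_dl x : gmap h (dl K x) = dl K (h x).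
Proof. exact: gmap_delta. Qed.
Lemma gmap_sc (c : K) : gmap h (sc G c) = sc H c.
Proof. by rewrite gmap_delta morph_g1. Qed.

Lemma gmap_sum (I : Type) (r : seq I) (F : I -> gralg K G) :
  gmap h (\sum_(i <- r) F i) = \sum_(i <- r) gmap h (F i).
Proof. by elim/big_rec2: _ => [|i a b _ <-]; rewrite ?gmap0 ?gmapD. Qed.

Lemma gmap_aug_power m (f : gralg K G) : aug_power m f -> aug_power m (gmap h f).
Proof.
elim: m f => [//|m IH]; apply: aug_powerS_ind => [|f g|u x um].
- by rewrite gmap0; apply: aug_power0.
- by rewrite gmapD; apply: aug_powerD.
rewrite gmapM// gmapB gmap1// gmap_dl -addn1.
by apply: aug_powerM; [apply: IH|apply: aug_power1_dl].
Qed.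

Lemma aug_power_lift m (f : gralg K H) : (forall y, exists x, h x = y) ->
  aug_power m f -> exists2 f', aug_power m f' & gmap h f' = f.
Proof.
move=> hs; elim: m f => [|m IH] f.
  move=> _; elim/gralg_ind: f => [|f g [f' _ <-] [g' _ <-]|c y].
  - by exists 0 => //; rewrite gmap0.
  - by exists (f' + g') => //; rewrite gmapD.
  - have [x <-] := hs y; exists (sc G c * dl K x) => //.
    by rewrite gmapM// gmap_sc gmap_dl.
move: f; apply: aug_powerS_ind => [|f g [f' fm <-] [g' gm <-]|u y um].
- by exists 0; [apply: aug_power0|rewrite gmap0].
- by exists (f' + g'); [apply: aug_powerD|rewrite gmapD].
- have [x <-] := hs y; have [u' um' <-] := IH _ um.
  exists (u' * (dl K x - 1)); last by rewrite gmapM// gmapB gmap1// gmap_dl.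
  by rewrite -addn1; apply: aug_powerM => //; apply: aug_power1_dl.
Qed.

End GmapAug.

(** * The group algebra of G modulo a congruence subgroup *)

Section CommutatorRing.
Variable A : pzRingType.
Implicit Types a u v : A.

Lemma commutator0 a : commutator a 0 = 0.
Proof. by rewrite /commutator mulr0 mul0r subr0. Qed.
Lemma commutatorD a u v : commutator a (u + v) = commutator a u + commutator a v.
Proof. by rewrite /commutator mulrDr mulrDl opprD addrACA. Qed.
Lemma commutatorDl a u v : commutator (u + v) a = commutator u a + commutator v a.
Proof. by rewrite /commutator mulrDr mulrDl opprD addrACA. Qed.
Lemma commutatorN a u : commutator a (- u) = - commutator a u.
Proof. by rewrite /commutator mulrN mulNr -opprD. Qed.
Lemma commutator1 a : commutator a 1 = 0.
Proof. by rewrite /commutator mulr1 mul1r subrr. Qed.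
Lemma commutatorC u v : commutator u v = - commutator v u.
Proof. by rewrite /commutator opprB. Qed.
Lemma commutatorM a u v : commutator a (u * v) = commutator a u * v + u * commutator a v.
Proof. by rewrite /commutator mulrBl mulrBr !mulrA addrA subrK. Qed.
Lemma commutatorMl a u v : commutator (u * v) a = u * commutator v a + commutator u a * v.
Proof. by rewrite /commutator mulrBl mulrBr !mulrA addrA subrK. Qed.
Lemma commutatorB1 a u : commutator a (u - 1) = commutator a u.
Proof. by rewrite commutatorD commutatorN commutator1 subr0. Qed.
Lemma commutatorB1l a u : commutator (u - 1) a = commutator u a.
Proof. by rewrite commutatorC commutatorB1 -commutatorC. Qed.

End CommutatorRing.

Section AugCommutator.
Variables (K : fieldType) (H : groupType).
Implicit Types (a u v : gralg K H).

Lemma commutator_sc a c u : commutator a (sc H c * u) = sc H c * commutator a u.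
Proof. by rewrite /commutator mulrBr !mulrA -(sc_comm c a). Qed.
Lemma commutator_scl a c u : commutator (sc H c * u) a = sc H c * commutator u a.
Proof. by rewrite commutatorC commutator_sc -mulrN -commutatorC. Qed.

(** [a, -] is a derivation, so its degree on all of K[H] is read off the generators. *)
Lemma aug_power_commutator a t : (forall y, aug_power t.+1 (commutator a (dl K y))) ->
  forall m f, aug_power m f -> aug_power (m + t) (commutator a f).
Proof.
move=> ta; elim=> [|m IH].
  move=> f _; elim/gralg_ind: f => [|f f' IH IH'|c y].
  - by rewrite commutator0; apply: aug_power0.
  - by rewrite commutatorD; apply: aug_powerD.
  - by rewrite commutator_sc; apply: aug_powerZ; apply: aug_powerS; apply: ta.
apply: aug_powerS_ind => [|f f' Hf Hf'|u y um].
- by rewrite commutator0; apply: aug_power0.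
- by rewrite commutatorD; apply: aug_powerD.
rewrite commutatorM commutatorB1; apply: aug_powerD; last first.
  by rewrite addSnnS; apply: aug_powerM.
rewrite addSn -addn1; apply: aug_powerM; [exact: IH|exact: aug_power1_dl].
Qed.

Hypothesis H2 : forall x y : H, aug_power 3 (commutator (dl K x) (dl K y)).

(** Commutativity of the associated graded ring reduces to group elements: commutators in J^3 beat
    the expected degree 2, and the derivation rule spreads this to all products. *)
Lemma aug_power_gr_comm m n u v : aug_power m u -> aug_power n v ->
  aug_power (m + n).+1 (commutator u v).
Proof.
move=> um vn; have xv x := @aug_power_commutator (dl K x) 2 (H2 x) n v vn.
elim: m u um => [|m IH].
  move=> u _; elim/gralg_ind: u => [|f f' IH IH'|c y].
  - by rewrite commutatorC commutator0 oppr0; apply: aug_power0.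
  - by rewrite commutatorDl; apply: aug_powerD.
  - by rewrite commutator_scl; apply: aug_powerZ; apply: aug_power_le (xv y); lia.
apply: aug_powerS_ind => [|f f' Hf Hf'|u y um].
- by rewrite commutatorC commutator0 oppr0; apply: aug_power0.
- by rewrite commutatorDl; apply: aug_powerD.
rewrite commutatorMl commutatorB1l; apply: aug_powerD.
  by apply: aug_power_le (aug_powerM um (xv y)); lia.
by apply: aug_power_le (aug_powerM (IH _ um) (aug_power1_dl K y)); lia.
Qed.

End AugCommutator.

Section Level.
Variables (p : nat) (p_prime : prime p) (p_ge3 : (3 <= p)%N).
Variables (K : fieldType) (charK : p \in [pchar K]).
Variables (l : nat) (l_ge1 : (1 <= l)%N) (G : groupType).
Variables (N : nat -> nsubgroup G) (g : G * G * G).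
Hypothesis uc : uniform_chain p l N g.

Lemma chain_le i j x : (i <= j)%N -> N j x -> N i x.
Proof.
move=> /subnK <-; elim: (j - i)%N => [//|k IH]; rewrite addSn => /(chainS uc).
exact: IH.
Qed.

Lemma chain_exp_p j x : N 0%N x -> N j (x ^+ (p ^ j))%g.
Proof.
move=> x0; elim: j => [|j IH]; first by rewrite expn0 expg1.
by rewrite expnSr expgnA; apply: (chain_pow uc).
Qed.

Variable n : nat.
Local Notation A := (gralg K (quotg (N n))).

Definition gel (x : G) : A := dl K (coset (N n) x).

Lemma gelM x y : gel (x * y)%g = gel x * gel y.
Proof. by rewrite /gel cosetM dlM. Qed.
Lemma gel1 : gel 1%g = 1. Proof. by rewrite /gel morph_g1 ?dl1//; apply: cosetM. Qed.
Lemma gelX x i : gel (x ^+ i)%g = gel x ^+ i.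
Proof. by elim: i => [|i IH]; [rewrite expg0 gel1 expr0|rewrite expgS exprS gelM IH]. Qed.
Lemma gel_eq x y : N n (x^-1 * y)%g -> gel x = gel y.
Proof. by move=> /cosetP e; rewrite /gel e. Qed.
Lemma gel_N x : N n x -> gel x = 1.
Proof. by move=> xn; rewrite -gel1; apply/esym/gel_eq; rewrite invg1 mul1g. Qed.
Lemma coset_surj (c : quotg (N n)) : exists x, coset (N n) x = c.
Proof. by exists (repr c); apply: coset_repr. Qed.

Lemma frobenius_sub1 (x : A) j : (x - 1) ^+ (p ^ j) = x ^+ (p ^ j) - 1.
Proof.
elim: j => [|j IH]; first by rewrite !expn0 !expr1.
rewrite expnSr exprM IH (exprM x).
have pA := gralg_pchar (quotg (N n)) charK.
rewrite -[LHS](pFrobenius_autE pA) pFrobenius_autB_comm ?pFrobenius_autE ?expr1n//.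
exact: commr1.
Qed.

Lemma gel_exp_p x j : gel (x ^+ (p ^ j))%g - 1 = (gel x - 1) ^+ (p ^ j).
Proof. by rewrite gelX frobenius_sub1. Qed.

(** [a] represents x - 1 in J^q / J^(q+1), where products of group elements become sums. *)
Definition symb (q : nat) (x : G) (a : A) : Prop :=
  aug_power q (gel x - 1) /\ aug_power q.+1 (gel x - 1 - a).

Lemma symbM q x y a b : (0 < q)%N -> symb q x a -> symb q y b -> symb q (x * y)%g (a + b).
Proof.
move=> q0 [xq xa] [yq yb]; have xy := aug_powerM xq yq.
rewrite /symb gelM mulr_sub1; split.
  by apply: aug_powerD; [apply: aug_power_le xy; lia|apply: aug_powerD].
rewrite -addrA opprD [_ - 1 + _ + _]addrACA; apply: aug_powerD; last exact: aug_powerD.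
by apply: aug_power_le xy; lia.
Qed.

Lemma symb1 q : symb q 1%g 0.
Proof. by rewrite /symb gel1 subrr subr0; split; apply: aug_power0. Qed.

Lemma symbX q x a i : (0 < q)%N -> symb q x a -> symb q (x ^+ i)%g (a *+ i).
Proof.
move=> q0 xa; elim: i => [|i IH]; first by rewrite mulr0n; apply: symb1.
by rewrite expgS mulrS; apply: symbM.
Qed.

Lemma symb_exp_p x j : symb (p ^ j) (x ^+ (p ^ j))%g ((gel x - 1) ^+ (p ^ j)).
Proof.
rewrite /symb gel_exp_p subrr; split; last exact: aug_power0.
by rewrite -[X in aug_power X _]mul1n; apply: aug_powerX; apply: aug_power1_dl.
Qed.

Definition lev_y1 : A := gel g.1.1 - 1.
Definition lev_y2 : A := gel g.1.2 - 1.
Definition lev_y3 : A := gel g.2 - 1.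

Lemma pj_gt0 j : (0 < p ^ j)%N.
Proof. by rewrite expn_gt0 prime_gt0. Qed.

Lemma symb_word j a b c : symb (p ^ j) (word g (p ^ j) a b c)
  (lev_y1 ^+ (p ^ j) *+ a + lev_y2 ^+ (p ^ j) *+ b + lev_y3 ^+ (p ^ j) *+ c).
Proof.
have gi x i : symb (p ^ j) (x ^+ (p ^ j * i))%g ((gel x - 1) ^+ (p ^ j) *+ i).
  by rewrite expgnA; apply: symbX (pj_gt0 j) _; apply: symb_exp_p.
by apply: symbM (pj_gt0 j) _ (gi _ _); apply: symbM (pj_gt0 j) (gi _ _) (gi _ _).
Qed.

(** In characteristic p, g^(p^j) - 1 = (g - 1)^(p^j), which settles the words of level j; the
    remaining factor lies one layer deeper. The induction descends from level n, where elements
    become trivial. *)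
Lemma aug_power_chain j x : N j x -> aug_power (p ^ j) (gel x - 1).
Proof.
have [k] : exists k, (n <= j + k)%N by exists n; lia.
elim: k j x => [|k IH] j x jn xj.
  rewrite gel_N ?subrr; [exact: aug_power0|apply: chain_le xj; lia].
have [a [b [c x']]] := chain_dec uc xj.
have [wq _] := symb_word j a b c.
rewrite -(mulVKg (word g (p ^ j) a b c) x) gelM mulr_sub1.
have xq : aug_power (p ^ j) (gel ((word g (p ^ j) a b c)^-1 * x)%g - 1).
  by apply: aug_power_le (IH _ _ _ x'); [apply: leq_pexp2l; rewrite ?prime_gt0|lia].
by apply: aug_powerD; [apply: aug_powerMl|apply: aug_powerD].
Qed.

Lemma symb_chain j x a b c : N j.+1 ((word g (p ^ j) a b c)^-1 * x)%g ->
  symb (p ^ j) x (lev_y1 ^+ (p ^ j) *+ a + lev_y2 ^+ (p ^ j) *+ b + lev_y3 ^+ (p ^ j) *+ c).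
Proof.
move=> /aug_power_chain xj; rewrite -(mulVKg (word g (p ^ j) a b c) x) -[X in symb _ _ X]addr0.
have jS : (p ^ j < p ^ j.+1)%N by rewrite ltn_exp2l// prime_gt1.
apply: symbM (pj_gt0 j) (symb_word j a b c) _; split; last rewrite subr0.
  by apply: aug_power_le xj; lia.
exact: aug_power_le xj.
Qed.

Lemma commutator_gel x y :
  commutator (gel x) (gel y) = (gel (x * y * x^-1 * y^-1)%g - 1) * (gel y * gel x).
Proof.
rewrite mulrBl mul1r /commutator -!gelM; congr (gel _ - _).
by rewrite !mulgA mulgVK mulgVK.
Qed.

Lemma aug_power_commutator_gel i j x y : N i x -> N j y ->
  aug_power (p ^ (i + j + l)) (commutator (gel x) (gel y)).
Proof.
by move=> xi yj; rewrite commutator_gel; apply: aug_powerMr; apply: aug_power_chain; apply: (chain_comm uc).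
Qed.

Lemma gr_comm_gel m q (u v : A) : aug_power m u -> aug_power q v ->
  aug_power (m + q).+1 (commutator u v).
Proof.
apply: aug_power_gr_comm => c d; have [x <-] := coset_surj c; have [y <-] := coset_surj d.
have := aug_power_commutator_gel (chain0 uc x) (chain0 uc y).
(* Group commutators lie in N_l, hence in J^(p^l), and p^l >= p >= 3. *)
apply: aug_power_le; rewrite (leq_trans p_ge3)// -[X in (X <= _)%N]expn1.
by apply: leq_pexp2l; [exact: prime_gt0|lia].
Qed.

End Level.

Lemma central_dl (K : fieldType) (H : groupType) (u : gralg K H) :
  (forall y, u * dl K y = dl K y * u) -> forall f, u * f = f * u.
Proof.
move=> uy f; elim/gralg_ind: f => [|f f' IH IH'|c y]; first by rewrite mulr0 mul0r.
  by rewrite mulrDr mulrDl IH IH'.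
by rewrite mulrA -sc_comm -!mulrA uy.
Qed.

(** * Nilpotence of the augmentation ideal at finite level *)

Section Nilpotency.
Variables (p : nat) (p_prime : prime p) (p_ge3 : (3 <= p)%N).
Variables (K : fieldType) (charK : p \in [pchar K]).
Variables (l : nat) (l_ge1 : (1 <= l)%N) (G : groupType).
Variables (N : nat -> nsubgroup G) (g : G * G * G).
Hypothesis uc : uniform_chain p l N g.

Definition additive_pred (A : zmodType) (P : A -> Prop) :=
  P 0 /\ forall a b, P a -> P b -> P (a + b).

Variable n : nat.
Local Notation A := (gralg K (quotg (N n.+1))).
Local Notation gel := (gel K N n.+1).
Local Notation red := (@quotg_map G (N n.+1) (N n)).

Let Nn : nsg (N n.+1) `<=` nsg (N n) := @chainS _ _ _ _ _ uc n.

Lemma redM : {morph red : x y / (x * y)%g}.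
Proof. exact: quotg_mapM. Qed.

Lemma red_coset x : red (coset (N n.+1) x) = coset (N n) x.
Proof. exact: quotg_map_coset. Qed.

Lemma ker_red_ind (P : A -> Prop) : additive_pred P ->
  (forall u k, N n k -> P (u * (gel k - 1))) -> forall f : A, gmap red f = 0 -> P f.
Proof.
move=> [P0 PD] Pk f f0; have [s us fs] := gsuppP f.
pose r (c : quotg (N n)) := coset (N n.+1) (repr c).
(* Replacing each coset by a representative of its image modulo N_n factors through the reduction of
   f, which vanishes; subtracting it leaves differences with a factor k - 1, k in N_n. *)
have fr0 : \sum_(x <- s) sc _ (f x) * dl K (r (red x)) = 0.
  transitivity (gmap (r \o red) f); last by rewrite -gmap_comp f0 gmap0.
  rewrite [in RHS](gralg_sum us fs).
  apply: (big_ind2 (fun a b => a = gmap (r \o red) b)) => [|a b c d -> ->|x _].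
  - by rewrite gmap0.
  - by rewrite gmapD.
  - by rewrite -!gdeltaE gmap_delta.
have -> : f = \sum_(x <- s) sc _ (f x) * (dl K x - dl K (r (red x))).
  under eq_bigr do rewrite mulrBr.
  by rewrite sumrB fr0 subr0; apply: gralg_sum.
elim/big_ind: _ => // x _.
have [y <-] := coset_surj x; rewrite red_coset /r.
set y' := repr _; have /cosetP yy : coset (N n) y' = coset (N n) y by exact: coset_repr.
have -> : dl K (coset (N n.+1) y) = gel y' * gel (y'^-1 * y)%g by rewrite -gelM mulVKg.
rewrite -[dl K (coset _ y')]mulr1 -mulrBr mulrA.
exact: Pk.
Qed.

Definition zpow (x : G) : A := gel (x ^+ (p ^ n))%g - 1.

Lemma zpow_central x (f : A) : zpow x * f = f * zpow x.
Proof.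
apply: central_dl => y; have [z <-] := coset_surj y; rewrite -/(gel z).
apply/eqP; rewrite -subr_eq0 -[_ - _]/(commutator (zpow x) (gel z)) commutatorB1l commutator_gel.
(* Commutators of N_n with G lie in N_(n+l), which is trivial at level n + 1 as l >= 1. *)
rewrite gel_N ?subrr ?mul0r//; have := chain_comm uc (chain_exp_p uc n (chain0 uc x)) (chain0 uc z).
by apply: (chain_le uc); lia.
Qed.

Lemma zpow_exp_p x : zpow x ^+ p = 0.
Proof.
have := gel_exp_p charK N n.+1 (x ^+ (p ^ n))%g 1; rewrite expn1 => <-.
by rewrite -expgnA -expnSr gel_N ?subrr//; apply: (chain_exp_p uc); apply: (chain0 uc).
Qed.

Lemma ker_red_zpow (P : A -> Prop) : additive_pred P ->
  (forall u, [/\ P (u * zpow g.1.1), P (u * zpow g.1.2) & P (u * zpow g.2)]) ->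
  forall f : A, gmap red f = 0 -> P f.
Proof.
move=> [P0 PD] PZ; apply: ker_red_ind => // u k kn.
pose Q x := forall u, P (u * (gel x - 1)).
have QM x y : Q x -> Q y -> Q (x * y)%g.
  move=> Qx Qy v; rewrite gelM mulr_sub1 mulrDr (mulrDr v (gel x - 1)) mulrA.
  by apply: (PD); [exact: Qy|apply: PD].
have QX x i : (forall u, P (u * zpow x)) -> Q (x ^+ (p ^ n * i))%g.
  move=> Px; rewrite expgnA; elim: i => [|i IH]; last by rewrite expgS; apply: QM.
  by move=> v; rewrite expg0 gel1 subrr mulr0.
have [a [b [c k']]] := chain_dec uc kn; have -> : gel k = gel (word g (p ^ n) a b c).
  by apply/esym/gel_eq.
suff : Q (word g (p ^ n) a b c) by apply.
by apply: (QM); [apply: (QM)|]; apply: (QX) => v; case: (PZ v).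
Qed.

Definition zmono (a b c : nat) : A := zpow g.1.1 ^+ a * zpow g.1.2 ^+ b * zpow g.2 ^+ c.

Lemma zmono_mul a b c u : [/\ zmono a b c * u * zpow g.1.1 = u * zmono a.+1 b c,
  zmono a b c * u * zpow g.1.2 = u * zmono a b.+1 c & zmono a b c * u * zpow g.2 = u * zmono a b c.+1].
Proof.
have cM (a' b' : A) : (forall f, a' * f = f * a') -> (forall f, b' * f = f * b') ->
    forall f, a' * b' * f = f * (a' * b').
  by move=> ca cb f; rewrite -mulrA cb mulrA ca mulrA.
have cX x i : forall f, zpow x ^+ i * f = f * zpow x ^+ i.
  elim: i => [|i IH] f; first by rewrite expr0 mul1r mulr1.
  by rewrite exprS; apply: cM => // f'; apply: zpow_central.
have -> : zmono a b c * u = u * zmono a b c by apply: (cM) => //; apply: (cM).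
rewrite -!(mulrA u); split; congr (_ * _); rewrite /zmono.
- by rewrite -[LHS]zpow_central exprS !mulrA.
- by rewrite -[LHS]mulrA -[X in _ * X = _]zpow_central mulrA exprSr !mulrA.
- by rewrite exprSr !mulrA.
Qed.

(** The kernel of K[G/N_(n+1)] -> K[G/N_n] is generated by three central elements
    of p-th power zero, so a large power of it vanishes. *)
Lemma nilpotent_step M : (forall f : gralg K (quotg (N n)), aug_power M f -> f = 0) ->
  exists M', forall f : A, aug_power M' f -> f = 0.
Proof.
(* Each block of M factors lands in the kernel and yields one [zpow]; among 3(p - 1) + 1 of them
   some generator occurs at least p times. *)
move=> M0; exists (M * (p.-1 + p.-1 + p.-1).+1)%N.
suff H k (P : A -> Prop) : additive_pred P ->
    (forall u a b c, (a + b + c = k)%N -> P (u * zmono a b c)) ->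
    forall f : A, aug_power (M * k) f -> P f.
  apply: (H (p.-1 + p.-1 + p.-1).+1) => [|u a b c abc].
    by split=> // a b -> ->; rewrite addr0.
  have Z0 x i : (p <= i)%N -> zpow x ^+ i = 0.
    by move=> /subnKC <-; rewrite exprD zpow_exp_p mul0r.
  have [pa|pa] := leqP p a; first by rewrite /zmono Z0// !mul0r mulr0.
  have [pb|pb] := leqP p b; first by rewrite /zmono (Z0 _ b)// mulr0 mul0r mulr0.
  have [pc|pc] := leqP p c; first by rewrite /zmono (Z0 _ c)// !mulr0.
  lia.
elim: k P => [|k IH] P [P0 PD] PZ f.
  have e : zmono 0 0 0 = 1 by rewrite /zmono !expr0 !mulr1.
  by move=> _; rewrite -[f]mulr1 -e; apply: PZ.
rewrite mulnS addnC; apply: aug_power_add_ind => // u v uk vM.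
have v0 : gmap red v = 0 by apply: M0; apply: gmap_aug_power vM; apply: redM.
move: u uk; apply: IH => [|u a b c abc].
  by split=> [|u u' Pu Pu']; rewrite ?mul0r// mulrDl; apply: PD.
rewrite -mulrA; move: v v0 {vM}; apply: ker_red_zpow => [|v].
  by split=> [|v v' Pv Pv']; rewrite ?mulr0// !mulrDr; apply: PD.
have [z1 z2 z3] := zmono_mul a b c v.
rewrite !(mulrA (zmono a b c) v) z1 z2 z3 !(mulrA u); split; apply: PZ; lia.
Qed.

End Nilpotency.

Lemma mulr_sub_chain (R : pzRingType) (u h t v k : R) :
  u * t - k = (u - h) * t + h * (t - v) + (h * v - k).
Proof. by rewrite mulrBl mulrBr !addrA !subrK. Qed.

(** * Spanning by ordered monomials *)

Section Spanning.
Variables (p : nat) (p_prime : prime p) (p_ge3 : (3 <= p)%N).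
Variables (K : fieldType) (charK : p \in [pchar K]).
Variables (l : nat) (l_ge1 : (1 <= l)%N) (G : groupType).
Variables (N : nat -> nsubgroup G) (g : G * G * G).
Hypothesis uc : uniform_chain p l N g.

Lemma nilpotent n : exists M, forall f : gralg K (quotg (N n)), aug_power M f -> f = 0.
Proof.
elim: n => [|n [M]]; last exact: (nilpotent_step p_prime p_ge3 charK l_ge1 uc).
exists 1%N; apply: aug_powerS_ind => [//|f f' -> ->|u c _]; first by rewrite addr0.
by have [x <-] := coset_surj c; rewrite -/(gel K N 0 x) gel_N ?subrr ?mulr0//; apply: (chain0 uc).
Qed.

Definition expo := (nat * nat * nat)%type.
Definition ewt (e : expo) : nat := (e.1.1 + e.1.2 + e.2)%N.

Section Monomials.
Variables (R : pzRingType) (y1 y2 y3 : R).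
Definition mono (e : expo) : R := y1 ^+ e.1.1 * y2 ^+ e.1.2 * y3 ^+ e.2.

Lemma mono_mul1 a b c : mono (a, b, c) * y1 - mono (a.+1, b, c) =
  y1 ^+ a * commutator (y2 ^+ b * y3 ^+ c) y1.
Proof. by rewrite /mono /commutator /= mulrBr !mulrA -exprSr. Qed.
Lemma mono_mul2 a b c : mono (a, b, c) * y2 - mono (a, b.+1, c) =
  y1 ^+ a * y2 ^+ b * commutator (y3 ^+ c) y2.
Proof. by rewrite /mono /commutator /= mulrBr exprSr !mulrA. Qed.
Lemma mono_mul3 a b c : mono (a, b, c) * y3 = mono (a, b, c.+1).
Proof. by rewrite /mono /= exprSr mulrA. Qed.
End Monomials.

Variable n : nat.
Local Notation A := (gralg K (quotg (N n))).
Local Notation gel := (gel K N n).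
Local Notation lev_y1 := (lev_y1 K N g n).
Local Notation lev_y2 := (lev_y2 K N g n).
Local Notation lev_y3 := (lev_y3 K N g n).
Local Notation mon := (mono lev_y1 lev_y2 lev_y3).
Local Notation sc := (@sc K (quotg (N n))).

Lemma aug_power_mon e : aug_power (ewt e) (mon e).
Proof.
have Y i x : aug_power i ((gel x - 1) ^+ i).
  by rewrite -[X in aug_power X]mul1n; apply: aug_powerX; apply: aug_power1_dl.
by apply: aug_powerM; [apply: aug_powerM|]; apply: Y.
Qed.

(** Moving the new factor to its place costs commutators, one degree higher than expected; y3 is
    already in place. *)
Lemma mon_mulY e : [/\ aug_power (ewt e).+2 (mon e * lev_y1 - mon (e.1.1.+1, e.1.2, e.2)),
  aug_power (ewt e).+2 (mon e * lev_y2 - mon (e.1.1, e.1.2.+1, e.2)) &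
  mon e * lev_y3 = mon (e.1.1, e.1.2, e.2.+1)].
Proof.
have Yx i x : aug_power i ((gel x - 1) ^+ i).
  by rewrite -[X in aug_power X]mul1n; apply: aug_powerX; apply: aug_power1_dl.
have Y x : aug_power 1 (gel x - 1) by apply: aug_power1_dl.
case: e => [[a b] c]; rewrite mono_mul1 mono_mul2 mono_mul3.
have -> : ewt (a, b, c) = (a + b + c)%N by [].
split=> //.
- have C := gr_comm_gel p_prime p_ge3 charK l_ge1 uc (aug_powerM (Yx b g.1.2) (Yx c g.2)) (Y g.1.1).
  by apply: aug_power_le (aug_powerM (Yx a g.1.1) C); lia.
- have C := gr_comm_gel p_prime p_ge3 charK l_ge1 uc (Yx c g.2) (Y g.1.2).
  by apply: aug_power_le (aug_powerM (aug_powerM (Yx a g.1.1) (Yx b g.1.2)) C); lia.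
Qed.

Definition inspan (P : expo -> Prop) (f : A) : Prop :=
  exists s : seq (K * expo), (forall u, u \in s -> P u.2) /\
    f = \sum_(u <- s) sc u.1 * mon u.2.

Lemma inspan0 P : inspan P 0.
Proof. by exists [::]; rewrite big_nil. Qed.

Lemma inspanD P f f' : inspan P f -> inspan P f' -> inspan P (f + f').
Proof.
move=> [s [sP ->]] [t [tP ->]]; exists (s ++ t); split; last by rewrite big_cat.
by move=> u; rewrite mem_cat => /orP[/sP|/tP].
Qed.

Lemma inspan1 (P : expo -> Prop) c e : P e -> inspan P (sc c * mon e).
Proof.
by move=> Pe; exists [:: (c, e)]; rewrite big_seq1; split=> // u; rewrite mem_seq1 => /eqP ->.
Qed.

Lemma inspanZ P c f : inspan P f -> inspan P (sc c * f).
Proof.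
move=> [s [sP ->]]; exists [seq (c * u.1, u.2) | u <- s]; split.
  by move=> _ /mapP[u /sP ? ->].
by rewrite big_map mulr_sumr; apply: eq_bigr => u _; rewrite scM mulrA.
Qed.

Lemma inspanW (P Q : expo -> Prop) f : (forall e, P e -> Q e) -> inspan P f -> inspan Q f.
Proof. by move=> PQ [s [sP ->]]; exists s; split=> // u /sP/PQ. Qed.

Lemma inspan_ind (P : expo -> Prop) (Q : A -> Prop) : additive_pred Q ->
  (forall c e, P e -> Q (sc c * mon e)) -> forall f, inspan P f -> Q f.
Proof.
move=> [Q0 QD] Qm f [s [sP ->]]; rewrite big_seq; elim/big_ind: _ => // u /sP; exact: Qm.
Qed.

Lemma symb_gel x : exists a b c, aug_power 2 (gel x - 1 - (lev_y1 *+ a + lev_y2 *+ b + lev_y3 *+ c)).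
Proof.
have [a [b [c xE]]] := chain_dec uc (chain0 uc x); exists a, b, c.
by have [_] := symb_chain p_prime p_ge3 charK l_ge1 uc n xE; rewrite expn0 !expr1.
Qed.

(** Modulo J^2 a factor x - 1 is a combination of y1, y2, y3 by [chain_dec] at level 0, and
    [mon_mulY] rewrites the product as monomials of weight m + 1. *)
Lemma aug_power_leading m f : aug_power m f ->
  exists2 h, inspan (fun e => ewt e = m) h & aug_power m.+1 (f - h).
Proof.
elim: m f => [|m IH] f.
  have [c fc _] := aug_ideal_sc f; exists (sc c); last exact: aug_power1.
  have e0 : mon (0, 0, 0)%N = 1 by rewrite /mono !expr0 !mulr1.
  by rewrite -[sc c]mulr1 -e0; apply: inspan1.
move: f; apply: aug_powerS_ind => [|f f' [h hs fh] [h' hs' fh']|u y um].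
- by exists 0; [apply: inspan0|rewrite subr0; apply: aug_power0].
- exists (h + h'); first exact: inspanD.
  by rewrite opprD addrACA; apply: aug_powerD.
have [x <-] := coset_surj y; have [a [b [c xE]]] := symb_gel x.
have [h hs uh] := IH _ um.
set v := lev_y1 *+ a + _ + _ in xE.
have hv : exists2 h', inspan (fun e => ewt e = m.+1) h' & aug_power m.+2 (h * v - h').
  move: h hs {uh}; apply: inspan_ind => [|d e em].
    split; first by exists 0; [apply: inspan0|rewrite mul0r subr0; apply: aug_power0].
    move=> h h' [k ks hk] [k' ks' hk']; exists (k + k'); first exact: inspanD.
    by rewrite mulrDl opprD addrACA; apply: aug_powerD.
  have [e1 e2 e3] := mon_mulY e; rewrite em in e1 e2.
  pose k := mon (e.1.1.+1, e.1.2, e.2) *+ a + mon (e.1.1, e.1.2.+1, e.2) *+ b +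
    mon (e.1.1, e.1.2, e.2.+1) *+ c.
  exists (sc d * k).
    apply: inspanZ; have inn i e' : ewt e' = m.+1 -> inspan (fun e => ewt e = m.+1) (mon e' *+ i).
      by move=> e'm; rewrite -mulr_natl -sc_nat; apply: inspan1.
    by move: em; rewrite /ewt => em; apply: inspanD; [apply: inspanD|]; apply: inn; rewrite /ewt /=; lia.
  rewrite -mulrA -mulrBr; apply: aug_powerZ.
  rewrite /v /k !(mulrDr (mon e)) !(mulrnAr (mon e)) e3.
  rewrite opprD addrACA subrr addr0 opprD addrACA -!mulrnBl.
  by apply: aug_powerD; apply: aug_powerMn.
have [h' h's hv'] := hv; exists h' => //; rewrite -/(gel x).
have -> : u * (gel x - 1) - h' = (u - h) * (gel x - 1) + h * (gel x - 1 - v) + (h * v - h').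
  exact: mulr_sub_chain.
have hm : aug_power m h.
  move: h hs {uh hv h' h's hv'}; apply: inspan_ind => [|d e <-].
    by split; [apply: aug_power0|move=> ? ?; apply: aug_powerD].
  by apply: aug_powerZ; apply: aug_power_mon.
apply: aug_powerD => //; apply: aug_powerD.
  by rewrite -addn1; apply: aug_powerM uh (aug_power1_dl _ _).
by rewrite -addn2; apply: aug_powerM.
Qed.

(** Leading forms are stripped repeatedly; nilpotence makes the process stop. *)
Lemma aug_power_inspan m f : aug_power m f -> inspan (fun e => (m <= ewt e)%N) f.
Proof.
have [M M0] := nilpotent n.
have [k] : exists k, (M <= m + k)%N by exists M; lia.
elim: k m f => [|k IH] m f mk fm.
  have -> : f = 0 by apply: M0; apply: aug_power_le fm; lia.
  exact: inspan0.
have [h hs fh] := aug_power_leading fm; rewrite -(subrK h f); apply: inspanD.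
  have mk' : (M <= m.+1 + k)%N by lia.
  by apply: inspanW (IH _ _ mk' fh) => e /ltnW.
by apply: inspanW hs => e ->.
Qed.

Local Notation q := (p ^ n)%N.
(** At level n the p^n-th powers of the y_i vanish, so only these exponents survive ([mon_out]). *)
Definition box : Type := ('I_q * 'I_q * 'I_q)%type.
HB.instance Definition _ := Finite.on box.
Definition bexp (b : box) : expo := (b.1.1 : nat, b.1.2 : nat, b.2 : nat).

Lemma mon_out e : ~~ [&& (e.1.1 < q)%N, (e.1.2 < q)%N & (e.2 < q)%N] -> mon e = 0.
Proof.
have Y0 x i : (q <= i)%N -> (gel x - 1) ^+ i = 0.
  move=> /subnKC <-; rewrite exprD -(gel_exp_p charK) gel_N ?subrr ?mul0r//.
  exact: (chain_exp_p uc n (chain0 uc x)).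
rewrite !negb_and -!leqNgt => /or3P[]; rewrite /mono => /Y0 ->; by rewrite ?mul0r ?mulr0 ?mul0r.
Qed.

Lemma inspan_box P f : inspan P f -> exists2 d : box -> K,
  (forall b, d b != 0 -> P (bexp b)) & f = \sum_b sc (d b) * mon (bexp b).
Proof.
move: f; apply: inspan_ind => [|c e Pe].
  split=> [|f f' [d dP ->] [d' dP' ->]].
    by exists (fun=> 0) => [b|]; rewrite ?eqxx// big1// => b _; rewrite sc0 mul0r.
  exists (fun b => d b + d' b) => [b|].
    by have [->|/dP//] := eqVneq (d b) 0; rewrite add0r => /dP'.
  by rewrite -big_split; apply: eq_bigr => b _; rewrite scD mulrDl.
have [/and3P[e1 e2 e3]|/mon_out ->] := boolP [&& (e.1.1 < q)%N, (e.1.2 < q)%N & (e.2 < q)%N].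
  pose b0 : box := (Ordinal e1, Ordinal e2, Ordinal e3).
  have b0E : bexp b0 = e by rewrite /bexp /= -!surjective_pairing.
  exists (fun b => if b == b0 then c else 0) => [b|].
    by case: (eqVneq b b0) => [->|_]; rewrite ?b0E// eqxx.
  rewrite (bigD1 b0)//= eqxx b0E big1 ?addr0// => b /negPf ->.
  by rewrite sc0 mul0r.
by exists (fun=> 0) => [b|]; rewrite ?eqxx// mulr0 big1// => b _; rewrite sc0 mul0r.
Qed.

End Spanning.

(** * Ordered words in the generators *)

Lemma dvdn_add_sub_small d a b : (a < d)%N -> (b < d)%N -> (d %| a + (d - b))%N -> a = b.
Proof.
by move=> ad bd /dvdnP[[|[|k]]]; rewrite ?mul0n ?mulSn; lia.
Qed.

Section CentralGroup.
Variable H : groupType.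
Definition centralg (z : H) : Prop := forall h : H, (z * h = h * z)%g.

Lemma centralg_word (u v w x y z : H) : centralg x -> centralg y ->
  ((u * x) * (v * y) * (w * z) = (u * v * w) * (x * y * z))%g.
Proof.
move=> xc yc; have e1 : (y * (w * z) = w * (y * z))%g by rewrite !mulgA (yc w).
have e2 : (x * (v * (w * (y * z))) = v * (w * (x * (y * z))))%g.
  by rewrite !mulgA (xc v) -(mulgA v x w) (xc w) !mulgA.
by rewrite -!mulgA e1 e2.
Qed.
End CentralGroup.

Section Words.
Variables (p : nat) (p_prime : prime p).
Variables (l : nat) (l_ge1 : (1 <= l)%N) (G : groupType).
Variables (N : nat -> nsubgroup G) (g : G * G * G).
Hypothesis uc : uniform_chain p l N g.

Lemma coset_N n x : N n x -> coset (N n) x = 1%g.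
Proof.
move=> xn; rewrite -(morph_g1 (@cosetM _ (N n))).
by apply/esym/cosetP; rewrite invg1 mul1g.
Qed.

Lemma coset_central j x : N j x -> centralg (coset (N j.+1) x).
Proof.
move=> xj h; rewrite -(coset_repr h); set y := repr h; rewrite -!cosetM.
rewrite -[(x * y)%g](_ : ((x * y * x^-1 * y^-1) * (y * x))%g = _).
  rewrite cosetM coset_N ?mul1g//; have := chain_comm uc xj (chain0 uc y).
  by apply: (chain_le uc); lia.
by rewrite !mulgA mulgVK mulgVK.
Qed.

(** Modulo N_(j+1) the p^j-th powers are central, so the top base-p digits separate from the lower
    ones. *)
Lemma word_split j i1 i2 i3 a b c :
  coset (N j.+1) (word g 1 (i1 + p ^ j * a) (i2 + p ^ j * b) (i3 + p ^ j * c)) =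
  (coset (N j.+1) (word g 1 i1 i2 i3) * coset (N j.+1) (word g (p ^ j) a b c))%g.
Proof.
rewrite /word !mul1n !expgnDr !cosetM; apply: centralg_word; apply: coset_central;
  rewrite expgnA; elim: (X in (_ ^+ X)%g) => [|k IH]; rewrite ?expg0; try exact: nsg1.
all: rewrite expgS; apply: nsgM => //; apply: (chain_exp_p uc); exact: (chain0 uc).
Qed.

Lemma wordZ n a b c : word g 1 (n * a) (n * b) (n * c) = word g n a b c.
Proof. by rewrite /word !mul1n. Qed.

Lemma word_chain j a b c : N j (word g (p ^ j) a b c).
Proof.
have H x i : N j (x ^+ (p ^ j * i))%g.
  rewrite expgnA; elim: i => [|i IH]; first by rewrite expg0; apply: nsg1.
  by rewrite expgS; apply: nsgM => //; apply: (chain_exp_p uc); apply: (chain0 uc).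
by apply: nsgM; [apply: nsgM|].
Qed.

(** Digit by digit: reduction modulo N_n determines the exponents modulo p^n, and the last digit is
    a coordinate in the layer N_n / N_(n+1). *)
Lemma word_inj n i1 i2 i3 j1 j2 j3 :
  (i1 < p ^ n)%N -> (i2 < p ^ n)%N -> (i3 < p ^ n)%N ->
  (j1 < p ^ n)%N -> (j2 < p ^ n)%N -> (j3 < p ^ n)%N ->
  coset (N n) (word g 1 i1 i2 i3) = coset (N n) (word g 1 j1 j2 j3) ->
  [/\ i1 = j1, i2 = j2 & i3 = j3].
Proof.
elim: n i1 i2 i3 j1 j2 j3 => [|n IH] i1 i2 i3 j1 j2 j3.
  by rewrite expn0 !ltnS !leqn0 => /eqP -> /eqP -> /eqP -> /eqP -> /eqP -> /eqP ->.
set q := (p ^ n)%N => Hi1 Hi2 Hi3 Hj1 Hj2 Hj3; have q0 : (0 < q)%N by apply: pj_gt0.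
have dE i : i = (i %% q + q * (i %/ q))%N by rewrite addnC mulnC -divn_eq.
pose C := coset (N n.+1).
have split_ i j k : C (word g 1 i j k) =
   (C (word g 1 (i %% q) (j %% q) (k %% q)) * C (word g q (i %/ q) (j %/ q) (k %/ q)))%g.
  by rewrite {1}(dE i) {1}(dE j) {1}(dE k); apply: word_split.
have red_ i j k : coset (N n) (word g 1 i j k) = coset (N n) (word g 1 (i %% q) (j %% q) (k %% q)).
  have NS : nsg (N n.+1) `<=` nsg (N n) := @chainS _ _ _ _ _ uc n.
  rewrite -!(quotg_map_coset _ NS) -/(C _) split_ quotg_mapM// [X in (_ * X)%g]quotg_map_coset//.
  by rewrite coset_N ?mulg1//; apply: word_chain.
move=> e; have : coset (N n) (word g 1 i1 i2 i3) = coset (N n) (word g 1 j1 j2 j3).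
  by apply/cosetP/(chainS uc)/cosetP.
rewrite red_ (red_ j1) => /IH[]; rewrite ?ltn_mod// => e1 e2 e3.
move: e; rewrite -/(C _) -/(C (word g 1 j1 _ _)) split_ (split_ j1) e1 e2 e3 => /mulgI e.
have dp i : (i < p ^ n.+1)%N -> (i %/ q < p)%N by move=> ip; rewrite ltn_divLR// -expnS.
have A1 := dp _ Hi1; have A2 := dp _ Hi2; have A3 := dp _ Hi3.
have B1 := dp _ Hj1; have B2 := dp _ Hj2; have B3 := dp _ Hj3.
suff [d1 d2 d3] : [/\ i1 %/ q = j1 %/ q, i2 %/ q = j2 %/ q & i3 %/ q = j3 %/ q]%N.
  by rewrite (dE i1) (dE i2) (dE i3) e1 e2 e3 d1 d2 d3 -!dE.
move: A1 A2 A3 B1 B2 B3 e.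
move: (i1 %/ q)%N (i2 %/ q)%N (i3 %/ q)%N (j1 %/ q)%N (j2 %/ q)%N (j3 %/ q)%N.
move=> a1 a2 a3 b1 b2 b3 A1 A2 A3 B1 B2 B3 e.
have add_ x1 x2 x3 y1 y2 y3 : C (word g q (x1 + y1) (x2 + y2) (x3 + y3)) =
    (C (word g q x1 x2 x3) * C (word g q y1 y2 y3))%g.
  by rewrite /C -(wordZ q (x1 + y1)) !mulnDr /q word_split wordZ.
(* p - b stands in for -b among natural exponents: the word with all three exponents qp is trivial
   modulo N_(n+1). *)
have /(chain_uniq uc)[] : N n.+1 (word g q (a1 + (p - b1)) (a2 + (p - b2)) (a3 + (p - b3))).
  rewrite -[word _ _ _ _ _]mul1g -invg1; apply/cosetP; rewrite -/(C _) -/(C (word _ _ _ _ _)).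
  rewrite add_ e -add_ !subnKC ?(ltnW B1) ?(ltnW B2) ?(ltnW B3)//.
  have -> : word g q p p p = word g (p ^ n.+1) 1 1 1 by rewrite /word expnSr !muln1.
  by rewrite /C (coset_N (word_chain n.+1 1 1 1)) (coset_N (nsg1 _)).
by move=> /(dvdn_add_sub_small A1 B1) -> /(dvdn_add_sub_small A2 B2) -> /(dvdn_add_sub_small A3 B3) ->.
Qed.

(** Puts N_1, which contains G^p, in a normal form whose exponents are all divisible by p;
    successive layers correct the error. *)
Lemma chain1_word n x : N 1%N x ->
  exists a b c, coset (N n.+1) x = coset (N n.+1) (word g p a b c).
Proof.
move=> x1; elim: n => [|n [a [b [c e]]]].
  exists 0%N, 0%N, 0%N; rewrite !coset_N//.
  by have := word_chain 1 0 0 0; rewrite expn1.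
set w := word g p a b c in e; have /cosetP wx := esym e.
have [a' [b' [c' x']]] := chain_dec uc wx.
exists (a + p ^ n * a')%N, (b + p ^ n * b')%N, (c + p ^ n * c')%N.
rewrite -(wordZ p) !mulnDr !mulnA -expnS word_split wordZ -/w -cosetM; apply/esym/cosetP.
by rewrite invgM -mulgA.
Qed.

End Words.

(** * Linear independence of the box monomials *)

Lemma mulr_sum3 (R : pzRingType) (m n k : nat) (F1 F2 F3 : nat -> R) :
  (\sum_(i < m) F1 i) * (\sum_(i < n) F2 i) * (\sum_(i < k) F3 i) =
  \sum_(i < m) \sum_(j < n) \sum_(t < k) F1 i * F2 j * F3 t.
Proof.
rewrite mulr_suml mulr_suml; apply: eq_bigr => i _.
rewrite -mulrA mulr_suml mulr_sumr; apply: eq_bigr => j _.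
by rewrite !mulr_sumr; apply: eq_bigr => t _; rewrite mulrA.
Qed.

Lemma big_ord_last (M : nmodType) (F : nat -> M) m :
  (forall i, (i < m)%N -> F i = 0) -> \sum_(i < m.+1) F i = F m.
Proof. by move=> F0; rewrite big_ord_recr /= big1 ?add0r// => i _; apply: F0. Qed.

Section Independence.
Variables (p : nat) (p_prime : prime p) (p_ge3 : (3 <= p)%N).
Variables (K : fieldType) (charK : p \in [pchar K]).
Variables (l : nat) (l_ge1 : (1 <= l)%N) (G : groupType).
Variables (N : nat -> nsubgroup G) (g : G * G * G).
Hypothesis uc : uniform_chain p l N g.
Variable n : nat.
Local Notation A := (gralg K (quotg (N n))).
Local Notation gel := (gel K N n).
Local Notation mon := (mono (lev_y1 K N g n) (lev_y2 K N g n) (lev_y3 K N g n)).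
Local Notation sc := (@sc K (quotg (N n))).
Local Notation q := (p ^ n)%N.
Local Notation box := (box p n).

Lemma sc_mul3 (a b c : K) (x y z : A) :
  sc a * x * (sc b * y) * (sc c * z) = sc (a * b * c) * (x * y * z).
Proof.
have e u v : y * (sc u * v) = sc u * (y * v) by rewrite mulrA -(sc_comm u y) mulrA.
have e' u v : x * (sc u * v) = sc u * (x * v) by rewrite mulrA -(sc_comm u x) mulrA.
by rewrite -!mulrA e !e' !scM -!mulrA.
Qed.

Definition bcoef (m i : nat) : K := ((-1) ^+ (m - i)) *+ 'C(m, i).

Lemma gel_sub1X x m : (gel x - 1) ^+ m = \sum_(i < m.+1) sc (bcoef m i) * gel (x ^+ i)%g.
Proof.
rewrite addrC exprDn_comm; last exact/commr_sym/commrN1.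
apply: eq_bigr => i _; rewrite gelX /bcoef.
have scMn c k : sc (c *+ k) = sc c *+ k by rewrite -mulr_natr scM sc_nat mulr_natr.
have scX c k : sc (c ^+ k) = sc c ^+ k.
  by elim: k => [|k IH]; rewrite ?expr0 ?sc1// !exprS scM IH.
by rewrite scMn scX scN sc1 mulrnAl.
Qed.

Lemma monE e : mon e = \sum_(i < e.1.1.+1) \sum_(j < e.1.2.+1) \sum_(t < e.2.+1)
  sc (bcoef e.1.1 i * bcoef e.1.2 j * bcoef e.2 t) * gel (word g 1 i j t).
Proof.
rewrite /mono !gel_sub1X.
rewrite (mulr_sum3 _ _ _ (fun i => sc (bcoef e.1.1 i) * gel (g.1.1 ^+ i)%g)
  (fun i => sc (bcoef e.1.2 i) * gel (g.1.2 ^+ i)%g) (fun i => sc (bcoef e.2 i) * gel (g.2 ^+ i)%g)).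
apply: eq_bigr => i _; apply: eq_bigr => j _; apply: eq_bigr => t _.
by rewrite sc_mul3 /word !mul1n !gelM.
Qed.

(** Expanding [mon (bexp b)] gives words with exponents bounded by those of b. The word of b0 can
    occur only if b0 <= b coordinatewise, and the weight condition then forces b = b0, where the
    coefficient is 1. *)
Lemma mon_coef (b b0 : box) : (ewt (bexp b) <= ewt (bexp b0))%N ->
  mon (bexp b) (coset (N n) (word g 1 b0.1.1 b0.1.2 b0.2)) = (b == b0)%:R.
Proof.
move=> bb0; set c0 := coset _ _.
have Tc i j t : (i <= b.1.1)%N -> (j <= b.1.2)%N -> (t <= b.2)%N ->
    gel (word g 1 i j t) c0 = [&& i == b0.1.1 :> nat, j == b0.1.2 :> nat & t == b0.2 :> nat]%:R.
  move=> ib jb tb; rewrite /gel /=.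
  have [/and3P[/eqP -> /eqP -> /eqP ->]|ne] := boolP [&& _, _ & _]; first by rewrite eqxx.
  rewrite ifN//; apply: contraNneq ne => e.
  have ib' := leq_ltn_trans ib (ltn_ord _); have jb' := leq_ltn_trans jb (ltn_ord _).
  have tb' := leq_ltn_trans tb (ltn_ord _).
  have [-> -> ->] := word_inj p_prime l_ge1 uc (ltn_ord _) (ltn_ord _) (ltn_ord _) ib' jb' tb' e.
  by rewrite !eqxx.
have F0 i j t : (i <= b.1.1)%N -> (j <= b.1.2)%N -> (t <= b.2)%N ->
    [|| i != b.1.1 :> nat, j != b.1.2 :> nat | t != b.2 :> nat] ->
    gel (word g 1 i j t) c0 = 0.
  move=> ib jb tb ne; rewrite Tc//; case: and3P => // -[/eqP e1 /eqP e2 /eqP e3].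
  by move: bb0 ne; rewrite /ewt /bexp /= -e1 -e2 -e3; lia.
pose c i j t := bcoef b.1.1 i * bcoef b.1.2 j * bcoef b.2 t.
have c0E i j t : (i <= b.1.1)%N -> (j <= b.1.2)%N -> (t <= b.2)%N ->
    [|| i != b.1.1 :> nat, j != b.1.2 :> nat | t != b.2 :> nat] -> c i j t * gel (word g 1 i j t) c0 = 0.
  by move=> ib jb tb ne; rewrite F0 ?mulr0.
have -> : mon (bexp b) c0 = \sum_(i < b.1.1.+1) \sum_(j < b.1.2.+1) \sum_(t < b.2.+1)
    c i j t * gel (word g 1 i j t) c0.
  rewrite monE gsum_coef; apply: eq_bigr => i _; rewrite gsum_coef; apply: eq_bigr => j _.
  by rewrite gsum_coef; apply: eq_bigr => t _; rewrite sc_coef.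
rewrite (@big_ord_last _ (fun i => \sum_(j < b.1.2.+1) \sum_(t < b.2.+1)
    c i j t * gel (word g 1 i j t) c0)); last first.
  move=> i ib; rewrite big1// => j _; rewrite big1// => t _; apply: c0E; [exact: ltnW| | |].
  - by rewrite -ltnS.
  - by rewrite -ltnS.
  - by rewrite neq_ltn ib.
rewrite (@big_ord_last _ (fun j => \sum_(t < b.2.+1) c b.1.1 j t * gel (word g 1 b.1.1 j t) c0)); last first.
  move=> j jb; rewrite big1// => t _; apply: c0E; [by []|exact: ltnW| |].
  - by rewrite -ltnS.
  - by rewrite !neq_ltn jb orbT.
rewrite (@big_ord_last _ (fun t => c b.1.1 b.1.2 t * gel (word g 1 b.1.1 b.1.2 t) c0)); last first.
  by move=> t tb; apply: c0E => //; [exact: ltnW|rewrite !neq_ltn tb !orbT].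
rewrite Tc// /c /bcoef !subnn !expr0 !binn !mulr1n !mul1r.
by congr (_%:R); case: b b0 {bb0 c0 Tc F0 c c0E} => [[b1 b2] b3] [[c1 c2] c3] /=; rewrite !xpair_eqE -andbA.
Qed.

(** The box monomials are unitriangular with respect to the group elements
    [x^i y^j z^k], which are distinct by [word_inj]. *)
Lemma box_independent (d : box -> K) :
  \sum_b sc (d b) * mon (bexp b) = 0 -> forall b, d b = 0.
Proof.
move=> d0 b; apply/eqP; apply: contraT => db.
(* At a support element of maximal weight [mon_coef] isolates the coefficient [d b0]. *)
have [b0 db0 b0max] := @arg_maxnP _ b (fun b => d b != 0) (fun b => ewt (bexp b)) db.
have : (\sum_b sc (d b) * mon (bexp b)) (coset (N n) (word g 1 b0.1.1 b0.1.2 b0.2)) = 0.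
  by rewrite d0.
rewrite gsum_coef (bigD1 b0)// sc_coef mon_coef// eqxx mulr1 big1 => [|b' b'b0].
  by rewrite /= addr0 => /eqP; rewrite (negPf db0).
rewrite sc_coef; have [->|db'] := eqVneq (d b') 0; first by rewrite mul0r.
by rewrite mon_coef ?(negPf b'b0) ?mulr0//; apply: b0max.
Qed.

Lemma box_unique (d d' : box -> K) :
  \sum_b sc (d b) * mon (bexp b) = \sum_b sc (d' b) * mon (bexp b) -> d =1 d'.
Proof.
move=> dd b; apply/eqP; rewrite -subr_eq0; apply/eqP.
apply: (@box_independent (fun b => d b - d' b)); apply/eqP.
under eq_bigr do rewrite scD scN mulrBl.
by rewrite sumrB dd subrr.
Qed.

Local Notation insp := (@inspan K G N g n).

(** Uniqueness of coordinates lets two constraints hold for one expansion: exponents divisible by p,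
    from KG^p, together with weight at least m, from the filtration. *)
Lemma inspanI (P Q : expo -> Prop) f : insp P f -> insp Q f -> insp (fun e => P e /\ Q e) f.
Proof.
move=> /(inspan_box charK uc)[d dP fE] /(inspan_box charK uc)[d' dQ fE'].
have dd : d =1 d' by apply: box_unique; rewrite -fE.
rewrite fE; elim/big_ind: _ => [|f1 f2|b _]; [exact: inspan0|exact: inspanD|].
have [->|db] := eqVneq (d b) 0; first by rewrite sc0 mul0r; apply: inspan0.
by apply: inspan1; split; [apply: dP|apply: dQ; rewrite -dd].
Qed.

(** In characteristic p, y^(pa) = (1 + (y - 1)^p)^a expands in p-th powers of y - 1. *)
Lemma inspan_chain1 x : N 1%N x ->
  insp (fun e => [/\ p %| e.1.1, p %| e.1.2 & p %| e.2]%N) (gel x).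
Proof.
case: (posnP n) => [n0 _|n0].
  rewrite gel_N; last by rewrite n0; apply: (chain0 uc).
  have e0 : mon (0, 0, 0)%N = 1 by rewrite /mono !expr0 !mulr1.
  have -> : 1 = sc 1 * mon (0, 0, 0)%N by rewrite e0 mulr1.
  by apply: inspan1; rewrite !dvdn0.
move=> x1; have [a [b [c]]] := chain1_word p_prime l_ge1 uc n.-1 x1; rewrite prednK// => xE.
rewrite {1}/gel xE -/(gel _) /word !gelM !expgnA !gelX.
have pw y i : (gel y ^+ p) ^+ i = \sum_(j < i.+1) ((gel y - 1) ^+ (p * j) *+ 'C(i, j)).
  have -> : gel y ^+ p = 1 + (gel y - 1) ^+ p.
    by have := frobenius_sub1 charK (gel y) 1; rewrite expn1 => ->; rewrite addrC subrK.
  rewrite exprDn_comm; last exact/commr_sym/commr1.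
  by apply: eq_bigr => j _; rewrite expr1n mul1r exprM.
rewrite !pw (mulr_sum3 _ _ _ (fun j => (gel g.1.1 - 1) ^+ (p * j) *+ 'C(a, j))
  (fun j => (gel g.1.2 - 1) ^+ (p * j) *+ 'C(b, j)) (fun j => (gel g.2 - 1) ^+ (p * j) *+ 'C(c, j))).
elim/big_ind: _ => [|f1 f2|i _]; [exact: inspan0|exact: inspanD|].
elim/big_ind: _ => [|f1 f2|j _]; [exact: inspan0|exact: inspanD|].
elim/big_ind: _ => [|f1 f2|t _]; [exact: inspan0|exact: inspanD|].
rewrite !mulrnAr !mulrnAl -!mulrnA -mulr_natl -sc_nat.
by apply: (@inspan1 _ _ _ _ _ _ _ (p * i, p * j, p * t)%N); rewrite /= !dvdn_mulr.
Qed.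

End Independence.

(** * The completed group algebra *)

Section CompletedLevel.
Variables (p : nat) (p_prime : prime p) (p_ge3 : (3 <= p)%N).
Variables (K : fieldType) (charK : p \in [pchar K]).
Variables (l : nat) (l_ge1 : (1 <= l)%N) (G : groupType).
Variables (N : nat -> nsubgroup G) (g : G * G * G).
Hypothesis uc : uniform_chain p l N g.
Variable tau : set (set G).
Hypothesis tauN : forall j, tau (nsg (N j)).
Hypothesis tau_cofinal : forall U : set G, tau U -> U 1%g -> exists j, forall x, N j x -> U x.
Local Notation KG := (cga K tau).

Definition openN (j : nat) : open_nsubgroup tau := exist _ (N j) (tauN j).
Definition lev (n : nat) (x : KG) : gralg K (quotg (N n)) := cga_proj x (openN n).

Lemma levD n x y : lev n (x + y) = lev n x + lev n y. Proof. by []. Qed.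
Lemma levB n x y : lev n (x - y) = lev n x - lev n y. Proof. by []. Qed.
Lemma levM n x y : lev n (x * y) = lev n x * lev n y. Proof. by []. Qed.
Lemma levX n x i : lev n (x ^+ i) = lev n x ^+ i.
Proof. by elim: i => [|i IH]; rewrite ?expr0// !exprS levM IH. Qed.
Lemma levMn n x i : lev n (x *+ i) = lev n x *+ i.
Proof. by elim: i => [|i IH]; rewrite ?mulr0n// !mulrS levD IH. Qed.
Lemma lev_sum n (I : Type) (r : seq I) (P : pred I) (f : I -> KG) :
  lev n (\sum_(i <- r | P i) f i) = \sum_(i <- r | P i) lev n (f i).
Proof. by elim/big_rec2: _ => [//|i a b _ <-]. Qed.
Lemma lev_commutator n x y : lev n (commutator x y) = commutator (lev n x) (lev n y).
Proof. by []. Qed.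

(** Closure may be tested on the cofinal N_j; the converse lifts elements of J^m along G ->
    G/N_j. *)
Lemma cga_fil_lev (m : nat) (x : KG) :
  cga_fil (- m%:Z) x <-> forall n, aug_power m (lev n x).
Proof.
have m0 : (- m%:Z <= 0) by lia.
have mE : `|- m%:Z|%N = m by lia.
split=> [/(cga_filP _ m0) xm n|xm].
  have [f] := xm (openN n); rewrite mE => fm fx; rewrite /lev -fx.
  by apply: (gmap_aug_power (@cosetM _ (N n))).
apply/(cga_filP _ m0) => M; rewrite mE.
have [j jM] := tau_cofinal (svalP M) (nsg1 _).
have [f fm fx] := aug_power_lift (@cosetM _ (N j)) (@coset_surj _ N j) (xm j).
exists f => //; rewrite -(@cga_compat _ _ _ x (openN j) M jM) -[cga_proj x _]/(lev j x) -fx.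
by rewrite gmap_comp; apply: eq_gmap => y /=; rewrite quotg_map_coset.
Qed.

Definition scK (c : K) : KG := cga_of tau (sc G c).
Definition tK (x : G) : KG := cga_of tau (dl K x).
Definition cga_y1 : KG := tK g.1.1 - 1.
Definition cga_y2 : KG := tK g.1.2 - 1.
Definition cga_y3 : KG := tK g.2 - 1.
Local Notation mK := (mono cga_y1 cga_y2 cga_y3).
Local Notation mon n := (mono (lev_y1 K N g n) (lev_y2 K N g n) (lev_y3 K N g n)).

Lemma lev_sc n c : lev n (scK c) = sc _ c.
Proof. exact: (gmap_sc (@cosetM _ (N n))). Qed.
Lemma lev_t n x : lev n (tK x) = gel K N n x.
Proof. exact: gmap_dl. Qed.
Lemma lev_mon n e : lev n (mK e) = mon n e.
Proof. by rewrite /mono !levM !levX !levB !lev_t. Qed.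

Lemma lev_red n k x : (k <= n)%N ->
  gmap (@quotg_map G (N n) (N k)) (lev n x) = lev k x.
Proof. by move=> kn; apply: (@cga_compat _ _ _ x (openN n) (openN k)) => y; apply: (chain_le uc). Qed.

Local Notation box := (box p).

(** The box size k is independent of the level n: once m < p^k the box holds every exponent of
    weight m, and the same coefficients serve at all levels. *)
Definition hsum (n k m : nat) (d : box k -> K) : gralg K (quotg (N n)) :=
  \sum_(b : box k | ewt (bexp b) == m) sc _ (d b) * mon n (bexp b).
Definition hsumK (k m : nat) (d : box k -> K) : KG :=
  \sum_(b : box k | ewt (bexp b) == m) scK (d b) * mK (bexp b).

Lemma lev_hsum (n k m : nat) (d : box k -> K) : lev n (hsumK m d) = hsum n m d.
Proof.
rewrite lev_sum; apply: eq_bigr => b _; by rewrite levM lev_sc (@lev_mon n).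
Qed.

Lemma hsum_independent k m (d : box k -> K) : aug_power m.+1 (hsum k m d) ->
  forall b, ewt (bexp b) = m -> d b = 0.
Proof.
move=> /(aug_power_inspan p_prime p_ge3 charK l_ge1 uc)/(inspan_box charK uc)[d' d'P].
rewrite /hsum big_mkcond => dd b bm.
pose d0 b := if ewt (bexp b) == m then d b else 0.
have /(_ b) : d0 =1 d'.
  apply: (box_unique p_prime p_ge3 charK l_ge1 uc); rewrite -dd; apply: eq_bigr => b' _.
  by rewrite /d0; case: ifP; rewrite ?sc0 ?mul0r.
rewrite /d0 bm eqxx => ->; apply/eqP; apply: contraT => /d'P; rewrite bm; lia.
Qed.

Lemma hsum_leading n k m f : (m < p ^ k)%N -> aug_power m f ->
  exists d : box k -> K, aug_power m.+1 (f - hsum n m d).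
Proof.
move=> mk /(aug_power_leading p_prime p_ge3 charK l_ge1 uc)[h hs fh].
suff [d hd] : exists d : box k -> K, h = hsum n m d by exists d; rewrite -hd.
move: h hs {fh}; apply: inspan_ind => [|c e em].
  split=> [|h h' [d ->] [d' ->]].
    by exists (fun=> 0); rewrite /hsum big1// => b _; rewrite sc0 mul0r.
  exists (fun b => d b + d' b); rewrite /hsum -big_split; apply: eq_bigr => b _.
  by rewrite scD mulrDl.
have e1 : (e.1.1 < p ^ k)%N by move: em; rewrite /ewt; lia.
have e2 : (e.1.2 < p ^ k)%N by move: em; rewrite /ewt; lia.
have e3 : (e.2 < p ^ k)%N by move: em; rewrite /ewt; lia.
pose b0 : box k := (Ordinal e1, Ordinal e2, Ordinal e3).
have b0E : bexp b0 = e by rewrite /bexp /= -!surjective_pairing.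
exists (fun b => if b == b0 then c else 0).
rewrite /hsum (bigD1 b0) ?b0E ?em// eqxx big1 => [|b /andP[_ /negPf ->]]; first by rewrite /= addr0.
by rewrite sc0 mul0r.
Qed.

Lemma fil_hsumK k m (d : box k -> K) : cga_fil (- m%:Z) (hsumK m d).
Proof.
apply/cga_fil_lev => n; rewrite lev_hsum /hsum; elim/big_ind: _ => [|f f'|b /eqP <-].
- exact: aug_power0.
- exact: aug_powerD.
- by apply: aug_powerZ; apply: aug_power_mon.
Qed.

Lemma hsumK_independent k m (d : box k -> K) : cga_fil (- m.+1%:Z) (hsumK m d) ->
  forall b, ewt (bexp b) = m -> d b = 0.
Proof. by move=> /cga_fil_lev/(_ k); rewrite lev_hsum; apply: hsum_independent. Qed.

(** The leading form found at level k is correct everywhere: below k by reduction, above k because a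
    discrepancy there would reduce to a nonzero form of weight m at level k. *)
Lemma hsumK_leading k m x : (m < p ^ k)%N -> cga_fil (- m%:Z) x ->
  exists d : box k -> K, cga_fil (- m.+1%:Z) (x - hsumK m d).
Proof.
move=> mk xm; have /cga_fil_lev/(_ k) xk := xm.
have [d xd] := hsum_leading mk xk; exists d; apply/cga_fil_lev => n.
have x'k : aug_power m.+1 (lev k (x - hsumK m d)) by rewrite levB lev_hsum.
have [nk|/ltnW kn] := leqP n k.
  rewrite -(lev_red _ nk); apply: gmap_aug_power => //.
  by apply: quotg_mapM => y; apply: (chain_le uc).
have [d' xd'] : exists d' : box k -> K, aug_power m.+1 (lev n (x - hsumK m d) - hsum n m d').
  apply: (hsum_leading mk); rewrite levB; apply: aug_powerB.
    by have /cga_fil_lev := xm.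
  by have /cga_fil_lev := fil_hsumK m d.
suff d0 : hsum n m d' = 0 by move: xd'; rewrite d0 subr0.
rewrite /hsum big1// => b /eqP bm; rewrite (@hsum_independent k m d') ?sc0 ?mul0r//.
rewrite -lev_hsum -(subKr (lev k (x - hsumK m d)) (lev k (hsumK m d'))).
apply: aug_powerB => //; rewrite -levB -(lev_red _ kn) levB lev_hsum.
by apply: gmap_aug_power => //; apply: quotg_mapM => y; apply: (chain_le uc).
Qed.

Lemma cga_gr_comm a b (x y : KG) : cga_fil (- a%:Z) x -> cga_fil (- b%:Z) y ->
  cga_fil (- (a + b).+1%:Z) (commutator x y).
Proof.
move=> /cga_fil_lev xa /cga_fil_lev yb; apply/cga_fil_lev => n.
exact: (gr_comm_gel p_prime p_ge3 charK l_ge1 uc (xa n) (yb n)).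
Qed.

(** The bracket of g^(p^r) with y - 1, of degree 1, lies in J^(p^(r+l)); with (y - 1)^p, of degree
    p, in J^(p^(r+l+1)). [src_deg] and [src_deg1] are the respective gains. *)
Definition src_deg r : nat := (p ^ (r + l)).-1.
Definition src_deg1 r : nat := (p ^ (r + l).+1 - p)%N.

Lemma cga_source_theta x r m (b : KG) : cga_fil (- m%:Z) b ->
  cga_fil (- (m + src_deg r)%N%:Z) (commutator (tK (x ^+ (p ^ r))%g) b).
Proof.
move=> /cga_fil_lev bm; apply/cga_fil_lev => n; rewrite lev_commutator lev_t.
apply: aug_power_commutator => // c; have [y <-] := coset_surj c.
have := aug_power_commutator_gel p_prime p_ge3 charK l_ge1 uc n
  (chain_exp_p uc r (chain0 uc x)) (chain0 uc y).
by rewrite /src_deg prednK ?addn0//; apply: pj_gt0.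
Qed.

Lemma cga_source_bracket x y a b c r : chain_bracket p l N g x y a b c ->
  cga_fil (- (p ^ (r + l)).+1%:Z) (commutator (tK (x ^+ (p ^ r))%g) (tK y - 1) -
    (cga_y1 ^+ (p ^ (r + l)) *+ a + cga_y2 ^+ (p ^ (r + l)) *+ b + cga_y3 ^+ (p ^ (r + l)) *+ c)).
Proof.
move=> xy; apply/cga_fil_lev => n.
rewrite commutatorB1 levB lev_commutator !levD !levMn !levX !levB !lev_t commutator_gel.
have [xyq xyY] := symb_chain p_prime p_ge3 charK l_ge1 uc n (xy r).
set k := gel _ _ _ _ in xyq xyY *; set Y := _ *+ a + _ + _ in xyY *.
set w := gel _ _ _ _ * gel _ _ _ _; have -> : (k - 1) * w - Y = (k - 1 - Y) + (k - 1) * (w - 1).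
  by rewrite (mulrBr (k - 1)) mulr1 [RHS]addrC addrA subrK.
apply: aug_powerD => //; rewrite -addn1; apply: aug_powerM => //.
by rewrite /w -gelM; apply: aug_power1_dl.
Qed.

(** At each level b is a combination of monomials in the p-th powers of the y_i, all of weight at
    least m, and the derivation rule passes the gain on a p-th power to each of them. *)
Lemma cga_source_theta1 x r m (b : KG) : cga_fil (- m%:Z) b -> cga_power K tau p b ->
  cga_fil (- (m + src_deg1 r)%N%:Z) (commutator (tK (x ^+ (p ^ r))%g) b).
Proof.
move=> /cga_fil_lev bm bp; apply/cga_fil_lev => n; rewrite lev_commutator lev_t.
set a := gel _ _ _ _.
have [_ [f fp <-] fb] := bp (openN n).
have b1 : inspan g (fun e => [/\ p %| e.1.1, p %| e.1.2 & p %| e.2]%N) (lev n b).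
  rewrite /lev -fb /=; have [s us fs] := gsuppP f; rewrite (gralg_sum us fs).
  rewrite (gmap_sum (coset (N n))).
  elim/big_ind: _ => [|u v|x' _]; [exact: inspan0|exact: inspanD|].
  rewrite gmapM; last exact: cosetM.
  rewrite gmap_sc; last exact: cosetM.
  rewrite gmap_dl; have [->|fx'] := eqVneq (f x') 0; first by rewrite sc0 mul0r; apply: inspan0.
  apply/inspanZ/(inspan_chain1 p_prime charK l_ge1 uc).
  have x'p : power_subgroup p x' := fp _ fx'.
  (* N_1 is a subgroup containing all p-th powers, hence contains G^p. *)
  by apply: x'p => [|y]; [exact: nsgP|exact: (chain_pow uc (chain0 uc y))].
have bI := inspanI p_prime p_ge3 charK l_ge1 uc b1 (aug_power_inspan p_prime p_ge3 charK l_ge1 uc (bm n)).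
have axp (y : G) : aug_power (p + src_deg1 r) (commutator a ((gel K N n y - 1) ^+ p)).
  have := gel_exp_p charK N n y 1; rewrite expn1 => <-; rewrite commutatorB1.
  have := aug_power_commutator_gel p_prime p_ge3 charK l_ge1 uc n
    (chain_exp_p uc r (chain0 uc x)) (chain_pow uc (chain0 uc y)).
  have -> : (r + 1 + l = (r + l).+1)%N by lia.
  rewrite /src_deg1 subnKC// expnS leq_pmulr// ; exact: pj_gt0.
have axX (y : G) i : aug_power (p * i) ((gel K N n y - 1) ^+ (p * i)) /\
    aug_power (p * i + src_deg1 r) (commutator a ((gel K N n y - 1) ^+ (p * i))).
  split; first by rewrite -[X in aug_power X]mul1n; apply: aug_powerX; apply: aug_power1_dl.
  rewrite exprM; elim: i => [|i IH]; first by rewrite expr0 commutator1; apply: aug_power0.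
  have yp j : aug_power (p * j) (((gel K N n y - 1) ^+ p) ^+ j).
    by rewrite -exprM -[X in aug_power X]mul1n; apply: aug_powerX; apply: aug_power1_dl.
  rewrite exprS commutatorM; apply: aug_powerD.
    by apply: aug_power_le (aug_powerM (axp y) (yp i)); rewrite mulnS; lia.
  have := yp 1%N; rewrite expr1 muln1 => yp1.
  by apply: aug_power_le (aug_powerM yp1 IH); rewrite mulnS; lia.
move: (lev n b) bI; apply: inspan_ind => [|c e [[/dvdnP[i iE] /dvdnP[j jE] /dvdnP[k kE]] em]].
  by split=> [|u v]; rewrite ?commutator0 ?commutatorD; [apply: aug_power0|apply: aug_powerD].
rewrite commutator_sc; apply: aug_powerZ.
have [i1 i2] := axX g.1.1 i; have [j1 j2] := axX g.1.2 j; have [k1 k2] := axX g.2 k.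
rewrite mulnC in iE; rewrite mulnC in jE; rewrite mulnC in kE.
move: em; rewrite /ewt /mono iE jE kE => em.
rewrite !commutatorM mulrDl; apply: aug_powerD; first apply: aug_powerD.
- by apply: aug_power_le (aug_powerM (aug_powerM i2 j1) k1); lia.
- by apply: aug_power_le (aug_powerM (aug_powerM i1 j2) k1); lia.
- by apply: aug_power_le (aug_powerM (aug_powerM i1 j1) k2); lia.
Qed.

End CompletedLevel.

(** * Associated graded rings *)

Section GradedRing.
Variables (A : pzRingType) (F : filtration A).
Local Notation gr := (gr F).
Local Notation cls := (@gr_cls A F).
Implicit Types (k m : int) (a b : A).

Lemma gr_clsE k a (Fa : F k a) : cls k a = gr_pi (Rees (gr_cls_subproof Fa)).
Proof.
rewrite /gr_cls; case: pselect => // Fa'; congr gr_pi; exact: val_inj.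
Qed.

Lemma gr_piS (I : Type) (r : seq I) (P : pred I) (f : I -> rees F) :
  gr_pi (\sum_(i <- r | P i) f i) = \sum_(i <- r | P i) gr_pi (f i).
Proof.
elim/big_rec2: _ => [|i x y _ <-]; last by rewrite gr_piD.
by rewrite -(subrr (0 : rees F)) gr_piB subrr.
Qed.

Lemma rees_sumE (I : Type) (r : seq I) (P : pred I) (f : I -> rees F) k :
  rees_val (\sum_(i <- r | P i) f i) k = \sum_(i <- r | P i) rees_val (f i) k.
Proof. by elim/big_rec2: _ => [//|i x y _ <-]. Qed.

Lemma gr_pi_sum (f : rees F) (s : seq int) : uniq s -> (forall k : int, f k != 0 -> k \in s) ->
  gr_pi f = \sum_(k <- s) cls k (f k).
Proof.
move=> us fs; under eq_bigr => k _ do rewrite (gr_clsE (reesP f k)).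
rewrite -gr_piS; congr gr_pi; apply: val_inj; apply: gralgP => k.
rewrite /= rees_sumE /=; have [ks|ks] := boolP (k \in s).
  rewrite (bigD1_seq k)//= eqxx big1 ?addr0// => m mk.
  by rewrite ifN// eq_sym.
have /eqP -> : f k == 0 by apply: contraR ks => /fs.
by rewrite big_seq big1// => m ms; case: eqP => // km; rewrite km ms in ks.
Qed.

Lemma gr_sum_cls (x : gr) : exists s : seq (int * A),
  (forall u, u \in s -> F u.1 u.2) /\ x = \sum_(u <- s) cls u.1 u.2.
Proof.
rewrite -(gr_reprK x); set f := gr_repr x; have [s us fs] := gsuppP (rees_val f).
exists [seq (k, rees_val f k) | k <- s]; split; first by move=> _ /mapP[k _ ->]; apply: reesP.
by rewrite big_map (gr_pi_sum us fs).
Qed.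

Lemma gr_sum_cls_eq0 (I : Type) (r : seq I) (k : I -> int) (a : I -> A) :
  (forall i, F (k i) (a i)) -> \sum_(i <- r) cls (k i) (a i) = 0 ->
  forall m, F (m - 1) (\sum_(i <- r | k i == m) a i).
Proof.
move=> Fa; under eq_bigr => i _ do rewrite (gr_clsE (Fa i)).
rewrite -gr_piS => h0 m; have := h0; rewrite -[RHS](_ : gr_pi 0 = 0).
  move=> /gr_piP; rewrite subr0 => /rees_lowerP/(_ m); rewrite rees_sumE /=.
  rewrite [in X in _ -> X]big_mkcond; congr (fil F _ _); apply: eq_bigr => i _.
  by rewrite eq_sym.
by rewrite -(subrr (0 : rees F)) gr_piB subrr.
Qed.

Lemma gr_clsD k a b : F k a -> F k b -> cls k (a + b) = cls k a + cls k b.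
Proof.
move=> Fa Fb; rewrite (gr_clsE (filD Fa Fb)) (gr_clsE Fa) (gr_clsE Fb) -gr_piD; congr gr_pi.
apply: val_inj; apply: gralgP => m.
rewrite -[RHS]/((if m == k then a else 0) + (if m == k then b else 0)) /=.
by case: ifP; rewrite ?addr0.
Qed.

Lemma gr_cls_eq0 k a : F k a -> (cls k a = 0 <-> F (k - 1) a).
Proof.
move=> Fa; split=> [a0|Fa1].
  have := @gr_sum_cls_eq0 _ [:: tt] (fun=> k) (fun=> a) (fun=> Fa).
  by rewrite !big_seq1 => /(_ a0 k); rewrite big_mkcond big_seq1 eqxx.
rewrite (gr_clsE Fa) -[RHS](_ : gr_pi 0 = 0); last by rewrite -(subrr (0 : rees F)) gr_piB subrr.
apply/gr_piP/rees_lowerP => m; rewrite subr0 /=; case: eqP => [->//|_]; exact: fil0.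
Qed.

Lemma gr_cls0 k : cls k 0 = 0.
Proof. by apply/gr_cls_eq0; exact: fil0. Qed.

Lemma gr_clsN k a : F k a -> cls k (- a) = - cls k a.
Proof.
move=> Fa; apply: (addrI (cls k a)); rewrite -gr_clsD ?subrr ?gr_cls0//; exact: filN.
Qed.

Lemma gr_clsB k a b : F k a -> F k b -> cls k (a - b) = cls k a - cls k b.
Proof. by move=> Fa Fb; rewrite gr_clsD ?gr_clsN//; apply: filN. Qed.

Lemma gr_cls_eq k a b : F k a -> F k b -> F (k - 1) (a - b) -> cls k a = cls k b.
Proof.
move=> Fa Fb Fab; apply/eqP; rewrite -subr_eq0 -gr_clsB//; apply/eqP/gr_cls_eq0 => //.
exact: filB.
Qed.

Lemma gr_cls_sum (I : Type) (r : seq I) (P : pred I) k (f : I -> A) :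
  (forall i, P i -> F k (f i)) ->
  cls k (\sum_(i <- r | P i) f i) = \sum_(i <- r | P i) cls k (f i).
Proof.
move=> Ff; have [//] : F k (\sum_(i <- r | P i) f i) /\
    cls k (\sum_(i <- r | P i) f i) = \sum_(i <- r | P i) cls k (f i).
elim/big_rec2: _ => [|i x y Pi [Fy <-]]; first by split; [exact: fil0|exact: gr_cls0].
by split; [apply: filD => //; apply: Ff|rewrite gr_clsD//; apply: Ff].
Qed.

Lemma gr_clsM k m a b : F k a -> F m b -> cls k a * cls m b = cls (k + m) (a * b).
Proof.
move=> Fa Fb; rewrite (gr_clsE (filM Fa Fb)) (gr_clsE Fa) (gr_clsE Fb) [LHS]gr_mulE.
congr gr_pi; apply: val_inj; apply: gralgP => n.
pose Zm := Algebra.to_multiplicative int.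
rewrite -[LHS]/(@gmul A Zm (@gdelta A Zm a k) (@gdelta A Zm b m) n) gmul_deltal.
rewrite -[LHS]/(a * if - (k : int) + n == m then b else 0) -[RHS]/(if n == k + m then a * b else 0).
have -> : (- k + n == m) = (n == k + m) by rewrite addrC subr_eq addrC.
by case: ifP; rewrite ?mulr0.
Qed.

Lemma gr_cls1 : cls 0 1 = 1.
Proof.
rewrite (gr_clsE (fil1 F)); congr gr_pi.
by apply: val_inj; apply: gralgP.
Qed.

Lemma gr_clsX k a n : F k a -> cls k a ^+ n = cls (k * n%:Z) (a ^+ n) /\ F (k * n%:Z) (a ^+ n).
Proof.
move=> Fa; elim: n => [|n [IH Fn]]; first by rewrite mulr0 !expr0 gr_cls1; split=> //; apply: fil1.
have e : k * n.+1%:Z = k + k * n%:Z by lia.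
by rewrite exprS IH gr_clsM// e exprS; split=> //; apply: filM.
Qed.

Section Derivation.
Variables (a : A) (n : nat).
Hypothesis Fn : forall k b, F k b -> F (k - n%:Z) (commutator a b).

(** [gr_der] is defined through a chosen representative; the degree bound on the bracket makes any
    other one serve. *)
Lemma gr_der_pi (f : rees F) (s : seq int) : uniq s -> (forall k : int, f k != 0 -> k \in s) ->
  gr_der a n (gr_pi f) = \sum_(k <- s) cls (k - n%:Z) (commutator a (f k)).
Proof.
move=> us fs; rewrite /gr_der; set f' := gr_repr _.
have [s' us' fs'] := gsuppP (rees_val f').
have /gr_piP/rees_lowerP ff' : gr_pi f' = gr_pi f by exact: gr_reprK.
pose t := undup (s ++ s'); have ut : uniq t := undup_uniq _.
have z (h : rees F) k : cls (k - n%:Z) (commutator a (h k)) != 0 -> h k != 0.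
  by apply: contraNneq => ->; rewrite commutator0 gr_cls0.
rewrite (@fsumE _ _ t)//; last first.
  by move=> k /z /fs'; rewrite mem_undup mem_cat => ->; rewrite orbT.
rewrite (@big_seq_wid _ _ s t)//; first last.
- by move=> k /z /fs ks; rewrite mem_undup mem_cat ks.
- by move=> k /z /fs.
apply: eq_bigr => k _; apply: gr_cls_eq; [exact/Fn/reesP|exact/Fn/reesP|].
have := Fn (ff' k); rewrite -[rees_val (f' - f) k]/(f' k - f k) commutatorD commutatorN.
by have -> : k - 1 - n%:Z = k - n%:Z - 1 by lia.
Qed.

Lemma gr_der_add x y : gr_der a n (x + y) = gr_der a n x + gr_der a n y :> gr.
Proof.
rewrite -(gr_reprK x) -(gr_reprK y); set f := gr_repr x; set h := gr_repr y.
have [s us fs] := gsuppP (rees_val f); have [t ut ht] := gsuppP (rees_val h).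
have [r ur fr] := gsuppP (rees_val (f + h)).
pose w := undup (s ++ t ++ r); have uw : uniq w := undup_uniq _.
have wf k : f k != 0 -> k \in w by move=> /fs ks; rewrite mem_undup !mem_cat ks.
have wh k : h k != 0 -> k \in w by move=> /ht ks; rewrite mem_undup !mem_cat ks orbT.
have wfh k : (f + h) k != 0 -> k \in w by move=> /fr ks; rewrite mem_undup !mem_cat ks !orbT.
rewrite -gr_piD (gr_der_pi uw wf) (gr_der_pi uw wh) (gr_der_pi uw wfh).
rewrite -big_split; apply: eq_bigr => k _.
rewrite -[rees_val (f + h) k]/(f k + h k) commutatorD gr_clsD//; exact/Fn/reesP.
Qed.

Lemma gr_der0 : gr_der a n (0 : gr) = 0.
Proof. by apply: (addrI (gr_der a n (0 : gr))); rewrite -gr_der_add !addr0. Qed.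

Lemma gr_der_sum (I : Type) (r : seq I) (P : pred I) (f : I -> gr) :
  gr_der a n (\sum_(i <- r | P i) f i) = \sum_(i <- r | P i) gr_der a n (f i).
Proof. by elim/big_rec2: _ => [|i x y _ <-]; rewrite ?gr_der0 ?gr_der_add. Qed.

Lemma gr_der_cls k b : F k b -> gr_der a n (cls k b) = cls (k - n%:Z) (commutator a b).
Proof.
move=> Fb; rewrite (gr_clsE Fb) (@gr_der_pi _ [:: k])//.
  by rewrite big_seq1 /= eqxx.
by move=> m /=; rewrite mem_seq1; case: ifP => //; rewrite eqxx.
Qed.

Lemma gr_der_mul x y : gr_der a n (x * y) = gr_der a n x * y + x * gr_der a n y :> gr.
Proof.
have [s [sF ->]] := gr_sum_cls x; have [t [tF ->]] := gr_sum_cls y.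
rewrite mulr_suml !gr_der_sum !mulr_suml -big_split; apply: eq_big_seq => u /sF Fu.
rewrite !mulr_sumr gr_der_sum -big_split; apply: eq_big_seq => v /tF Fv.
rewrite gr_clsM// !gr_der_cls//; last exact: filM.
have Fu' := Fn Fu; have Fv' := Fn Fv.
rewrite !gr_clsM// commutatorM.
have e1 : u.1 - n%:Z + v.1 = u.1 + v.1 - n%:Z by lia.
have e2 : u.1 + (v.1 - n%:Z) = u.1 + v.1 - n%:Z by lia.
by rewrite e1 e2 gr_clsD//; [rewrite -e1|rewrite -e2]; apply: filM.
Qed.

End Derivation.
End GradedRing.

(** * Divisibility in polynomial rings *)

Section Multiples.
Variable R : idomainType.
Implicit Types Q Z a b : R.

Definition multiple Q Z : Prop := exists b, Z = Q * b.

Lemma multipleD Q Z Z' : multiple Q Z -> multiple Q Z' -> multiple Q (Z + Z').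
Proof. by move=> [b ->] [c ->]; exists (b + c); rewrite mulrDr. Qed.
Lemma multipleMr Q Z c : multiple Q Z -> multiple Q (Z * c).
Proof. by move=> [b ->]; exists (b * c); rewrite mulrA. Qed.
Lemma multipleB Q Z Z' : multiple Q Z -> multiple Q Z' -> multiple Q (Z - Z').
Proof. by move=> [b ->] [c ->]; exists (b - c); rewrite mulrBr. Qed.

(** From Za = Qu and Zb = Qv one gets ub = va; regularity yields u = aw, and then Z = Qw. *)
Lemma multiple_regular Q Z a b : a != 0 -> b != 0 ->
  (forall u v, u * b = v * a -> multiple a u) ->
  multiple Q (Z * a) -> multiple Q (Z * b) -> multiple Q Z.
Proof.
move=> a0 b0 ab [u uE] [v vE]; have [Q0|Q0] := eqVneq Q 0.
  by exists 0; apply: (mulIf b0); rewrite vE Q0 !mul0r.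
have [w wE] : multiple a u.
  by apply: (ab u v); apply: (mulfI Q0); rewrite !mulrA -uE -vE mulrAC.
by exists w; apply: (mulIf a0); rewrite uE wE; ring.
Qed.

End Multiples.

(** The remainder r of u modulo a satisfies r b = c a for some c; as r has smaller degree than the
    monic a and b is a nonzero constant, r = 0. *)
Lemma monic_regular (S : idomainType) (a u v : {poly S}) (b : S) :
  a \is monic -> b != 0 -> u * b%:P = v * a -> multiple a u.
Proof.
move=> am b0 uv; have uE := Pdiv.RingMonic.rdivp_eq am u.
set r := Pdiv.Ring.rmodp u a in uE.
suff r0 : r = 0 by exists (Pdiv.Ring.rdivp u a); rewrite {1}uE r0 addr0 mulrC.
pose c := v - Pdiv.Ring.rdivp u a * b%:P.
have rE : r * b%:P = c * a by rewrite /c mulrBl -uv {1}uE; ring.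
have ra : (size r < size a)%N by rewrite Pdiv.Ring.ltn_rmodp monic_neq0.
have [c0|c0] := eqVneq c 0.
  by apply: (@mulIf _ b%:P); rewrite ?polyC_eq0// rE c0 !mul0r.
have : size (b%:P * r) = size (c * a) by rewrite mulrC rE.
rewrite (size_Mmonic c0 am) size_Cmul// => e.
by move: ra; rewrite -size_poly_gt0 in c0; rewrite e; lia.
Qed.

Section Sl2Polynomials.
Variables (K : fieldType) (p : nat) (p_gt1 : (1 < p)%N) (two : (2%:R : K) != 0).
Local Notation R1 := {poly K}.
Local Notation R2 := {poly R1}.
Local Notation R3 := {poly R2}.
Let e : R3 := ('X%:P)%:P.
Let f : R3 := 'X%:P.
Let h : R3 := 'X.

(** Eliminating between two exponents [q] and [q p] shows that [Yf] times each of
    [h^(qp) - h^q e^(qp-q)] and [f^(qp) - f^q e^(qp-q)] is a multiple of [Q]; the first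
    is monic in [h] and the second does not involve [h], so they form a regular
    sequence.  The same works for [Ye], and then [e^q Yh], [f^q Yh] are multiples of [Q]. *)
Lemma sl2_polynomials (Q Ye Yf Yh : R3) (n0 : nat) :
  (forall n, (n0 <= n)%N -> let q := (p ^ n)%N in
    [/\ multiple Q (Yf * h ^+ q - 2%:R * Yh * e ^+ q),
        multiple Q (2%:R * Yh * f ^+ q - Ye * h ^+ q) &
        multiple Q (2%:R * (Ye * e ^+ q - Yf * f ^+ q))]) ->
  [/\ multiple Q Ye, multiple Q Yf & multiple Q Yh].
Proof.
move=> H; have [A1 A2 A3] := H n0 (leqnn _); have [B1 B2 B3] := H n0.+1 (leqnSn _).
move: A1 A2 A3 B1 B2 B3; set q := (p ^ n0)%N.
have q0 : (0 < q)%N by rewrite expn_gt0; lia.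
(* Writing qp as q + m makes each relation for qp comparable with a multiple of the one for q. *)
have -> : (p ^ n0.+1 = q + q * p.-1)%N by rewrite expnS /q; nia.
set m := (q * p.-1)%N; have m0 : (0 < m)%N by rewrite muln_gt0 q0; lia.
rewrite !exprD => A1 A2 A3 B1 B2 B3.
have two1 : (2%:R : R1) != 0 by rewrite -polyC_natr polyC_eq0.
have two2 : (2%:R : R2) != 0 by rewrite -polyC_natr polyC_eq0.
have monich (c : R2) : h ^+ q * (h ^+ m - c%:P) \is monic.
  rewrite monicMl ?monicXn// monicE lead_coefDl ?lead_coefXn// size_polyN size_polyXn.
  by apply: leq_ltn_trans (size_polyC_leq1 _) _; lia.
have mXc (c : R1) : 'X^m - c%:P \is monic.
  rewrite monicE lead_coefDl ?lead_coefXn// size_polyN size_polyXn.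
  by apply: leq_ltn_trans (size_polyC_leq1 _) _; lia.
have monicf (c : R1) : 'X^q * ('X^m - c%:P) != 0 :> R2.
  by rewrite monic_neq0// monicMl ?monicXn// mXc.
have reg (Z : R3) (c b : R2) : b != 0 -> multiple Q (Z * (h ^+ q * (h ^+ m - c%:P))) ->
    multiple Q (Z * b%:P) -> multiple Q Z.
  move=> b0; have bP : b%:P != 0 by rewrite polyC_eq0.
  by apply: multiple_regular (monic_neq0 (monich c)) bP _ => u v; apply: monic_regular b0.
have eE i : e ^+ i = ('X^i%:P)%:P by rewrite /e -!polyC_exp.
have fE i : f ^+ i = ('X^i)%:P by rewrite /f -!polyC_exp.
(* The [Yh] terms cancel in B1 - e^m A1, the [Ye] terms in e^m A3 - B3. *)
have Yf0 : multiple Q Yf.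
  apply: (reg _ ('X^m%:P) (2%:R * ('X^q * ('X^m - 'X^m%:P)))); first by rewrite mulf_neq0.
    have := multipleB B1 (multipleMr (e ^+ m) A1); congr multiple; rewrite -eE; ring.
  have := multipleB (multipleMr (e ^+ m) A3) B3; congr multiple.
  by rewrite !(rmorphM, rmorphB) /= -!fE -eE rmorph_nat; ring.
have Ye0 : multiple Q Ye.
  apply: (reg _ ('X^m) (2%:R * ('X^q%:P * ('X^m%:P - 'X^m)))).
  - have c0 : ('X^q)%:P != 0 :> R2 by rewrite polyC_eq0 monic_neq0// monicXn.
    have d0 : ('X^m)%:P - 'X^m != 0 :> R2 by rewrite -opprB oppr_eq0 monic_neq0// mXc.
    exact: mulf_neq0 two2 (mulf_neq0 c0 d0).
  - have := multipleB (multipleMr (f ^+ m) A2) B2; congr multiple; rewrite -fE; ring.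
  have := multipleB B3 (multipleMr (f ^+ m) A3); congr multiple.
  by rewrite !(rmorphM, rmorphB) /= -!fE -!eE rmorph_nat; ring.
split=> //; have Yhe : multiple Q (2%:R * Yh * e ^+ q).
  have := multipleB (multipleMr (h ^+ q) Yf0) A1; congr multiple; ring.
have Yhf : multiple Q (2%:R * Yh * f ^+ q).
  have := multipleD A2 (multipleMr (h ^+ q) Ye0); congr multiple; ring.
have two3 : (2%:R : R3) = ((2%:R : K)%:P%:P)%:P by rewrite !rmorph_nat.
have [b bE] : multiple Q (2%:R * Yh); last first.
  exists (((2%:R^-1 : K)%:P%:P)%:P * b); rewrite mulrCA -bE two3 mulrA -!polyCM mulVf//.
  by rewrite !polyC1 mul1r.
apply: (multiple_regular _ _ _ Yhf Yhe).
- by rewrite fE polyC_eq0 monic_neq0// monicXn.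
- by rewrite eE !polyC_eq0 monic_neq0// monicXn.
move=> u v uv.
(* Coefficientwise in h: f^q is monic in f and e^q is a constant there. *)
have /choice[w wE] t : exists w : R2, u`_t = 'X^q * w.
  apply: (@monic_regular _ 'X^q u`_t v`_t ('X^q)); rewrite ?monicXn ?monic_neq0 ?monicXn//.
  by have := congr1 (fun P : R3 => P`_t) uv; rewrite eE fE /= !coefMC.
exists (\poly_(t < size u) w t); apply/polyP => t; rewrite fE coefCM coef_poly.
case: ltnP => tu; first exact: wE.
by rewrite mulr0 nth_default.
Qed.

End Sl2Polynomials.

(** * Polynomial description of the graded ring *)

Section PartialDerivatives.
Variable K : fieldType.
Local Notation R1 := {poly K}.
Local Notation R2 := {poly R1}.
Local Notation R3 := {poly R2}.

(** With e the innermost and h the outermost variable, [deriv2] and [deriv3] are d/de on K[e,f] and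
    K[e,f,h], [deriv32] is d/df, and the plain derivative on [R3] is d/dh. *)
Definition deriv2 : R2 -> R2 := map_poly (@deriv K).
Definition deriv3 : R3 -> R3 := map_poly deriv2.
Definition deriv32 : R3 -> R3 := map_poly (@deriv R1).

Lemma map_polyMXaddC (R S : nzRingType) (f : {additive R -> S}) (P : {poly R}) c :
  map_poly f (P * 'X + c%:P) = map_poly f P * 'X + (f c)%:P.
Proof.
apply/polyP => i; rewrite coef_map_id0 ?raddf0// !coefD !coefMX !coefC raddfD /=.
by case: i => [|i] /=; rewrite ?raddf0 ?coef_map_id0 ?raddf0.
Qed.

Lemma deriv2MXaddC P c : deriv2 (P * 'X + c%:P) = deriv2 P * 'X + (c^`())%:P.
Proof. exact: map_polyMXaddC. Qed.
Lemma deriv32MXaddC P c : deriv32 (P * 'X + c%:P) = deriv32 P * 'X + (c^`())%:P.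
Proof. exact: map_polyMXaddC. Qed.
Lemma deriv3MXaddC P c : deriv3 (P * 'X + c%:P) = deriv3 P * 'X + (deriv2 c)%:P.
Proof. exact: (map_polyMXaddC (map_poly (@deriv K))). Qed.

Definition pm (c : K) (e : expo) : R3 :=
  ((c%:P * 'X^(e.1.1))%:P * 'X^(e.1.2))%:P * 'X^(e.2).

Lemma coef_pm c e i j t : (pm c e)`_t`_j`_i = c *+ ((i, j, t) == e).
Proof.
case: e => [[a b] d]; rewrite /pm /= !xpair_eqE.
rewrite coefCM coefXn; case: (eqVneq t d) => _; last by rewrite andbF mulr0 !coef0.
rewrite mulr1 coefCM coefXn andbT; case: (eqVneq j b) => _; last by rewrite andbF mulr0 coef0.
by rewrite mulr1 coefCM coefXn andbT; case: (i == a); rewrite ?mulr1 ?mulr0.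
Qed.

Lemma coef3_bound (P : R3) : exists n : nat, forall i j t : nat,
  (n <= i)%N || (n <= j)%N || (n <= t)%N -> P`_t`_j`_i = 0.
Proof.
pose n2 := (\max_(t < size P) size (P`_t)%R)%N.
pose n1 := (\max_(t < size P) \max_(j < size (P`_t)%R) size (P`_t`_j)%R)%N.
exists (maxn n1 (maxn n2 (size P))) => i j t.
have [tP|tP _] := ltnP t (size P); last by rewrite (nth_default _ tP) !coef0.
have t2 : (size (P`_t)%R <= n2)%N by apply: (leq_bigmax (Ordinal tP)).
have [jP|jP _] := ltnP j (size (P`_t)%R); last by rewrite (nth_default _ jP) coef0.
have t1 : (size (P`_t`_j)%R <= n1)%N.
  apply: leq_trans (leq_bigmax (Ordinal tP)); exact: (leq_bigmax (Ordinal jP)).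
clearbody n1 n2; move=> /orP[/orP[]|]; rewrite !geq_max => /and3P[h1 h2 h3].
- by apply: nth_default; apply: leq_trans h1.
- by move: (leq_trans jP (leq_trans t2 h2)); rewrite ltnn.
- by move: (leq_trans tP h3); rewrite ltnn.
Qed.

Lemma pm_sum p (P : R3) : (1 < p)%N ->
  exists k, P = \sum_(b : box p k) pm P`_b.2`_b.1.2`_b.1.1 (bexp b).
Proof.
move=> p1; have [n nP] := coef3_bound P; exists n.
have np : (n < p ^ n)%N by apply: ltn_expl.
apply/polyP => t; apply/polyP => j; apply/polyP => i; rewrite !coef_sum.
have cE (b : box p n) : (pm P`_b.2`_b.1.2`_b.1.1 (bexp b))`_t`_j`_i =
    P`_t`_j`_i *+ ((i, j, t) == bexp b).
  by rewrite coef_pm; case: eqP => // -[-> -> ->].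
under eq_bigr do rewrite cE.
have [/and3P[i1 j1 t1]|ne] := boolP [&& (i < p ^ n)%N, (j < p ^ n)%N & (t < p ^ n)%N].
  pose b0 : box p n := (Ordinal i1, Ordinal j1, Ordinal t1).
  rewrite (bigD1 b0)//= eqxx big1 ?addr0// => b bb0; case: eqP => // e; case/eqP: bb0.
  case: b e => [[b1 b2] b3] [e1 e2 e3].
  by congr (_, _, _); apply: val_inj.
rewrite nP; last by move: ne; rewrite !negb_and -!leqNgt; lia.
by rewrite big1// => b _; rewrite mul0rn.
Qed.

End PartialDerivatives.

Lemma int_neg_nat (k : int) : k <= 0 -> exists m : nat, k = - m%:Z.
Proof. by move=> k0; exists `|k|%N; lia. Qed.

Section GrPolynomial.
Variables (K : fieldType) (A : pzRingType) (F : filtration A) (p : nat).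
Hypothesis p_gt1 : (1 < p)%N.
Variables (s : K -> A) (y1 y2 y3 : A).
Local Notation mK := (mono y1 y2 y3).
Local Notation box := (box p).
Definition hs (k m : nat) (d : box k -> K) : A :=
  \sum_(b : box k | ewt (bexp b) == m) s (d b) * mK (bexp b).
Hypotheses (F0 : forall x, F 0 x) (sD : forall c d, s (c + d) = s c + s d)
  (sM : forall c d, s (c * d) = s c * s d) (s1 : s 1 = 1).
Hypotheses (Fy1 : F (- 1) y1) (Fy2 : F (- 1) y2) (Fy3 : F (- 1) y3).
Hypothesis Fcomm : forall (a b : nat) x y, F (- a%:Z) x -> F (- b%:Z) y ->
  F (- (a + b).+1%:Z) (commutator x y).
Hypothesis lead_hs : forall k m x, (m < p ^ k)%N -> F (- m%:Z) x ->
  exists d : box k -> K, F (- m.+1%:Z) (x - hs m d).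
Hypothesis indep_hs : forall k m (d : box k -> K), F (- m.+1%:Z) (hs m d) ->
  forall b, ewt (bexp b) = m -> d b = 0.
Local Notation gr := (gr F).
Local Notation cls := (@gr_cls A F).

Lemma gr_cls_pos k x : 0 < k -> cls k x = 0.
Proof.
move=> k0; apply/gr_cls_eq0; first by apply: fil_le (F0 x); lia.
by apply: fil_le (F0 x); lia.
Qed.

Fact gr_mulC (x y : gr) : x * y = y * x.
Proof.
have [t [tF ->]] := gr_sum_cls x; have [r [rF ->]] := gr_sum_cls y.
rewrite mulr_suml mulr_sumr; apply: eq_big_seq => u /tF Fu.
rewrite mulr_sumr mulr_suml; apply: eq_big_seq => v /rF Fv.
have [u0|/int_neg_nat[a ua]] := ltrP 0 u.1; first by rewrite (gr_cls_pos _ u0) mul0r mulr0.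
have [v0|/int_neg_nat[b vb]] := ltrP 0 v.1; first by rewrite (gr_cls_pos _ v0) mulr0 mul0r.
rewrite !gr_clsM// [v.1 + _]addrC; apply: gr_cls_eq.
- exact: filM.
- by rewrite addrC; apply: filM.
rewrite ua in Fu *; rewrite vb in Fv *.
by have := Fcomm Fu Fv; apply: fil_le; lia.
Qed.

Lemma s_0 : s 0 = 0.
Proof. by apply: (addrI (s 0)); rewrite -sD !addr0. Qed.

Fact gr_nz : (1 : gr) != 0.
Proof.
apply/eqP; rewrite -gr_cls1 => /(gr_cls_eq0 (fil1 F)) F1.
have z1 : (0 < p ^ 0)%N by rewrite expn0.
pose b0 : box 0 := (Ordinal z1, Ordinal z1, Ordinal z1).
have hs1 : hs 0 (fun _ : box 0 => 1) = 1.
  rewrite /hs (bigD1 b0)//= s1 mul1r /mono /= !expr0 !mulr1 big1 ?addr0//.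
  move=> b /andP[_ bb0]; case/eqP: bb0; case: b => [[i j] k].
  by congr (_, _, _); apply: val_inj; case: i j k => [[|i] i0] [[|j] j0] [[|k] k0].
have := @indep_hs 0 0 (fun=> 1); rewrite hs1 => /(_ F1 b0 erefl) /eqP.
by rewrite oner_eq0.
Qed.

Definition grB : comNzRingType := HB.pack gr
  (GRing.PzSemiRing_isNonZero.Build gr gr_nz)
  (GRing.PzRing_hasCommutativeMul.Build gr gr_mulC).

Definition sg (c : K) : grB := cls 0 (s c).

Fact sg_zmod : zmod_morphism sg.
Proof.
move=> c d; rewrite /sg; have sN e : s (- e) = - s e.
  by apply: (addrI (s e)); rewrite -sD !subrr s_0.
by rewrite sD sN; apply: gr_clsB; apply: F0.
Qed.
HB.instance Definition _ := GRing.isZmodMorphism.Build K grB sg sg_zmod.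

Fact sg_monoid : monoid_morphism sg.
Proof.
split; first by rewrite /sg s1; apply: gr_cls1.
move=> c d; rewrite /sg sM; have := gr_clsM (F0 (s c)) (F0 (s d)); rewrite addr0.
by move=> <-.
Qed.
HB.instance Definition _ := GRing.isMonoidMorphism.Build K grB sg sg_monoid.

Definition gr_y1 : grB := cls (- 1) y1.
Definition gr_y2 : grB := cls (- 1) y2.
Definition gr_y3 : grB := cls (- 1) y3.

Lemma comm_grB (R : nzRingType) (f : {rmorphism R -> grB}) (x : grB) : commr_rmorph f x.
Proof. by move=> c; apply: mulrC. Qed.

Definition gr_phi1 : {rmorphism {poly K} -> grB} := horner_morph (comm_grB sg gr_y1).
Definition gr_phi2 : {rmorphism {poly {poly K}} -> grB} := horner_morph (comm_grB gr_phi1 gr_y2).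
Definition gr_phi : {rmorphism {poly {poly {poly K}}} -> grB} := horner_morph (comm_grB gr_phi2 gr_y3).

Section DerivPhi.
Variable D : grB -> grB.
Hypotheses (DD : forall x y, D (x + y) = D x + D y)
  (DM : forall x y, D (x * y) = D x * y + x * D y) (Ds : forall c, D (sg c) = 0).

Lemma deriv_gr_phi1 P : D (gr_phi1 P) = gr_phi1 P^`() * D gr_y1.
Proof.
have D0 : D 0 = 0 by have := Ds 0; rewrite /sg s_0 gr_cls0.
elim/poly_ind: P => [|P c IH]; first by rewrite deriv0 !rmorph0 mul0r.
rewrite derivMXaddC !rmorphD !rmorphM DD DM IH.
have -> : gr_phi1 c%:P = sg c by exact: horner_morphC.
have -> : gr_phi1 'X = gr_y1 by exact: horner_morphX.
by rewrite Ds addr0; ring.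
Qed.

Lemma deriv_gr_phi2 P : D (gr_phi2 P) = gr_phi2 (deriv2 P) * D gr_y1 + gr_phi2 P^`() * D gr_y2.
Proof.
have D0 : D 0 = 0 by have := Ds 0; rewrite /sg s_0 gr_cls0.
elim/poly_ind: P => [|P c IH]; first by rewrite /deriv2 map_poly0 deriv0 !rmorph0 !mul0r addr0.
rewrite derivMXaddC deriv2MXaddC !rmorphD !rmorphM DD DM IH.
have -> : gr_phi2 c%:P = gr_phi1 c by exact: horner_morphC.
have -> : gr_phi2 (c^`())%:P = gr_phi1 c^`() by exact: horner_morphC.
have -> : gr_phi2 'X = gr_y2 by exact: horner_morphX.
by rewrite deriv_gr_phi1; ring.
Qed.

(** The chain rule for a derivation killing scalars. It serves twice: for the brackets with the
    sources and for the arbitrary D of the conclusion. *)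
Lemma deriv_gr_phi P : D (gr_phi P) = gr_phi (deriv3 P) * D gr_y1 + gr_phi (deriv32 P) * D gr_y2 + gr_phi P^`() * D gr_y3.
Proof.
have D0 : D 0 = 0 by have := Ds 0; rewrite /sg s_0 gr_cls0.
elim/poly_ind: P => [|P c IH].
  by rewrite /deriv3 /deriv32 !map_poly0 deriv0 !rmorph0 !mul0r !addr0.
rewrite derivMXaddC deriv3MXaddC deriv32MXaddC.
rewrite !rmorphD !rmorphM DD DM IH.
have e c' : gr_phi c'%:P = gr_phi2 c' by exact: horner_morphC.
rewrite !e.
have -> : gr_phi 'X = gr_y3 by exact: horner_morphX.
by rewrite deriv_gr_phi2; ring.
Qed.

End DerivPhi.

Lemma Fmono e : F (- (ewt e)%:Z) (mK e).
Proof.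
have [_ f1] := gr_clsX e.1.1 Fy1; have [_ f2] := gr_clsX e.1.2 Fy2.
have [_ f3] := gr_clsX e.2 Fy3.
by have := filM (filM f1 f2) f3; rewrite /ewt; congr (fil F _ _); lia.
Qed.

Lemma Fterm c e : F (- (ewt e)%:Z) (s c * mK e).
Proof. by rewrite -[X in F X]add0r; apply: filM; [apply: F0|apply: Fmono]. Qed.

Lemma gr_phi_pm c e : gr_phi (pm c e) = cls (- (ewt e)%:Z) (s c * mK e).
Proof.
have e3 c' : gr_phi c'%:P = gr_phi2 c' by exact: horner_morphC.
have e2 c' : gr_phi2 c'%:P = gr_phi1 c' by exact: horner_morphC.
have e1 c' : gr_phi1 c'%:P = sg c' by exact: horner_morphC.
have x3 : gr_phi 'X = gr_y3 by exact: horner_morphX.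
have x2 : gr_phi2 'X = gr_y2 by exact: horner_morphX.
have x1 : gr_phi1 'X = gr_y1 by exact: horner_morphX.
rewrite /pm rmorphM rmorphXn e3 rmorphM rmorphXn e2 rmorphM rmorphXn e1 x1 x2 x3.
have [h1 f1] := gr_clsX e.1.1 Fy1; have [h2 f2] := gr_clsX e.1.2 Fy2.
have [h3 f3] := gr_clsX e.2 Fy3.
transitivity (cls 0 (s c) * cls (- 1) y1 ^+ e.1.1 * cls (- 1) y2 ^+ e.1.2 * cls (- 1) y3 ^+ e.2) => //.
rewrite h1 h2 h3 (gr_clsM (F0 (s c)) f1) (gr_clsM (filM (F0 (s c)) f1) f2).
rewrite (gr_clsM (filM (filM (F0 (s c)) f1) f2) f3) /mono !mulrA.
by congr (cls _ _); rewrite /ewt; lia.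
Qed.

Lemma gr_phi_surj (x : gr) : exists P, gr_phi P = x.
Proof.
have [t [tF ->]] := gr_sum_cls x; rewrite big_seq.
elim/big_ind: _ => [|_ _ [P <-] [Q <-]|u /tF].
- by exists 0; rewrite rmorph0.
- by exists (P + Q); rewrite rmorphD.
have [u0|/int_neg_nat[m ->]] := ltrP 0 u.1; first by exists 0; rewrite gr_cls_pos// rmorph0.
(* The box of size m suffices in degree -m, since m < p^m. *)
move=> um; have [d ud] := lead_hs (ltn_expl m p_gt1) um.
have Ft (b : box m) : ewt (bexp b) == m -> F (- m%:Z) (s (d b) * mK (bexp b)).
  by move=> /eqP bm; have := Fterm (d b) (bexp b); rewrite bm.
exists (\sum_(b : box m | ewt (bexp b) == m) pm (d b) (bexp b)).
transitivity (cls (- m%:Z) (hs m d)).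
  rewrite /hs gr_cls_sum// rmorph_sum; apply: eq_bigr => b /eqP bm.
  by rewrite /= gr_phi_pm bm.
apply/esym/gr_cls_eq => //; last by have -> : - m%:Z - 1 = - m.+1%:Z by lia.
rewrite /hs; elim/big_ind: _ => [||b /Ft//]; [exact: fil0|exact: filD].
Qed.

Lemma gr_phi_inj P : gr_phi P = 0 -> P = 0.
Proof.
have [k Pk] := pm_sum P p_gt1; rewrite {1}Pk rmorph_sum => P0.
have Pb (b : box k) : P`_b.2`_b.1.2`_b.1.1 = 0.
  have P1 : \sum_(b : box k) cls (- (ewt (bexp b))%:Z) (s P`_b.2`_b.1.2`_b.1.1 * mK (bexp b)) = 0.
    by rewrite -[RHS]P0; apply: eq_bigr => b' _; rewrite /= gr_phi_pm.
  have := gr_sum_cls_eq0 (fun b' : box k => Fterm P`_b'.2`_b'.1.2`_b'.1.1 (bexp b')) P1.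
  move=> /(_ (- (ewt (bexp b))%:Z)) H.
  apply: (@indep_hs k (ewt (bexp b)) (fun b' => P`_b'.2`_b'.1.2`_b'.1.1)) => //.
  have -> : - (ewt (bexp b)).+1%:Z = - (ewt (bexp b))%:Z - 1 by lia.
  move: H; congr (fil F _ _); apply: eq_bigl => b'.
  by rewrite eqr_opp.
by rewrite Pk big1// => b _; rewrite Pb /pm polyC0 mul0r polyC0 mul0r polyC0 mul0r.
Qed.

Definition bracket_poly (q a b c : nat) : {poly {poly {poly K}}} :=
  ('X%:P)%:P ^+ q *+ a + 'X%:P ^+ q *+ b + 'X ^+ q *+ c.

Lemma Fpow q y : F (- 1) y -> F (- q%:Z) (y ^+ q).
Proof. by move=> /(gr_clsX q)[_]; rewrite mulN1r. Qed.

Lemma F_bracket q a b c : F (- q%:Z) (y1 ^+ q *+ a + y2 ^+ q *+ b + y3 ^+ q *+ c).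
Proof.
have FM y n : F (- q%:Z) y -> F (- q%:Z) (y *+ n).
  by move=> Fy; elim: n => [|n IH]; rewrite ?mulr0n; [exact: fil0|rewrite mulrS; apply: filD].
by apply: filD; [apply: filD|]; apply: FM; apply: Fpow.
Qed.

Lemma gr_phi_bracket q a b c : gr_phi (bracket_poly q a b c) =
  cls (- q%:Z) (y1 ^+ q *+ a + y2 ^+ q *+ b + y3 ^+ q *+ c).
Proof.
have FM y n : F (- q%:Z) y -> F (- q%:Z) (y *+ n) /\ cls (- q%:Z) (y *+ n) = cls (- q%:Z) y *+ n.
  move=> Fy; elim: n => [|n [IH IH']]; rewrite ?mulr0n ?mulrS.
    by split; [exact: fil0|exact: gr_cls0].
  by split; [apply: filD|rewrite gr_clsD// IH'].
have X i y : F (- 1) y -> cls (- 1) y ^+ q *+ i = cls (- q%:Z) (y ^+ q *+ i) /\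
    F (- q%:Z) (y ^+ q *+ i).
  move=> Fy; have [FMi ->] := FM _ i (Fpow q Fy); split=> //.
  by have [-> _] := gr_clsX q Fy; rewrite mulN1r.
have [h1 f1] := X a _ Fy1; have [h2 f2] := X b _ Fy2; have [h3 f3] := X c _ Fy3.
rewrite (gr_clsD (filD f1 f2) f3) (gr_clsD f1 f2) -h1 -h2 -h3.
have e3 c' : gr_phi c'%:P = gr_phi2 c' by exact: horner_morphC.
have e2 c' : gr_phi2 c'%:P = gr_phi1 c' by exact: horner_morphC.
have x3 : gr_phi 'X = gr_y3 by exact: horner_morphX.
have x2 : gr_phi2 'X = gr_y2 by exact: horner_morphX.
have x1 : gr_phi1 'X = gr_y1 by exact: horner_morphX.
by rewrite !rmorphD !rmorphMn !rmorphXn !e3 e2 x1 x2 x3.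
Qed.

Lemma gr_der_phi u q (a1 b1 c1 a2 b2 c2 a3 b3 c3 : nat) : (0 < q)%N ->
  (forall k b, F k b -> F (k - q.-1%:Z) (commutator u b)) ->
  (forall c, commutator u (s c) = 0) ->
  F (- q.+1%:Z) (commutator u y1 - (y1 ^+ q *+ a1 + y2 ^+ q *+ b1 + y3 ^+ q *+ c1)) ->
  F (- q.+1%:Z) (commutator u y2 - (y1 ^+ q *+ a2 + y2 ^+ q *+ b2 + y3 ^+ q *+ c2)) ->
  F (- q.+1%:Z) (commutator u y3 - (y1 ^+ q *+ a3 + y2 ^+ q *+ b3 + y3 ^+ q *+ c3)) ->
  forall P, gr_der u q.-1 (gr_phi P : gr) = gr_phi (deriv3 P * bracket_poly q a1 b1 c1 +
    deriv32 P * bracket_poly q a2 b2 c2 + P^`() * bracket_poly q a3 b3 c3).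
Proof.
move=> q0 Fu us br1 br2 br3 P.
have gE y a b c : F (- 1) y -> F (- q.+1%:Z) (commutator u y - (y1 ^+ q *+ a + y2 ^+ q *+ b + y3 ^+ q *+ c)) ->
    gr_der u q.-1 (cls (- 1) y) = gr_phi (bracket_poly q a b c).
  move=> Fy Fb; rewrite (gr_der_cls Fu Fy) gr_phi_bracket.
  (* The generators have degree -1, so a bracket of order q - 1 lands in degree -q. *)
  have e : - 1 - q.-1%:Z = - q%:Z by lia.
  have := Fu _ _ Fy; rewrite e => Fuy; apply: gr_cls_eq => //; first exact: F_bracket.
  by have -> : - q%:Z - 1 = - q.+1%:Z by lia.
pose D : grB -> grB := gr_der u q.-1.
have -> : gr_der u q.-1 (gr_phi P : gr) = D (gr_phi P) by [].
rewrite (@deriv_gr_phi D); first last.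
- move=> c; rewrite /D /sg (gr_der_cls Fu (F0 _)) us; exact: gr_cls0.
- exact: (gr_der_mul Fu).
- exact: (gr_der_add Fu).
rewrite /D /gr_y1 /gr_y2 /gr_y3 (gE _ _ _ _ Fy1 br1) (gE _ _ _ _ Fy2 br2) (gE _ _ _ _ Fy3 br3).
by rewrite -!(rmorphM gr_phi) -!(rmorphD gr_phi).
Qed.

(** * From brackets of the generators to the derivation hypothesis *)

Section DerivationHypothesis.
Variables (A1 : set A) (l : nat).
Hypotheses (charKp : p%:R = 0 :> K) (two : 2%:R != 0 :> K).
Hypotheses (A1_0 : A1 0) (A1_s : forall c, A1 (s c)).

Definition source_bracket (a : derivation_source F A1) (y : A) (i j k : nat) : Prop :=
  forall r, F (- (p ^ (r + l)).+1%:Z) (commutator (a r) y -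
    (y1 ^+ (p ^ (r + l)) *+ i + y2 ^+ (p ^ (r + l)) *+ j + y3 ^+ (p ^ (r + l)) *+ k)).

Variables a1 a2 a3 : derivation_source F A1.
Hypotheses (a1_theta : forall r, theta a1 r = (p ^ (r + l)).-1)
  (a2_theta : forall r, theta a2 r = (p ^ (r + l)).-1)
  (a3_theta : forall r, theta a3 r = (p ^ (r + l)).-1).
Hypotheses (a1_s : forall r c, commutator (a1 r) (s c) = 0)
  (a2_s : forall r c, commutator (a2 r) (s c) = 0)
  (a3_s : forall r c, commutator (a3 r) (s c) = 0).
Hypotheses (b11 : source_bracket a1 y1 0 0 0) (b12 : source_bracket a1 y2 0 0 1)
  (b13 : source_bracket a1 y3 (p - 2) 0 0).
Hypotheses (b21 : source_bracket a2 y1 0 0 (p - 1)) (b22 : source_bracket a2 y2 0 0 0)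
  (b23 : source_bracket a2 y3 0 2 0).
Hypotheses (b31 : source_bracket a3 y1 2 0 0) (b32 : source_bracket a3 y2 0 (p - 2) 0)
  (b33 : source_bracket a3 y3 0 0 0).

Lemma gr_phi_multiple Q Z : principal_ideal (gr_phi Q : gr) (gr_phi Z) -> multiple Q Z.
Proof.
move=> [b bE]; have [B BE] := gr_phi_surj b; exists B; apply/eqP; rewrite -subr_eq0.
apply/eqP/gr_phi_inj; rewrite rmorphB rmorphM BE; apply/eqP; rewrite subr_eq0; apply/eqP.
exact: bE.
Qed.

Lemma bracket_derivation_hypothesis : derivation_hypothesis F A1.
Proof.
move=> X Y _ _ H D [DD DM DB1].
have [Q QX] := gr_phi_surj X; have [P PY] := gr_phi_surj Y; rewrite -QX -PY in H *.
have p_gt0 : (0 < p)%N by apply: ltnW.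
have q_gt0 r : (0 < p ^ (r + l))%N by rewrite expn_gt0 p_gt0.
have src_mult a i1 j1 k1 i2 j2 k2 i3 j3 k3 :
    (forall r, theta a r = (p ^ (r + l)).-1) -> (forall r c, commutator (a r) (s c) = 0) ->
    source_bracket a y1 i1 j1 k1 -> source_bracket a y2 i2 j2 k2 -> source_bracket a y3 i3 j3 k3 ->
    exists r0, forall r, (r0 <= r)%N -> multiple Q (deriv3 P * bracket_poly (p ^ (r + l)) i1 j1 k1 +
      deriv32 P * bracket_poly (p ^ (r + l)) i2 j2 k2 + P^`() * bracket_poly (p ^ (r + l)) i3 j3 k3).
  move=> ath as0 br1 br2 br3; have [r0 Hr] := H a; exists r0 => r r0r; apply: gr_phi_multiple.
  have Fa k b : F k b -> F (k - (p ^ (r + l)).-1%:Z) (commutator (a r) b).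
    by rewrite -ath; apply: src_theta.
  have := gr_der_phi (q_gt0 r) Fa (as0 r) (br1 r) (br2 r) (br3 r) P.
  by rewrite -ath => <-; apply: Hr.
have [r1 H1] := src_mult _ _ _ _ _ _ _ _ _ _ a1_theta a1_s b11 b12 b13.
have [r2 H2] := src_mult _ _ _ _ _ _ _ _ _ _ a2_theta a2_s b21 b22 b23.
have [r3 H3] := src_mult _ _ _ _ _ _ _ _ _ _ a3_theta a3_s b31 b32 b33.
have p0 : p%:R = 0 :> {poly {poly {poly K}}} by rewrite -3!polyC_natr charKp !polyC0.
have pB k : (k <= p)%N -> (p - k)%:R = - k%:R :> {poly {poly {poly K}}}.
  by move=> kp; rewrite natrB// p0 sub0r.
have zero3 : forall q', bracket_poly q' 0 0 0 = 0.
  by move=> q'; rewrite /bracket_poly !mulr0n !addr0.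
have [Qe Qf Qh] : [/\ multiple Q (deriv3 P), multiple Q (deriv32 P) & multiple Q P^`()].
  (* The exponent p^n belongs to index r = n - l, which must pass the thresholds of all three
     sources. *)
  apply: (@sl2_polynomials K p p_gt1 two Q _ _ _ (r1 + r2 + r3 + l)) => n rn q.
  pose r := (n - l)%N; have rl : (r + l = n)%N by rewrite subnK//; lia.
  have h1 : (r1 <= r)%N by lia.
  have h2 : (r2 <= r)%N by lia.
  have h3 : (r3 <= r)%N by lia.
  have := H1 r h1; have := H2 r h2; have := H3 r h3; rewrite rl -/q !zero3 !mulr0 => m3 m2 m1.
  have n2 : (p - 2)%:R = - 2%:R :> {poly {poly {poly K}}} := pB 2 p_gt1.
  have n1 : (p - 1)%:R = - 1%:R :> {poly {poly {poly K}}} := pB 1%N p_gt0.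
  split.
  - by move: m1; congr multiple; rewrite /bracket_poly -[_ *+ (p - 2)]mulr_natl n2; ring.
  - by move: m2; congr multiple; rewrite /bracket_poly -[_ *+ (p - 1)]mulr_natl n1; ring.
  - by move: m3; congr multiple; rewrite /bracket_poly -[_ *+ (p - 2)]mulr_natl n2; ring.
(* D kills 1 by the Leibniz rule, hence kills K by linearity over the image of [A1], which contains
   the scalars; this is what the chain rule asks for. *)
have D1 : D 1 = 0.
  apply: (addrI (D 1)); rewrite addr0; have := DM 1 1.
  by rewrite !mulr1 mul1r => e; rewrite -e.
have DsB c : D (sg c) = 0.
  rewrite -[sg c](mulr1 (sg c : gr)) DB1 ?D1 ?mulr0//.
  exists (Rees (gr_cls_subproof (F0 (s c)))); split; last by rewrite /sg (gr_clsE (F0 (s c))).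
  by move=> k /=; case: ifP.
have DE := @deriv_gr_phi D DD DM DsB P.
have pm Z x : multiple Q Z -> principal_ideal (gr_phi Q : gr) (gr_phi Z * x : grB).
  by move=> [b ->]; exists (gr_phi b * x); rewrite rmorphM -mulrA.
have pD x y : principal_ideal (gr_phi Q : gr) x -> principal_ideal (gr_phi Q : gr) y ->
    principal_ideal (gr_phi Q : gr) (x + y).
  by move=> [b ->] [c ->]; exists (b + c); rewrite mulrDr.
by rewrite DE; apply: (pD); [apply: (pD)|]; apply: (pm).
Qed.

End DerivationHypothesis.

End GrPolynomial.

(** * Sources of derivations *)

Section ChainDerivation.
Variables (p : nat) (p_prime : prime p) (p_ge3 : (3 <= p)%N).
Variables (K : fieldType) (charK : p \in [pchar K]).
Variables (l : nat) (l_ge1 : (1 <= l)%N) (G : groupType).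
Variables (N : nat -> nsubgroup G) (g : G * G * G).
Hypothesis uc : uniform_chain p l N g.
Variable tau : set (set G).
Hypothesis tauN : forall j, tau (nsg (N j)).
Hypothesis tau_cofinal : forall U : set G, tau U -> U 1%g -> exists j, forall x, N j x -> U x.
Local Notation KG := (cga K tau).
Local Notation F := (cga_filtration K tau).
Local Notation A1 := (cga_power K tau p).
Local Notation s := (@scK K G tau).
Local Notation Y1 := (cga_y1 K g tau).
Local Notation Y2 := (cga_y2 K g tau).
Local Notation Y3 := (cga_y3 K g tau).
Local Notation t := (@tK K G tau).

Lemma scKD c d : s (c + d) = s c + s d.
Proof. by rewrite /scK scD; apply/cgaP => M /=; rewrite gmapD. Qed.
Lemma scKM c d : s (c * d) = s c * s d.
Proof. by rewrite /scK scM cga_ofM. Qed.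
Lemma scK1 : s 1 = 1.
Proof. exact: cga_of1. Qed.
Lemma scK_central c x : commutator x (s c) = 0.
Proof.
apply/cgaP => M; rewrite -[LHS]/(commutator (cga_proj x M) (gmap (coset (sval M)) (sc G c))).
rewrite gmap_sc; last exact: cosetM.
by rewrite /commutator sc_comm subrr.
Qed.

Lemma F_all x : F 0 x. Proof. exact: cga_fil_ge0. Qed.

Lemma F_y x : F (- 1) (t x - 1).
Proof.
apply: (proj2 (cga_fil_lev p_prime p_ge3 charK l_ge1 tauN tau_cofinal 1 _)) => n.
by rewrite levB lev_t; apply: aug_power1_dl.
Qed.

Lemma scK_A1 c : A1 (s c).
Proof.
move=> M; exists (s c) => //; exists (sc G c) => // y.
have [-> _ H [H1 _] _//|ne] := eqVneq y 1%g.
by rewrite /= (negPf ne) eqxx.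
Qed.

Lemma A1_0 : A1 0.
Proof.
move=> M; exists 0 => //; exists 0; first by move=> y; rewrite gcoef0 eqxx.
by apply/cgaP => M' /=; rewrite gmap0.
Qed.

(** With q = p^(r+l) the gap is (p - 1)(q - 1), and q > r + l. *)
Lemma src_deg_infty M : exists r0, forall r, (r0 <= r)%N -> (src_deg p l r + M <= src_deg1 p l r)%N.
Proof.
exists M => r Mr; rewrite /src_deg /src_deg1 expnS.
have : (r + l < p ^ (r + l))%N by apply: ltn_expl; lia.
move: (p ^ (r + l))%N => q rq; nia.
Qed.

Lemma src_thetaF x r (k : int) (b : KG) : F k b ->
  F (k - (src_deg p l r)%:Z) (commutator (t (x ^+ (p ^ r))%g) b).
Proof.
move=> Fb; have H (m : nat) : F (- m%:Z) b ->
    F (- (m + src_deg p l r)%N%:Z) (commutator (t (x ^+ (p ^ r))%g) b).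
  exact: (cga_source_theta p_prime p_ge3 charK l_ge1 uc tauN tau_cofinal).
(* In positive degree the filtration is already everything, so the bound in degree 0 is stronger. *)
have [k0|/int_neg_nat[m km]] := ltrP 0 k; first by apply: fil_le (H 0%N (F_all b)); lia.
by rewrite km in Fb *; apply: fil_le (H m Fb); lia.
Qed.

Lemma src_theta1F x r (k : int) (b : KG) : F k b -> A1 b ->
  F (k - (src_deg1 p l r)%:Z) (commutator (t (x ^+ (p ^ r))%g) b).
Proof.
move=> Fb b1; have H (m : nat) : F (- m%:Z) b ->
    F (- (m + src_deg1 p l r)%N%:Z) (commutator (t (x ^+ (p ^ r))%g) b).
  by move=> bm; exact: (cga_source_theta1 p_prime p_ge3 charK l_ge1 uc tauN tau_cofinal).
have [k0|/int_neg_nat[m km]] := ltrP 0 k; first by apply: fil_le (H 0%N (F_all b)); lia.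
by rewrite km in Fb *; apply: fil_le (H m Fb); lia.
Qed.

Definition chain_source (x : G) : derivation_source F A1 :=
  @DerivationSource KG F A1 (fun r => t (x ^+ (p ^ r))%g) (src_deg p l) (src_deg1 p l)
    (@src_thetaF x) (@src_theta1F x) src_deg_infty.

Lemma chain_bracket_refl x : chain_bracket p l N g x x 0 0 0.
Proof.
move=> r; rewrite /word !muln0 !expg0 !mulg1 invg1 mul1g -expgSr expgS mulgK mulgV.
exact: nsg1.
Qed.

Lemma source_bracketF x y a b c : chain_bracket p l N g x y a b c ->
  source_bracket p Y1 Y2 Y3 l (chain_source x) (t y - 1) a b c.
Proof.
by move=> xy r; apply: (cga_source_bracket p_prime p_ge3 charK l_ge1 uc tauN tau_cofinal).
Qed.

Hypotheses (b12 : chain_bracket p l N g g.1.1 g.1.2 0 0 1)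
  (b13 : chain_bracket p l N g g.1.1 g.2 (p - 2) 0 0)
  (b23 : chain_bracket p l N g g.1.2 g.2 0 2 0)
  (b21 : chain_bracket p l N g g.1.2 g.1.1 0 0 (p - 1))
  (b31 : chain_bracket p l N g g.2 g.1.1 2 0 0)
  (b32 : chain_bracket p l N g g.2 g.1.2 0 (p - 2) 0).

Lemma chain_derivation_hypothesis : derivation_hypothesis F A1.
Proof.
have charKp : p%:R = 0 :> K by apply: pcharf0.
have two : 2%:R != 0 :> K.
  by rewrite -(dvdn_pcharf charK); apply/negP => /dvdn_leq => /(_ isT); lia.
apply: (bracket_derivation_hypothesis (prime_gt1 p_prime) F_all scKD scKM scK1
  (F_y _) (F_y _) (F_y _)
  (cga_gr_comm p_prime p_ge3 charK l_ge1 uc tauN tau_cofinal)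
  (hsumK_leading p_prime p_ge3 charK l_ge1 uc tauN tau_cofinal)
  (hsumK_independent p_prime p_ge3 charK l_ge1 uc tauN tau_cofinal)
  charKp two A1_0 scK_A1
  (a1 := chain_source g.1.1) (a2 := chain_source g.1.2) (a3 := chain_source g.2) (l := l)) => //.
all: try (by move=> r c; apply: scK_central).
all: apply: source_bracketF => //; exact: chain_bracket_refl.
Qed.
End ChainDerivation.

Theorem proposition6p10 (p : nat) (p_prime : prime p) (p_ge3 : (3 <= p)%N)
    (K : fieldType) (charK : p \in [pchar K]) (l : nat) (l_ge1 : (1 <= l)%N)
    (G : groupType) (expL : 'M[padic_int p_prime]_2 -> G)
    (expLG : is_exp l expL) :
  derivation_hypothesis (cga_filtration K (exp_open l expL))
    (cga_power K (exp_open l expL) p).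
Proof.
have [N [[[x y] z] [uc oN cof [[b12 b13 b23] [b21 b31 b32]]]]] := exp_chain p_ge3 l_ge1 expLG.
exact: (chain_derivation_hypothesis p_prime p_ge3 charK l_ge1 uc oN cof b12 b13 b23 b21 b31 b32).
Qed.
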